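(* Let $\ell\ge 1$ and let $\lambda,\mu$ be partitions with at most $\ell$ parts, where $\ell(\lambda)\le \ell$ and $\lambda_1\le \ell$. Suppose $\pi_j x_i\in(0,1)$ and $\rho_j x_i>0$ for all $i\ge 1$ and $1\le j\le \ell$. Set $\alpha_j=\rho_{j+1}$ and $\beta_j=\pi_{j+1}$ for $j\ge 1$, $\boldsymbol{\alpha}=(\alpha_1,\alpha_2,\dots)$, $\boldsymbol{\beta}=(\beta_1,\beta_2,\dots)$, $\boldsymbol{\pi}^{-1}=(\pi_1^{-1},\pi_2^{-1},\dots)$, $\boldsymbol{\rho}^{-1}=(\rho_1^{-1},\rho_2^{-1},\dots)$. Then for every $n\ge 1$ the $n$-step transition probabilities of the four particle processes are \begin{align*} \mathsf{P}_{A,n}(\lambda\mid\mu)&=\prod_{j=1}^{\ell}\prod_{i=1}^n(1-\pi_jx_i)\,\boldsymbol{\pi}^{\lambda/\mu}\,g_{\lambda/\mu}(\mathbf{x}_n;\boldsymbol{\pi}^{-1}),& \mathsf{P}_{B,n}(\lambda\mid\mu)&=\frac{\boldsymbol{\rho}^{\lambda/\mu}}{\prod_{i=1}^n(1+\rho_1x_i)}\,J_{\lambda'/\!/\mu'}(\mathbf{x}_n;\boldsymbol{\alpha}),\\ \mathsf{P}_{C,n}(\lambda\mid\mu)&=\prod_{i=1}^n(1-\pi_1x_i)\,\boldsymbol{\pi}^{\lambda/\mu}\,G_{\lambda/\!/\mu}(\mathbf{x}_n;\boldsymbol{\beta}),& \mathsf{P}_{D,n}(\lambda\mid\mu)&=\frac{\boldsymbol{\rho}^{\lambda/\mu}}{\prod_{j=1}^{\ell}\prod_{i=1}^n(1+\rho_jx_i)}\,j_{\lambda'/\mu'}(\mathbf{x}_n;\boldsymbol{\rho}^{-1}).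 \end{align*}
   Context: Particle systems. There are $\ell$ particles labelled $1,\dots,\ell$ on $\mathbb{Z}_{\ge0}$ (several may share a site). $G(j,i)$ denotes the position of particle $j$ after time step $i$; always $G(1,i)\ge G(2,i)\ge\dots\ge G(\ell,i)\ge 0$, so a configuration is identified with a partition $\lambda$ with at most $\ell$ parts ($\lambda_j$ = position of particle $j$). Parameters: time parameters $x_1,x_2,\dots$; particle parameters $\pi_1,\dots,\pi_\ell$ (geometric cases) or $\rho_1,\dots,\rho_\ell$ (Bernoulli cases), with the convention $\pi_j=\rho_j=0$ for $j>\ell$. At each time step $i$, independent random variables $w_{1i},\dots,w_{\ell i}$ are drawn, either geometric, $\mathsf{P}(w_{ji}=k)=(1-\pi_jx_i)(\pi_jx_i)^k$ for $k\in\mathbb{Z}_{\ge0}$, or Bernoulli, $\mathsf{P}(w_{ji}=1)=\rho_jx_i/(1+\rho_jx_i)$, $\mathsf{P}(w_{ji}=0)=1/(1+\rho_jx_i)$. Conventions: $G(0,i)=+\infty$, $G(\ell+1,i)=0$. Case A (geometric, pushing; particles updated in the order $\ell,\ell-1,\dots,1$): $G(j,i)=\max(G(j,i-1),G(j+1,i))+w_{ji}$. Case B (Bernoulli, blocking; order $1,\dots,\ell$): $G(j,i)=\min(G(j,i-1)+w_{ji},G(j-1,i))$. Case C (geometric, blocking; order $\ell,\dots,1$): $G(j,i)=\min(G(j,i-1)+w_{ji},G(j-1,i-1))$. Case D (Bernoulli, pushing; order $1,\dots,\ell$; particle $j$ jumps to $G(j,i-1)+w_{ji}$ and pushes to its new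 site every particle of smaller label lying to its left): $G(j,i)=\max_{j\le m\le\ell}(G(m,i-1)+w_{mi})$. $\mathsf{P}_{X,n}(\lambda\mid\mu)=\mathsf{P}(G(\cdot,n)=\lambda\mid G(\cdot,0)=\mu)$ for Case X. Notation: $\boldsymbol{\pi}^{\lambda/\mu}=\prod_j\pi_j^{\lambda_j-\mu_j}$, $\boldsymbol{\rho}^{\lambda/\mu}=\prod_j\rho_j^{\lambda_j-\mu_j}$; $\lambda'$ is the conjugate partition; $\mathbf{x}_n$ means setting $x_{n+1}=x_{n+2}=\dots=0$ in a function of $\mathbf{x}=(x_1,x_2,\dots)$. Symmetric functions. Boxes of a Young diagram (English convention) are indexed by (row, column). A hook tableau is a filling of a hook shape $(a,1^m)$ ($a\ge1,m\ge0$; arm $a-1$, leg $m$) with positive integers, the row weakly increasing and the column strictly increasing. A hook-valued tableau of skew shape $\lambda/\mu$ assigns to each box $b$ a hook tableau $T(b)$ such that $\max T(b)\le\min T(b')$ whenever $b'$ is immediately right of $b$, and $\max T(b)<\min T(b'')$ whenever $b''$ is immediately below $b$. For sequences $\boldsymbol{\alpha},\boldsymbol{\beta}$, $G_{\lambda/\mu}(\mathbf{x};\boldsymbol{\alpha},\boldsymbol{\beta})=\sum_T\prod_b(-\alpha_{c(b)})^{\mathrm{arm}(T(b))}(-\beta_{r(b)})^{\mathrm{leg}(T(b))}\prod_{e}x_e$, the sum over hook-valued tableaux of shape $\lambda/\mu$, the last product over all entries $e$ of $T(b)$, with $r(b),c(b)$ the row and column of $b$. For $\mu\subseteq\lambda$,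 $G_{\lambda/\!/\mu}(\mathbf{x};\boldsymbol{\alpha},\boldsymbol{\beta})=\sum_\nu\prod_{b\in\mu/\nu}\bigl(-(\alpha_{c(b)}+\beta_{r(b)})\bigr)G_{\lambda/\nu}(\mathbf{x};\boldsymbol{\alpha},\boldsymbol{\beta})$, summed over all $\nu$ obtained from $\mu$ by removing a subset of its corners (boxes $(r,\mu_r)$ with $\mu_r>\mu_{r+1}$); $G_{\lambda/\!/\mu}:=0$ if $\mu\not\subseteq\lambda$. Put $G_{\lambda/\!/\mu}(\mathbf{x};\boldsymbol{\beta})=G_{\lambda/\!/\mu}(\mathbf{x};0,\boldsymbol{\beta})$ and $J_{\lambda/\!/\mu}(\mathbf{x};\boldsymbol{\alpha})=G_{\lambda/\!/\mu}(\mathbf{x};\boldsymbol{\alpha},0)$. A reverse plane partition of shape $\lambda/\mu$ is a filling with positive integers weakly increasing along rows and down columns; a box $(r,c)$ is merged if $(r+1,c)$ is in $\lambda/\mu$ with the same entry. $g_{\lambda/\mu}(\mathbf{x};\boldsymbol{\beta})=\sum_T\prod_r\beta_r^{m_r(T)}\prod_{b\text{ not merged}}x_{T(b)}$, with $m_r(T)$ the number of merged boxes in row $r$; $g_{\lambda/\mu}:=0$ if $\mu\not\subseteq\lambda$. With $\omega$ the involution of symmetric functions with $\omega(s_\lambda)=s_{\lambda'}$, set $j_{\lambda/\mu}(\mathbf{x};\boldsymbol{\alpha})=\omega\bigl(g_{\lambda'/\mu'}(\mathbf{x};\boldsymbol{\alpha})\bigr)$. *)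

(* Defs.v *)
From HB Require Import structures.
From mathcomp Require Import all_boot all_order all_algebra.
From mathcomp Require Import finmap multiset.
From mathcomp Require Import all_classical all_reals all_analysis.

Set Implicit Arguments.
Unset Strict Implicit.
Unset Printing Implicit Defensive.

Import Order.TTheory GRing.Theory Num.Theory.

Local Open Scope classical_set_scope.
Local Open Scope ring_scope.

(* All indices are shifted to start at 0: [x i] is x_{i+1}, [pi j] is pi_{j+1},
   [nth 0%N lam r] is lambda_{r+1}, box (r, c) lies in row r+1 and column c+1,
   and a tableau entry e contributes the variable x_{e+1}. *)

Definition is_partition (lam : seq nat) : bool :=
  sorted geq lam && (0%N \notin lam).

Definition conj_part (lam : seq nat) : seq nat :=
  mkseq (fun c => count (fun p => (c < p)%N) lam) (head 0%N lam).

Definition sub_part (mu lam : seq nat) : bool :=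
  all (fun r => (nth 0%N mu r <= nth 0%N lam r)%N) (iota 0 (size mu)).

Definition skew_boxes (lam mu : seq nat) : seq (nat * nat) :=
  [seq (r, c) | r <- iota 0 (size lam),
                c <- iota (nth 0%N mu r) (nth 0%N lam r - nth 0%N mu r)].

Definition box (lam mu : seq nat) : finType := seq_sub (skew_boxes lam mu).

Definition right_of (lam mu : seq nat) (b b' : box lam mu) : bool :=
  val b' == ((val b).1, (val b).2.+1).

Definition below (lam mu : seq nat) (b b' : box lam mu) : bool :=
  val b' == ((val b).1.+1, (val b).2).

(* A monomial is a multiset of variable indices; a series is the family of its
   coefficients. *)
Definition monomial : Type := {mset nat}%mset.
Definition fps (R : Type) : Type := monomial -> R.

(* The degree-d homogeneous component of F(x_1, ..., x_n, 0, 0, ...), evaluated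
   at real numbers; the monomials of degree d are the sorted d-tuples. *)
Definition hcomp (R : realType) (n : nat) (x : nat -> R) (F : fps R) (d : nat)
    : R :=
  \sum_(t : d.-tuple 'I_n | sorted leq (map val t))
    F (seq_mset (map val t)) * \prod_(i <- t) x i.

(* v = r(1), where r = p/q is a rational function of one variable z, without
   pole at 1, whose power series expansion at z = 0 is \sum_d u_d z^d. *)
Definition rational_sum (R : realType) (u : nat -> R) (v : R) : Prop :=
  exists p q : {poly R},
    [/\ q.[1] != 0,
        forall k, \sum_(i < k.+1) q`_i * u (k - i)%N = p`_k
      & v = p.[1] / q.[1]].

Lemma rational_sum_unique (R : realType) (u : nat -> R) (v v' : R) :
  rational_sum u v -> rational_sum u v' -> v = v'.
Proof.
move=> [p [q [q1 qu ->]]] [p' [q' [q'1 q'u ->]]].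
have trunc (s r : {poly R}) k j :
    (forall k0, \sum_(i < k0.+1) s`_i * u (k0 - i)%N = r`_k0) ->
    (j <= k)%N -> r`_j = (s * \poly_(i < k.+1) u i)`_j.
  move=> su jk; rewrite -su coefM; apply: eq_bigr => i _.
  by rewrite coef_poly ltnS (leq_trans (leq_subr _ _) jk).
have eqp : q * p' = q' * p.
  apply/polyP => k; set U := \poly_(i < k.+1) u i.
  transitivity ((q * (q' * U))`_k).
    by rewrite !coefM; apply: eq_bigr => i _; rewrite (trunc _ _ k _ q'u) ?leq_subr.
  transitivity ((q' * (q * U))`_k); first by rewrite mulrCA.
  by rewrite !coefM; apply: eq_bigr => i _; rewrite (trunc _ _ k _ qu) ?leq_subr.
apply/eqP; rewrite eqr_div // -!hornerM (mulrC p) -eqp mulrC.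
by rewrite eqxx.
Qed.

(* F(x_1, ..., x_n, 0, 0, ...) at a real point.  A formal power series such as
   J_{(1)}(x_1; alpha) = \sum_k (- alpha_1)^k x_1^(k+1) = x_1 / (1 + alpha_1 x_1)
   stands for the rational function it expands, and need not converge at the
   given point; so the value is that of the rational function
   z |-> F(z x_1, ..., z x_n, 0, 0, ...) at z = 1.  When F has only finitely
   many terms in x_1, ..., x_n this is plain evaluation. *)
Definition fps_eval (R : realType) (n : nat) (x : nat -> R) (F : fps R) : R :=
  xget 0 [set v | rational_sum (hcomp n x F) v].

Lemma fps_eval_finite (R : realType) (n : nat) (x : nat -> R) (F : fps R)
    (D : nat) : (forall d, (D <= d)%N -> hcomp n x F d = 0) ->
  fps_eval n x F = \sum_(d < D) hcomp n x F d.
Proof.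
move=> F0; set v := \sum_(d < D) _.
suff Fv : rational_sum (hcomp n x F) v.
  by apply: xget_unique => // v' /rational_sum_unique; apply.
exists (\poly_(d < D) hcomp n x F d), 1.
split; rewrite ?hornerC ?oner_neq0 //.
  move=> k; rewrite big_ord_recl big1 => [|i _]; last by rewrite coefC mul0r.
  rewrite coefC eqxx mul1r addr0 subn0 coef_poly.
  by case: ltnP => // /F0.
rewrite divr1 horner_poly; apply: eq_bigr => i _.
by rewrite expr1n mulr1.
Qed.

(* (corner, rest of the row, rest of the column) *)
Definition hook : Type := (nat * seq nat * seq nat)%type.
Definition hook_arm (h : hook) : nat := size h.1.2.
Definition hook_leg (h : hook) : nat := size h.2.
Definition hook_entries (h : hook) : seq nat := h.1.1 :: h.1.2 ++ h.2.
Definition is_hook_tableau (h : hook) : bool :=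
  path leq h.1.1 h.1.2 && path ltn h.1.1 h.2.

Section SymmetricFunctions.
Variable R : realType.
Implicit Types (lam mu : seq nat) (alpha beta : nat -> R).

(* [allrel leq s s'] says max s <= min s', and similarly for [ltn]. *)
Definition is_hook_valued lam mu (T : {ffun box lam mu -> hook}) : bool :=
  [forall b, is_hook_tableau (T b)] &&
  [forall b, forall b',
     (right_of b b' ==> allrel leq (hook_entries (T b)) (hook_entries (T b')))
  && (below b b' ==> allrel ltn (hook_entries (T b)) (hook_entries (T b')))].

Definition hook_content lam mu (T : {ffun box lam mu -> hook}) : monomial :=
  seq_mset (flatten [seq hook_entries (T b) | b : box lam mu]).

(* G_{lam/mu}(x; alpha, beta) *)
Definition G_skew lam mu alpha beta : fps R := fun m =>
  \sum_(T \in [set T : {ffun box lam mu -> hook} |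
                 is_hook_valued T /\ hook_content T = m])
    \prod_(b : box lam mu)
      ((- alpha (val b).2) ^+ hook_arm (T b) *
       (- beta (val b).1) ^+ hook_leg (T b)).

Definition is_corner_row mu (r : nat) : bool := (nth 0%N mu r.+1 < nth 0%N mu r)%N.

Definition remove_corners mu (S : {set 'I_(size mu)}) : seq nat :=
  [seq (nth 0%N mu r - (r \in S))%N | r : 'I_(size mu)].

(* G_{lam//mu}(x; alpha, beta); S is the set of rows of the removed corners. *)
Definition G_dslash lam mu alpha beta : fps R := fun m =>
  if sub_part mu lam then
    \sum_(S : {set 'I_(size mu)} | [forall (r | r \in S), is_corner_row mu r])
      (\prod_(r in S) - (alpha (nth 0%N mu r).-1 + beta r)) *
      G_skew lam (remove_corners S) alpha beta m
  else 0.

Definition Gb_dslash lam mu beta : fps R := G_dslash lam mu (fun=> 0) beta.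

Definition J_dslash lam mu alpha : fps R := G_dslash lam mu alpha (fun=> 0).

Definition is_rpp lam mu (T : {ffun box lam mu -> nat}) : bool :=
  [forall b, forall b', (right_of b b' || below b b') ==> (T b <= T b')%N].

Definition merged lam mu (T : {ffun box lam mu -> nat}) (b : box lam mu)
    : bool := [exists b', below b b' && (T b' == T b)].

Definition merged_in_row lam mu (T : {ffun box lam mu -> nat}) (r : nat)
    : nat := #|[pred b | ((val b).1 == r) && merged T b]|.

Definition rpp_content lam mu (T : {ffun box lam mu -> nat}) : monomial :=
  seq_mset [seq T b | b in [pred b | ~~ merged T b]].

(* g_{lam/mu}(x; beta) *)
Definition g_skew lam mu beta : fps R := fun m =>
  if sub_part mu lam then
    \sum_(T \in [set T : {ffun box lam mu -> nat} |
                   is_rpp T /\ rpp_content T = m])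
      \prod_(r < size lam) beta r ^+ merged_in_row T r
  else 0.

Definition is_ssyt lam (T : {ffun box lam [::] -> nat}) : bool :=
  [forall b, forall b', (right_of b b' ==> (T b <= T b')%N)
                     && (below b b' ==> (T b < T b')%N)].

Definition schur lam : fps R := fun m =>
  \sum_(T \in [set T : {ffun box lam [::] -> nat} |
                 is_ssyt T /\ seq_mset [seq T b | b : box lam [::]] = m])
    (1 : R).

(* f = \sum_nu c_nu s_nu, a finite sum, and h = \sum_nu c_nu s_{nu'}. *)
Definition omega_graph (f h : fps R) : Prop :=
  exists (N : seq (seq nat)) (c : seq nat -> R),
    [/\ all is_partition N,
        forall m, f m = \sum_(nu <- N) c nu * schur nu m
      & forall m, h m = \sum_(nu <- N) c nu * schur (conj_part nu) m].

(* Single-valued because Schur functions are linearly independent; the default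
   0 is only used when f is not a symmetric function. *)
Definition omega (f : fps R) : fps R :=
  xget (fun=> 0) [set h | omega_graph f h].

(* j_{lam/mu}(x; alpha) *)
Definition j_skew lam mu alpha : fps R :=
  omega (g_skew (conj_part lam) (conj_part mu) alpha).

Definition skew_monomial (l : nat) (a : nat -> R) lam mu : R :=
  \prod_(j < l) a j ^ ((nth 0%N lam j)%:Z - (nth 0%N mu j)%:Z).

End SymmetricFunctions.

(* [G j i t] is the position of particle j+1 after i time steps at the sample
   point t; [w j i] is the variable w_{j+1,i+1} drawn at time step i+1. *)

Definition caseA (T : Type) (l : nat) (w G : nat -> nat -> T -> nat) : Prop :=
  forall j i t, (j < l)%N ->
    G j i.+1 t =
      (maxn (G j i t) (if (j.+1 < l)%N then G j.+1 i.+1 t else 0) + w j i t)%N.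

Definition caseB (T : Type) (l : nat) (w G : nat -> nat -> T -> nat) : Prop :=
  forall j i t, (j < l)%N ->
    G j i.+1 t = if j is j'.+1 then minn (G j i t + w j i t) (G j' i.+1 t)
                 else (G j i t + w j i t)%N.

Definition caseC (T : Type) (l : nat) (w G : nat -> nat -> T -> nat) : Prop :=
  forall j i t, (j < l)%N ->
    G j i.+1 t = if j is j'.+1 then minn (G j i t + w j i t) (G j' i t)
                 else (G j i t + w j i t)%N.

Definition caseD (T : Type) (l : nat) (w G : nat -> nat -> T -> nat) : Prop :=
  forall j i t, (j < l)%N ->
    G j i.+1 t = (\max_(j <= m < l) (G m i t + w m i t))%N.

Section Probability.
Context (R : realType) (d : measure_display) (T : measurableType d).
Variables (P : probability T R) (l : nat).
Implicit Types (w G : nat -> nat -> T -> nat).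

(* The w_{ji} and the initial configuration are random variables, mutually
   independent; [B = setT] gives the product rule for the w_{ji} alone. *)
Definition independent_drive w G : Prop :=
  [/\ forall j i, (j < l)%N -> measurable_fun setT (w j i),
      forall j, (j < l)%N -> measurable_fun setT (G j 0%N)
    & forall (B : set ('I_l -> nat)) (I : {fset 'I_l * nat})
             (A : 'I_l * nat -> set nat),
        (P ([set t | B (fun j => G j 0%N t)] `&`
            \bigcap_(k in [set` I]) (w k.1 k.2 @^-1` A k)) =
         P [set t | B (fun j => G j 0%N t)] *
         \prod_(k <- I) P (w k.1 k.2 @^-1` A k))%E].

Definition geometric_weights (pi x : nat -> R) w : Prop :=
  forall j i k, (j < l)%N ->
    P [set t | w j i t = k] =
      ((1 - pi j * x i) * (pi j * x i) ^+ k)%:E.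

Definition bernoulli_weights (rho x : nat -> R) w : Prop :=
  forall j i, (j < l)%N ->
    P [set t | w j i t = 1%N] = (rho j * x i / (1 + rho j * x i))%:E /\
    P [set t | w j i t = 0%N] = (1 / (1 + rho j * x i))%:E.

Definition config_at G (i : nat) (lam : seq nat) : set T :=
  [set t | forall j, (j < l)%N -> G j i t = nth 0%N lam j].

(* P(G(., n) = lam | G(., 0) = mu) *)
Definition transition_prob G (n : nat) (lam mu : seq nat) : R :=
  fine (P (config_at G n lam `&` config_at G 0 mu)) /
  fine (P (config_at G 0 mu)).

End Probability.

(* Main.v *)
(** Particle configurations are partitions, so an n-step transition probability
    is the sum, over the chains of shapes from mu to lam, of products of one-step
    kernels.  After conjugation by the row monomial pi^lam (or rho^lam) and
    extraction of the prefactor, each one-step kernel is a rational function of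
    the single time parameter x_i.

    On the other side, recording where the entries at most i lie turns a reverse
    plane partition or a hook-valued tableau with entries at most n into a chain
    mu = lam^0, ..., lam^n = lam, and its weight factors over the steps.  In cases
    B and C the removed corners of mu are exactly the boxes of mu that receive
    further entries.  Since the evaluation of rational functions is multiplicative,
    it remains to compare the one-variable kernels.

    For case D, omega has to be transported.  The kernels kD(x) and kA(x) satisfy
    kD(x) kD(y) = kD(y) kD(x) and kD(x) kA(-x) = 1, so their coefficients obey the
    relations between the e_a and the h_a; for beta = 0 they are the Pieri kernels
    of Young's lattice.  Hence the expansion of a monomial in the h_a in terms of
    monomials in the e_a is the same in both settings, and, by the triangularity of
    the Kostka numbers for the statistic n(nu) = sum_r r nu_r, the chains of kD
    compute omega(g_{lam/mu}). *)

Require Import Defs.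
From HB Require Import structures.
From mathcomp Require Import all_boot all_order all_algebra.
From mathcomp Require Import finmap multiset.
From mathcomp Require Import all_classical all_reals all_analysis.
From mathcomp Require Import zify ring.
Set Implicit Arguments.
Unset Strict Implicit.
Unset Printing Implicit Defensive.
Import Order.TTheory GRing.Theory Num.Theory.
Local Open Scope ring_scope.

(** * Chains and path sums *)

(** In cases B and C the probability factor of particle j+1 depends on whether particle j blocks it.
    This is a comparison of two adjacent rows of the old and new shapes, the same one that decides
    whether the last box of row j (case C) or column j (case B) may take another copy of the current
    entry. Hence the shift alpha_j = rho_{j+1}, beta_j = pi_{j+1}: particle 1 is never blocked and
    supplies the prefactor, and the surplus factor at the far end is 1 because the parameters vanish
    beyond l. Positions never decrease, so every intermediate configuration lies inside lam. With
    lam_1 <= l the states form a finite type, the shapes in the l by l square, which is closed under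
    transposition. Since [omega] is a relation between Schur expansions, an expansion of g_{lam/mu}
    has to be produced; g_{lam/mu} is not homogeneous, and its symmetry is not assumed. The
    coefficients come from the e side: the Kostka system is solved for the chains of kD, over shapes
    of area at most |lam/mu|. The word relations carry the resulting identity to the h words, whose
    values are the coefficients of g_{lam/mu}. *)

Section PathSums.
Variables (X : finType) (S : comNzRingType).
Implicit Types (W : nat -> X -> X -> S) (a z : X).

(** A chain stores its first n points only; from index n on it sits at the fixed end point [z].
    Chains thus form a finite type while [nx] is total on nat. *)
Definition nx n z (c : {ffun 'I_n -> X}) (i : nat) : X :=
  if insub i is Some j then c j else z.

(** The (a, z) entry of the matrix product W_0 W_1 ... W_{n-1}. *)
Definition psum n W a z : S :=
  \sum_(c : {ffun 'I_n -> X} | nx z c 0%N == a)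
    \prod_(i < n) W i (nx z c i) (nx z c i.+1).

Lemma nx_ord n z (c : {ffun 'I_n -> X}) (i : 'I_n) : nx z c i = c i.
Proof. by rewrite /nx; case: insubP => [j _ /val_inj ->|] //; rewrite ltn_ord. Qed.

Lemma nx_out n z (c : {ffun 'I_n -> X}) i : (n <= i)%N -> nx z c i = z.
Proof. by rewrite /nx => h; case: insubP => [j|] //; rewrite ltnNge h. Qed.

Lemma nx_ffun n z (f : nat -> X) i :
  nx z [ffun j : 'I_n => f j] i = if (i < n)%N then f i else z.
Proof.
by rewrite /nx; case: insubP => [j -> <-|/negbTE ->] //; rewrite ffunE.
Qed.

Definition nx_cons n a (c : {ffun 'I_n -> X}) : {ffun 'I_n.+1 -> X} :=
  [ffun i => oapp c a (unlift ord0 i)].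

Lemma nx_cons0 n z a (c : {ffun 'I_n -> X}) : nx z (nx_cons a c) 0%N = a.
Proof.
by rewrite -[0%N]/(nat_of_ord (@ord0 n)) nx_ord ffunE unlift_none.
Qed.

Lemma nx_consS n z a (c : {ffun 'I_n -> X}) i : nx z (nx_cons a c) i.+1 = nx z c i.
Proof.
case: (ltnP i n) => [lt_in|le_ni]; last by rewrite !nx_out.
rewrite -[i]/(nat_of_ord (Ordinal lt_in)) nx_ord.
rewrite -(_ : lift ord0 (Ordinal lt_in) = i.+1 :> nat) // nx_ord ffunE.
by rewrite liftK.
Qed.

Lemma psum0 W a z : psum 0 W a z = (a == z)%:R.
Proof.
rewrite /psum; under eq_bigl do rewrite nx_out // eq_sym.
under eq_bigr do rewrite big_ord0.
case: eqP => _; last by rewrite big_pred0.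
by rewrite sumr_const card_ffun !card_ord.
Qed.

Lemma psumS n W a z :
  psum n.+1 W a z = \sum_b W 0%N a b * psum n (fun i => W i.+1) b z.
Proof.
rewrite /psum.
rewrite (reindex (fun p : X * {ffun 'I_n -> X} => nx_cons p.1 p.2)) /=; last first.
  exists (fun c => (c ord0, [ffun i => c (lift ord0 i)])) => [[b c] _|c _].
    congr pair; first by rewrite ffunE unlift_none.
    by apply/ffunP => i; rewrite !ffunE liftK.
  apply/ffunP => i; rewrite !ffunE.
  by case: unliftP => [j|] -> //=; rewrite ffunE.
transitivity (\sum_(b | b == a) \sum_(c : {ffun 'I_n -> X})
    \prod_(i < n.+1) W i (nx z (nx_cons b c) i) (nx z (nx_cons b c) i.+1)).
  by rewrite pair_big /=; apply: eq_bigl => p; rewrite nx_cons0 andbT.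
rewrite big_pred1_eq (partition_big (fun c => nx z c 0%N) xpredT) //=.
apply: eq_bigr => b _; rewrite mulr_sumr; apply: eq_bigr => c /eqP <-.
rewrite big_ord_recl /= nx_cons0 nx_consS; congr (_ * _).
by apply: eq_bigr => i _; rewrite !nx_consS.
Qed.

(** Diagonal conjugation: the factors [s] and [t] of consecutive steps cancel at every interior
    point and survive only at the two ends. *)
Lemma psum_scale n W V (C : nat -> S) (s t : X -> S) a z :
  (forall b, s b * t b = 1) ->
  (forall i b c, (i < n)%N -> W i b c = C i * (t b * s c) * V i b c) ->
  psum n W a z = (\prod_(i < n) C i) * (t a * s z) * psum n V a z.
Proof.
move=> st hW.
elim: n a W V C hW => [|n IH] a W V C hW.
  rewrite !psum0 big_ord0 mul1r; case: eqP => [->|]; rewrite ?mulr0 //.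
  by rewrite mulrC mulrA mul1r mulrC st.
rewrite !psumS mulr_sumr big_ord_recl; apply: eq_bigr => b _.
rewrite hW // (IH _ _ (fun i => V i.+1) (fun i => C i.+1)); last by move=> *; apply: hW.
rewrite /bump /=; set p1 := psum _ _ _ _; set pr := \prod_(_ < _) _.
rewrite -[RHS]mulr1 -(st b); ring.
Qed.

Lemma eq_psum n W V a z : (forall i b c, (i < n)%N -> W i b c = V i b c) ->
  psum n W a z = psum n V a z.
Proof.
move=> h; apply: eq_bigr => c _; apply: eq_bigr => i _; exact: h.
Qed.

Lemma psum_inv n W (f : X -> X) a z : involutive f ->
  psum n W (f a) (f z) = psum n (fun i b c => W i (f b) (f c)) a z.
Proof.
move=> fK; elim: n a W => [|n IH] a W.
  by rewrite !psum0 (inv_eq fK) fK.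
rewrite !psumS (reindex_inj (inv_inj fK)); apply: eq_bigr => b _.
by rewrite IH.
Qed.

End PathSums.

(** * Homogeneous components of products of series *)

Section CauchyProducts.
Variables (S : comNzRingType).

(** The coefficient of degree d in the product of the series with coefficients [s i]; an exponent
    never exceeds d, which makes the index set finite. *)
Definition cprod (I : finType) (s : I -> nat -> S) (d : nat) : S :=
  \sum_(v : {ffun I -> 'I_d.+1} | (\sum_i v i)%N == d) \prod_i s i (v i).

Lemma coef_prod_poly (I : finType) (s : I -> nat -> S) D d :
  (\prod_i \poly_(j < D) s i j)`_d =
  \sum_(v : {ffun I -> 'I_D} | (\sum_i v i)%N == d) \prod_i s i (v i).
Proof.
under eq_bigr do rewrite poly_def.
rewrite bigA_distr_bigA /= coef_sum [RHS]big_mkcond /=; apply: eq_bigr => v _.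
rewrite scaler_prod.
have -> : \prod_i 'X^(v i) = 'X^(\sum_i v i)%N :> {poly S}.
  by elim/big_rec2: _ => [|i a b _ ->]; rewrite ?expr0 // exprD.
by rewrite coefZ coefXn eq_sym; case: eqP; rewrite ?mulr1 ?mulr0.
Qed.

Lemma coef_prod_trunc (I : finType) (s : I -> nat -> S) D D' d :
  (d < D)%N -> (d < D')%N ->
  (\prod_i \poly_(j < D) s i j)`_d = (\prod_i \poly_(j < D') s i j)`_d.
Proof.
move=> dD dD'.
suff : forall k, (k <= d)%N ->
  (\prod_i \poly_(j < D) s i j)`_k = (\prod_i \poly_(j < D') s i j)`_k by apply.
elim/big_rec2: _ => [//|i p q _ IH] k kd.
rewrite !coefM; apply: eq_bigr => j _; rewrite IH; last first.
  by rewrite (leq_trans _ kd) // leq_subr.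
have jk : (j <= d)%N by rewrite (leq_trans _ kd) // -ltnS.
by rewrite !coef_poly (leq_ltn_trans jk dD) (leq_ltn_trans jk dD').
Qed.

Lemma cprodE (I : finType) (s : I -> nat -> S) D d : (d < D)%N ->
  cprod s d = \sum_(v : {ffun I -> 'I_D} | (\sum_i v i)%N == d) \prod_i s i (v i).
Proof.
by move=> dD; rewrite /cprod -!coef_prod_poly; apply: coef_prod_trunc.
Qed.

Lemma cprod_poly (I : finType) (s : I -> nat -> S) D d : (d < D)%N ->
  cprod s d = (\prod_i \poly_(j < D) s i j)`_d.
Proof. by move=> dD; rewrite coef_prod_poly -cprodE. Qed.

Lemma cprod_scale (I : finType) (s : I -> nat -> S) x d :
  cprod s d * x ^+ d = cprod (fun i j => s i j * x ^+ j) d.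
Proof.
rewrite /cprod mulr_suml; apply: eq_bigr => v /eqP vd.
by rewrite big_split /= -expr_sum vd.
Qed.

End CauchyProducts.

(** * Shapes *)

Section Shapes.
Variable l : nat.

Definition is_shape (c : {ffun 'I_l -> 'I_l.+1}) : bool :=
  [forall r : 'I_l, (nx ord0 c r.+1 <= nx ord0 c r)%N].

(* Partitions whose diagram fits in the l x l square. *)
Definition shape : finType := {c : {ffun 'I_l -> 'I_l.+1} | is_shape c}.

Definition row (c : shape) (r : nat) : nat := nx ord0 (val c) r.

Lemma row_le (c : shape) r : (row c r <= l)%N.
Proof. by rewrite -ltnS ltn_ord. Qed.

Lemma row_out (c : shape) r : (l <= r)%N -> row c r = 0%N.
Proof. by move=> h; rewrite /row nx_out. Qed.

Lemma row_dec (c : shape) r : (row c r.+1 <= row c r)%N.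
Proof.
case: (ltnP r l) => [rl|lr]; last by rewrite !row_out // ltnW.
by have /forallP/(_ (Ordinal rl)) := valP c.
Qed.

Lemma shape_ext (c c' : shape) : (forall r, (r < l)%N -> row c r = row c' r) -> c = c'.
Proof.
move=> h; apply/val_inj/ffunP => i; apply/val_inj.
by rewrite -!(nx_ord ord0); apply: h.
Qed.

Lemma is_shape0 : is_shape [ffun => ord0].
Proof. by apply/forallP => r; rewrite /nx; case: insub => [j|]; rewrite ?ffunE. Qed.

Definition shape0 : shape := Sub [ffun => ord0] is_shape0.

(** Total by means of default values; under [shape_fun] none of them is reached ([row_mk]). *)
Definition mk_shape (f : nat -> nat) : shape :=
  insubd shape0 [ffun r : 'I_l => inord (f r)].

Definition shape_fun (f : nat -> nat) : Prop :=
  [/\ forall r, (f r.+1 <= f r)%N, (f 0 <= l)%N & forall r, (l <= r)%N -> f r = 0%N].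

Lemma row_mk f r : shape_fun f -> row (mk_shape f) r = f r.
Proof.
case=> fdec f0 fl.
have fle k : (f k <= l)%N by elim: k => // k IH; rewrite (leq_trans (fdec k)).
have nxf k : nx ord0 [ffun r : 'I_l => inord (f r) : 'I_l.+1] k = f k :> nat.
  rewrite (nx_ffun l ord0 (fun r => inord (f r))); case: ltnP => [_|/fl -> //].
  by rewrite inordK // ltnS.
have ok : is_shape [ffun r : 'I_l => inord (f r) : 'I_l.+1].
  by apply/forallP => k; rewrite !nxf.
by rewrite /row /mk_shape /insubd insubT /= nxf.
Qed.

Lemma row0 r : row shape0 r = 0%N.
Proof. by rewrite /row /= /nx; case: insub => [i|]; rewrite ?ffunE. Qed.

(** Transfer matrix along the rows: a shape is a weakly decreasing path of [l] row lengths followed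
    by 0, so a weight that is local in adjacent rows gives a path sum over 'I_l.+1. *)
Lemma sum_shape (S : comNzRingType) (w : nat -> nat -> nat -> S) :
  \sum_(k : shape) \prod_(r < l) w r (row k r) (row k r.+1) =
  \sum_(a : 'I_l.+1)
    psum l (fun r (a b : 'I_l.+1) => if (b <= a)%N then w r a b else 0) a ord0.
Proof.
transitivity (\sum_(c : {ffun 'I_l -> 'I_l.+1}) \prod_(r < l)
    if (nx ord0 c r.+1 <= nx ord0 c r)%N then w r (nx ord0 c r) (nx ord0 c r.+1)
    else 0); last first.
  by rewrite (partition_big (fun c : {ffun 'I_l -> 'I_l.+1} => nx ord0 c 0%N) xpredT).
rewrite [RHS](bigID is_shape) /= [X in _ + X]big1 ?addr0 => [|c]; last first.
  rewrite negb_forall => /existsP[r /negbTE h].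
  by rewrite (bigD1 r) //= h mul0r.
rewrite [RHS](reindex_omap (val : shape -> _) insub) => [|c sc]; last by rewrite insubT.
apply: eq_big => [k|k _]; first by rewrite (valP k) valK eqxx.
apply: eq_bigr => r _.
by have := row_dec k r; rewrite /row => ->.
Qed.

End Shapes.

(** A predicate closed downwards holds exactly below its cardinality. Column lengths and levels of
    boxes, defined as counts, are decoded this way. *)
Lemma count_initial (l : nat) (P : pred nat) r :
  (forall s, P s.+1 -> P s) -> (forall s, P s -> (s < l)%N) ->
  (r < \sum_(s < l) P s)%N = P r.
Proof.
move=> Pdec Pl.
have Pmon s t : (s <= t)%N -> P t -> P s.
  by move=> /subnK <-; elim: (t - s)%N => // k IH /Pdec.
have sumP k : (\sum_(s < k) P s <= k)%N.
  by rewrite -[X in (_ <= X)%N]card_ord -sum1_card; apply: leq_sum => i _; case: (P i).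
apply/idP/idP => [h|Pr].
  apply: contraLR h => nPr; rewrite -leqNgt.
  case: (leqP l r) => [lr|rl]; first exact: leq_trans (sumP _) lr.
  rewrite -(subnKC (ltnW rl)) big_split_ord /= [X in (_ + X)%N]big1 ?addn0 ?sumP //.
  move=> i _; case h: (P _) => //; move: nPr; rewrite (Pmon _ _ _ h) ?leq_addr //.
have rl := Pl _ Pr; rewrite -(subnKC rl) big_split_ord /=.
rewrite (eq_bigr (fun=> 1%N)) => [|i _]; last by rewrite (Pmon _ _ _ Pr) // -ltnS.
by rewrite sum_nat_const card_ord muln1 leq_addr.
Qed.

Section Transpose.
Variable l : nat.
Implicit Types c : shape l.

Definition tr c : shape l := mk_shape l (fun j => \sum_(r < l) (j < row c r))%N.

Lemma row_tr c j r : (r < row (tr c) j)%N = (j < row c r)%N.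
Proof.
rewrite row_mk; last first.
  split=> [k| |k lk].
  - by apply: leq_sum => i _; case: (ltnP k.+1) => // /ltnW ->.
  - rewrite -[X in (_ <= X)%N]card_ord -sum1_card.
    by apply: leq_sum => i _; case: (_ < _)%N.
  - by apply: big1 => i _; rewrite ltnNge (leq_trans (row_le _ _)).
rewrite (count_initial (l := l) (P := fun s => (j < row c s)%N)) // => s.
  by move=> h; rewrite (leq_trans h) // row_dec.
by case: (ltnP s l) => // /row_out ->.
Qed.

Lemma shape_ext_lt c c' : (forall r j, (j < row c r)%N = (j < row c' r)%N) -> c = c'.
Proof.
move=> h; apply: shape_ext => r _; apply/eqP; rewrite eqn_leq.
by rewrite leqNgt h ltnn leqNgt -h ltnn.
Qed.

Lemma trK : involutive tr.
Proof. by move=> c; apply: shape_ext_lt => r j; rewrite !row_tr. Qed.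

End Transpose.

(** Decides the comparisons in the goal by arithmetic, so that the cell weights become explicit
    expressions for [ring]. *)
Ltac bool_lia := repeat match goal with
  | |- context [leq ?a ?b] =>
     first [ rewrite (_ : leq a b = true); [|lia] | rewrite (_ : leq a b = false); [|lia] ]
  | |- context [@eq_op ?T ?a ?b] =>
     first [ rewrite (_ : @eq_op T a b = true); [|lia]
           | rewrite (_ : @eq_op T a b = false); [|lia] ]
  end; rewrite /= ?mulr0n ?mulr1n.

(** * Transfer sums along the rows *)

Section RowSums.
Variables (S : comNzRingType) (B : nat).
Implicit Types (W : nat -> nat -> nat -> S).

(** The path sum over row lengths again, with lengths in nat, so that it can be evaluated at [m] and
    [m.+1] without ordinals. *)
Fixpoint rsum s W (k : nat) : S :=
  if s is s'.+1 then \sum_(b < B) W 0%N k b * rsum s' (fun r => W r.+1) b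
  else (k == 0%N)%:R.

(** After a step of type D a row has one of two lengths, [m] or [m.+1]; the last hypothesis covers
    the case where [m.+1] is out of range. *)
Lemma sum_two (f : nat -> S) m : (m < B)%N ->
  (forall b, b != m -> b != m.+1 -> f b = 0) -> ((m.+1 < B)%N \/ f m.+1 = 0) ->
  \sum_(b < B) f b = f m + f m.+1.
Proof.
move=> mB f0 h; rewrite (bigD1 (Ordinal mB)) //=; congr (_ + _).
case: (ltnP m.+1 B) h => [m1B _|Bm1 [//|->]].
  rewrite (bigD1 (Ordinal m1B)) /=; last by rewrite -val_eqE /= gtn_eqF.
  rewrite big1 ?addr0 // => b /andP[b1 b2].
  by apply: f0; rewrite -?(val_eqE b).
rewrite big1 // => b b1; apply: f0; first by rewrite -val_eqE in b1.
by apply: contraTneq (ltn_ord b) => ->; rewrite -leqNgt.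
Qed.

End RowSums.

Lemma psum_rsum (S : comNzRingType) l s (W : nat -> nat -> nat -> S) (a : 'I_l.+1) :
  psum s (fun r (a b : 'I_l.+1) => W r a b) a ord0 = rsum l.+1 s W a.
Proof.
elim: s W a => [|s IH] W a; first by rewrite psum0 /= -val_eqE.
by rewrite psumS /=; apply: eq_bigr => b _; rewrite (IH (fun r => W r.+1)).
Qed.

(** * The one-step kernels of cases A and D *)

Section Kernels.
Variables (S : comNzRingType).
Implicit Types (x y : S) (beta : nat -> S).

(** A new box of the row is merged when its column is below [p'], the new length of the next row.
    This gives [p' - k] merged boxes, and [p - maxn k p'] boxes that carry [x]. *)
Definition cellA (b : S) x (k p p' : nat) : S :=
  if (k <= p)%N then b ^+ (p' - k) * x ^+ (p - maxn k p') else 0.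

(** A row grows by at most one box. The extra [b] appears when the next row ends up beyond the old
    end of this one: a particle pushed from behind. *)
Definition cellD (b : S) x (k p p' : nat) : S :=
  if p == k then 1 else if p == k.+1 then x + b *+ (k < p')%N else 0.

Definition kA l beta x (k p : shape l) : S :=
  \prod_(r < l) cellA (beta r) x (row k r) (row p r) (row p r.+1).

Definition kD l beta x (k p : shape l) : S :=
  \prod_(r < l) cellD (beta r) x (row k r) (row p r) (row p r.+1).

Definition wDD beta x y (m p : nat -> nat) (r k k' : nat) : S :=
  if (k' <= k)%N then cellD (beta r) x (m r) k k' * cellD (beta r) y k (p r) (p r.+1)
  else 0.

Definition wDA beta x y (m p : nat -> nat) (r k k' : nat) : S :=
  if (k' <= k)%N then cellD (beta r) x (m r) k k' * cellA (beta r) y k (p r) (p r.+1)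
  else 0.

Lemma cellD_supp b x k p p' : p != k -> p != k.+1 -> cellD b x k p p' = 0.
Proof. by rewrite /cellD => /negbTE -> /negbTE ->. Qed.

Section TwoSteps.
Variable l : nat.

Lemma rsum_DD_supp beta x y m p s k :
  (m s = 0 /\ p s = 0)%N -> (k != m 0%N) && (k != (m 0%N).+1) || (p 0%N != k) && (p 0%N != k.+1) ->
  rsum l.+1 s (wDD beta x y m p) k = 0.
Proof.
case: s => [|s] /= [m0 p0] h.
  by rewrite m0 p0 in h; case: k h.
rewrite big1 // => b _; rewrite /wDD; case: leqP => _; last by rewrite mul0r.
case/orP: h => /andP[h1 h2].
  by rewrite (cellD_supp _ _ _ h1 h2) !mul0r.
by rewrite (cellD_supp _ _ _ h1 h2) mulr0 mul0r.
Qed.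

(* The invariant that is propagated upwards from row to row: when the two steps
   together move the top row by one, the contributions q and q' of the first
   step moving it satisfy x q' = y q. *)
Lemma rsum_DD beta x y m p s :
  (forall r, m r.+1 <= m r)%N -> (forall r, p r.+1 <= p r)%N -> (p 0%N <= l)%N ->
  (m s = 0 /\ p s = 0)%N ->
  let f := rsum l.+1 s (wDD beta x y m p) in
  let f' := rsum l.+1 s (wDD beta y x m p) in
  if p 0%N == (m 0%N).+1 then
    x * f' (m 0%N).+1 = y * f (m 0%N).+1 /\ f (m 0%N) + f (m 0%N).+1 = f' (m 0%N) + f' (m 0%N).+1
  else forall k, f k = f' k.
Proof.
elim: s beta m p => [|s IH] beta m p mdec pdec pl [m0 p0].
  by rewrite /= m0 p0.
pose F := rsum l.+1 s (fun r => wDD beta x y m p r.+1).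
pose F' := rsum l.+1 s (fun r => wDD beta y x m p r.+1).
have HF : if p 1%N == (m 1%N).+1 then
    x * F' (m 1%N).+1 = y * F (m 1%N).+1 /\
    F (m 1%N) + F (m 1%N).+1 = F' (m 1%N) + F' (m 1%N).+1
  else forall k, F k = F' k.
  exact: (IH (fun r => beta r.+1) (fun r => m r.+1) (fun r => p r.+1)
    (fun r => mdec _) (fun r => pdec _) (leq_trans (pdec 0%N) pl) (conj m0 p0)).
rewrite /= -/F -/F'.
have sF k : (k != m 1%N) && (k != (m 1%N).+1) || (p 1%N != k) && (p 1%N != k.+1) -> F k = 0.
  exact: (@rsum_DD_supp (fun r => beta r.+1) x y (fun r => m r.+1) (fun r => p r.+1)).
have sF' k : (k != m 1%N) && (k != (m 1%N).+1) || (p 1%N != k) && (p 1%N != k.+1) -> F' k = 0.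
  exact: (@rsum_DD_supp (fun r => beta r.+1) y x (fun r => m r.+1) (fun r => p r.+1)).
have d0 := mdec 0%N; have e0 := pdec 0%N.
(* Two steps move a row by at most two boxes; outside this range both transfer sums vanish. *)
case: (boolP (m 1%N <= p 1%N <= (m 1%N).+2)%N) => [mp|nmp]; last first.
  have z k : F k = 0 by apply: sF; lia.
  have z' k : F' k = 0 by apply: sF'; lia.
  have sz k (W : nat -> nat -> nat -> S) : \sum_(b < l.+1) W 0%N k b * F b = 0.
    by apply: big1 => b _; rewrite z mulr0.
  have sz' k (W : nat -> nat -> nat -> S) : \sum_(b < l.+1) W 0%N k b * F' b = 0.
    by apply: big1 => b _; rewrite z' mulr0.
  by case: ifP => _; [split|move=> k]; rewrite !sz !sz' ?mulr0.
have two k (W : nat -> nat -> nat -> S) : \sum_(b < l.+1) W 0%N k b * F b =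
    W 0%N k (m 1%N) * F (m 1%N) + W 0%N k (m 1%N).+1 * F (m 1%N).+1.
  apply: (@sum_two S l.+1 (fun b : nat => (W 0%N k b * F b)%R) (m 1%N)); first by lia.
    by move=> b b1 b2; rewrite sF ?mulr0 // b1 b2.
  by case: (ltnP (m 1%N).+1 l.+1) => h; [left|right; rewrite sF ?mulr0 //; lia].
have two' k (W : nat -> nat -> nat -> S) : \sum_(b < l.+1) W 0%N k b * F' b =
    W 0%N k (m 1%N) * F' (m 1%N) + W 0%N k (m 1%N).+1 * F' (m 1%N).+1.
  apply: (@sum_two S l.+1 (fun b : nat => (W 0%N k b * F' b)%R) (m 1%N)); first by lia.
    by move=> b b1 b2; rewrite sF' ?mulr0 // b1 b2.
  by case: (ltnP (m 1%N).+1 l.+1) => h; [left|right; rewrite sF' ?mulr0 //; lia].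
have eqall (Q : nat -> Prop) : Q (m 0%N) -> Q (m 0%N).+1 ->
   (forall k, k != m 0%N -> k != (m 0%N).+1 -> Q k) -> forall k, Q k.
  move=> h1 h2 h3 k; case: (eqVneq k (m 0%N)) => [-> //|k1].
  by case: (eqVneq k (m 0%N).+1) => [-> //|k2]; apply: h3.
(* [u] and [q] collect the lower rows when the first step leaves row 1 in place or moves it. If row
   1 moves by 0 or 2 boxes in all, only one of the two is nonzero. *)
move: HF; set q := F (m 1%N).+1; set q' := F' (m 1%N).+1.
set u := F (m 1%N); set u' := F' (m 1%N) => HF.
have u0 : p 1%N = (m 1%N).+2 -> u = 0 by move=> h; apply: sF; lia.
have u0' : p 1%N = (m 1%N).+2 -> u' = 0 by move=> h; apply: sF'; lia.
have q0 : p 1%N = m 1%N -> q = 0 by move=> h; apply: sF; lia.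
have q0' : p 1%N = m 1%N -> q' = 0 by move=> h; apply: sF'; lia.
have {}two k (W : nat -> nat -> nat -> S) : \sum_(b < l.+1) W 0%N k b * F b =
    W 0%N k (m 1%N) * u + W 0%N k (m 1%N).+1 * q := two k W.
have {}two' k (W : nat -> nat -> nat -> S) : \sum_(b < l.+1) W 0%N k b * F' b =
    W 0%N k (m 1%N) * u' + W 0%N k (m 1%N).+1 * q' := two' k W.
have Hu : p 1%N = m 1%N -> u = u' by move=> e; move: HF; rewrite e ltn_eqF //; apply.
have Hq : p 1%N = (m 1%N).+2 -> q = q' by move=> e; move: HF; rewrite e gtn_eqF //; apply.
have Huq : p 1%N = (m 1%N).+1 -> x * q' = y * q /\ u + q = u' + q'.
  by move=> e; move: HF; rewrite e eqxx.
(* From here on the lower rows enter only through these four values and their relations; every case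
   left is an identity between a few cell weights. *)
clearbody u u' q q'.
have out k : k != m 0%N -> k != (m 0%N).+1 -> forall x y b, wDD beta x y m p 0%N k b = 0.
  by move=> k1 k2 x0 y0 b; rewrite /wDD; case: ifP => //; rewrite (cellD_supp _ _ _ k1 k2) mul0r.
have out2 k : p 0%N != k -> p 0%N != k.+1 -> forall x y b, wDD beta x y m p 0%N k b = 0.
  by move=> k1 k2 x0 y0 b; rewrite /wDD; case: ifP => // _; rewrite (cellD_supp _ _ _ k1 k2) mulr0.
have [p1|[p1|p1]] : (p 1%N = m 1%N \/ p 1%N = (m 1%N).+1 \/ p 1%N = (m 1%N).+2)%N by lia.
- have Eu := Hu p1.
  rewrite ?(q0 p1) ?(q0' p1) in two two' *.
  case: ifP => [/eqP p0'|p0'].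
    rewrite !two !two' ?mulr0 ?addr0 ?add0r /wDD /cellD p1 p0'; bool_lia; rewrite Eu; split; ring.
  apply: eqall => [||k k1 k2]; last by rewrite !two !two' !out // !mul0r.
    case: (eqVneq (p 0%N) (m 0%N)) => [p0''|p0'']; last by rewrite !two !two' !out2 ?mul0r //; lia.
    by rewrite !two !two' ?mulr0 ?addr0 ?add0r /wDD /cellD p1 p0''; bool_lia; rewrite Eu; ring.
  case: (eqVneq (p 0%N) (m 0%N).+2) => [p0''|p0'']; last by rewrite !two !two' !out2 ?mul0r //; lia.
  by rewrite !two !two' ?mulr0 ?addr0 ?add0r /wDD /cellD p1 p0''; bool_lia; rewrite Eu; ring.
- have [E1 E2] := Huq p1.
  (* The equality of sums eliminates [u']; the relation [x * q' = y * q] is handed to [ring]. *)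
  have {}E2 : u' = u + q - q' by rewrite E2; ring.
  (* Only for [m 0 = m 1] can row 1 pass the end of row 0 here and switch on [beta]. *)
  have [m01|m01] : (m 0%N = m 1%N \/ m 1%N < m 0%N)%N by lia.
    case: ifP => [/eqP p0'|p0'].
      rewrite !two !two' ?mulr0 ?addr0 ?add0r /wDD /cellD p1 p0' m01; bool_lia; rewrite /= E2.
      split; last by rewrite !mul1r ?mulr1n ?mulr0n; ring: E1.
      by rewrite ?mulr1n ?mulr0n; ring: E1.
    apply: eqall => [||k k1 k2]; last by rewrite !two !two' !out // !mul0r.
      by rewrite !two !two' !out2 ?mul0r //; lia.
    case: (eqVneq (p 0%N) (m 0%N).+2) => [p0''|p0'']; last by rewrite !two !two' !out2 ?mul0r //; lia.
    rewrite !two !two' ?mulr0 ?addr0 ?add0r /wDD /cellD p1 p0'' m01; bool_lia; rewrite /= E2.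
    by rewrite ?mulr1n ?mulr0n; ring: E1.
  case: ifP => [/eqP p0'|p0'].
    rewrite !two !two' ?mulr0 ?addr0 ?add0r /wDD /cellD p1 p0'; bool_lia; rewrite /= E2; split; rewrite ?mulr0n; ring.
  apply: eqall => [||k k1 k2]; last by rewrite !two !two' !out // !mul0r.
    case: (eqVneq (p 0%N) (m 0%N)) => [p0''|p0'']; last by rewrite !two !two' !out2 ?mul0r //; lia.
    by rewrite !two !two' ?mulr0 ?addr0 ?add0r /wDD /cellD p1 p0''; bool_lia; rewrite /= E2 ?mulr0n; ring.
  case: (eqVneq (p 0%N) (m 0%N).+2) => [p0''|p0'']; last by rewrite !two !two' !out2 ?mul0r //; lia.
  by rewrite !two !two' ?mulr0 ?addr0 ?add0r /wDD /cellD p1 p0''; bool_lia; rewrite /= E2 ?mulr0n; ring.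
- have Eq := Hq p1.
  rewrite ?(u0 p1) ?(u0' p1) in two two' *.
  (* Row 1 gains two boxes, so [beta] can occur in both steps, in the second one only, or not at
     all. *)
  have [m01|[m01|m01]] : (m 0%N = m 1%N \/ m 0%N = (m 1%N).+1 \/ (m 1%N).+1 < m 0%N)%N by lia.
  + case: ifP => [/eqP p0'|p0']; first by lia.
    apply: eqall => [||k k1 k2]; last by rewrite !two !two' !out // !mul0r.
      by rewrite !two !two' !out2 ?mul0r //; lia.
    case: (eqVneq (p 0%N) (m 0%N).+2) => [p0''|p0'']; last by rewrite !two !two' !out2 ?mul0r //; lia.
    rewrite !two !two' ?mulr0 ?addr0 ?add0r /wDD /cellD p1 p0'' m01; bool_lia; rewrite /= Eq ?mulr1n ?mulr0n; ring.
  + case: ifP => [/eqP p0'|p0'].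
      rewrite !two !two' ?mulr0 ?addr0 ?add0r /wDD /cellD p1 p0' m01; bool_lia; rewrite /= Eq ?mulr1n ?mulr0n; split; ring.
    apply: eqall => [||k k1 k2]; last by rewrite !two !two' !out // !mul0r.
      case: (eqVneq (p 0%N) (m 0%N)) => [p0''|p0'']; last by rewrite !two !two' !out2 ?mul0r //; lia.
      by lia.
    case: (eqVneq (p 0%N) (m 0%N).+2) => [p0''|p0'']; last by rewrite !two !two' !out2 ?mul0r //; lia.
    by rewrite !two !two' ?mulr0 ?addr0 ?add0r /wDD /cellD p1 p0'' m01; bool_lia; rewrite /= Eq ?mulr0n; ring.
  + case: ifP => [/eqP p0'|p0'].
      rewrite !two !two' ?mulr0 ?addr0 ?add0r /wDD /cellD p1 p0'; bool_lia; rewrite /= Eq ?mulr0n; split; ring.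
    apply: eqall => [||k k1 k2]; last by rewrite !two !two' !out // !mul0r.
      case: (eqVneq (p 0%N) (m 0%N)) => [p0''|p0'']; last by rewrite !two !two' !out2 ?mul0r //; lia.
      by rewrite !two !two' ?mulr0 ?addr0 ?add0r /wDD /cellD p1 p0''; bool_lia; rewrite /= Eq ?mulr0n; ring.
    case: (eqVneq (p 0%N) (m 0%N).+2) => [p0''|p0'']; last by rewrite !two !two' !out2 ?mul0r //; lia.
    by rewrite !two !two' ?mulr0 ?addr0 ?add0r /wDD /cellD p1 p0''; bool_lia; rewrite /= Eq ?mulr0n; ring.
Qed.

Lemma rsum_DA_supp beta x y m p s k :
  (m s = 0 /\ p s = 0)%N -> (k != m 0%N) && (k != (m 0%N).+1) || (p 0 < k)%N ->
  rsum l.+1 s (wDA beta x y m p) k = 0.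
Proof.
case: s => [|s] /= [m0 p0] h.
  by rewrite m0 p0 in h; case: k h => [|[|k]].
rewrite big1 // => b _; rewrite /wDA; case: leqP => _; last by rewrite mul0r.
case/orP: h => [/andP[h1 h2]|h].
  by rewrite (cellD_supp _ _ _ h1 h2) !mul0r.
by rewrite /cellA leqNgt h mulr0 mul0r.
Qed.

(** If the lower rows do not match, their two contributions are opposite and the current row
    preserves the cancellation. If they match, the current row contributes the telescoping sum
    [sp]. *)
Lemma rsum_DA beta x m p s :
  (forall r, m r.+1 <= m r)%N -> (forall r, p r.+1 <= p r)%N -> (p 0 <= l)%N ->
  (m 0 <= l)%N -> (m s = 0 /\ p s = 0)%N ->
  let f := rsum l.+1 s (wDA beta x (- x) m p) in
  f (m 0%N) + f (m 0%N).+1 = (all (fun r => p r == m r) (iota 0 s))%:R.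
Proof.
elim: s beta m p => [|s IH] beta m p mdec pdec pl ml [m0 p0].
  by rewrite /= m0 addr0.
pose F := rsum l.+1 s (fun r => wDA beta x (- x) m p r.+1).
have d0 := mdec 0%N; have e0 := pdec 0%N.
have HF : F (m 1%N) + F (m 1%N).+1 = (all (fun r => p r == m r) (iota 1 s))%:R.
  rewrite (iotaDl 1 0 s) all_map.
  exact: (IH (fun r => beta r.+1) (fun r => m r.+1) (fun r => p r.+1)
    (fun r => mdec _) (fun r => pdec _) (leq_trans e0 pl) (leq_trans d0 ml) (conj m0 p0)).
have sF k : (k != m 1%N) && (k != (m 1%N).+1) || (p 1 < k)%N -> F k = 0.
  exact: (@rsum_DA_supp (fun r => beta r.+1) x (- x) (fun r => m r.+1) (fun r => p r.+1)).
have two k : \sum_(b < l.+1) wDA beta x (- x) m p 0%N k b * F b =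
    wDA beta x (- x) m p 0%N k (m 1%N) * F (m 1%N) +
    wDA beta x (- x) m p 0%N k (m 1%N).+1 * F (m 1%N).+1.
  apply: (@sum_two S l.+1 (fun b : nat => (wDA beta x (- x) m p 0%N k b * F b)%R) (m 1%N)).
  - by rewrite ltnS (leq_trans d0).
  - by move=> b b1 b2; rewrite sF ?mulr0 // b1 b2.
  - by case: (ltnP (m 1%N).+1 l.+1) => h; [left|right; rewrite sF ?mulr0 //; lia].
(* Without [beta] the cancellation is (-x)^(e+1) + x (-x)^e = 0. *)
have sp : (p 1 <= m 0)%N ->
    cellA (beta 0%N) (- x) (m 0%N) (p 0%N) (p 1%N) +
    x * cellA (beta 0%N) (- x) (m 0%N).+1 (p 0%N) (p 1%N) = (p 0%N == m 0%N)%:R.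
  move=> h; rewrite /cellA; case: (ltngtP (m 0%N) (p 0%N)) => h'.
  - have [/eqP e1 /eqP e2] : (p 1%N - m 0%N == 0 /\ p 1%N - (m 0%N).+1 == 0)%N.
      by rewrite !subn_eq0 h leqW.
    rewrite !maxnE e1 e2 !addn0.
    by rewrite -[X in (- x) ^+ X](subnSK h') exprS mulr0n; ring.
  - by rewrite mulr0 addr0.
  - have /eqP e : (p 1%N - p 0%N == 0)%N by rewrite subn_eq0 -h'.
    by rewrite h' e mulr0 addr0 (maxn_idPl _) ?subnn ?mulr1 // -h'.
rewrite /= -/F !two.
move: HF; set u := F (m 1%N); set v := F (m 1%N).+1 => HF.
have v0 : (p 1 <= m 1)%N -> v = 0 by move=> h; apply: sF; rewrite ltnS h orbT.
have u0 : (p 1 < m 1)%N -> u = 0 by move=> h; apply: sF; rewrite h orbT.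
have ne1 : (p 1 <> m 1)%N -> all (fun r => p r == m r) (iota 1 s) = false.
  case: s {IH HF sF two u v v0 u0 F} m0 p0 => [|s] m0 p0 ne; first by rewrite m0 p0 in ne.
  by rewrite /= (introF eqP ne).
clearbody u v.
case: (leqP (p 1%N) (m 1%N)) => [pm|mp].
  move: HF; rewrite (v0 pm) addr0 => ->.
  transitivity ((cellA (beta 0%N) (- x) (m 0%N) (p 0%N) (p 1%N) +
    x * cellA (beta 0%N) (- x) (m 0%N).+1 (p 0%N) (p 1%N)) *
    (all (fun r => p r == m r) (iota 1 s))%:R).
    by rewrite !mulr0 /wDA /cellD; bool_lia; ring.
  by rewrite sp ?(leq_trans pm d0) // -mulnb natrM.
move: HF; rewrite ne1; last by lia.
move=> /eqP; rewrite addr_eq0 => /eqP ->; rewrite andbF.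
case: (ltnP (m 1%N) (m 0%N)) => h.
  (* Both lengths of row 1 get the same weight from row 0, so the opposite contributions cancel. *)
  by rewrite /wDA /cellD; bool_lia; ring.
have {}h : m 1%N = m 0%N by lia.
(* For [m 1 = m 0] the extra [beta] of the first step makes up for the additional power of [beta]
   that [cellA] has at [m 0] compared with [(m 0).+1]. *)
rewrite h in mp *; rewrite /wDA /cellD /cellA; bool_lia.
rewrite (maxn_idPr (ltnW mp)) (maxn_idPr mp).
rewrite -[X in beta 0%N ^+ X](subnSK mp) exprS.
by ring.
Qed.

End TwoSteps.

Lemma sum_rsum l (m p : shape l) (w : nat -> nat -> nat -> S) W :
  (forall r k k', W r k k' = if (k' <= k)%N then w r k k' else 0) ->
  (forall k, (k != row m 0) && (k != (row m 0).+1) || (row p 0 < k)%N ->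
     rsum l.+1 l W k = 0) ->
  \sum_(k : shape l) \prod_(r < l) w r (row k r) (row k r.+1) =
  rsum l.+1 l W (row m 0) + rsum l.+1 l W (row m 0).+1.
Proof.
move=> hW supp; rewrite sum_shape.
have E a : psum l (fun r (a b : 'I_l.+1) => if (b <= a)%N then w r a b else 0) a ord0
  = rsum l.+1 l W a.
  by rewrite -psum_rsum; apply: eq_psum => *; rewrite hW.
rewrite (eq_bigr _ (fun a _ => E a)).
apply: sum_two; first by rewrite ltnS row_le.
  by move=> b b1 b2; apply: supp; rewrite b1 b2.
case: (ltnP (row m 0).+1 l.+1) => h; [by left|right].
by apply: supp; rewrite (leq_ltn_trans (row_le p 0)) // orbT.
Qed.

Theorem kD_comm l beta x y (m p : shape l) :
  \sum_k kD beta x m k * kD beta y k p = \sum_k kD beta y m k * kD beta x k p.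
Proof.
have E x0 y0 : \sum_k kD beta x0 m k * kD beta y0 k p =
    rsum l.+1 l (wDD beta x0 y0 (row m) (row p)) (row m 0) +
    rsum l.+1 l (wDD beta x0 y0 (row m) (row p)) (row m 0).+1.
  rewrite /kD; under eq_bigr do rewrite -big_split /=.
  apply: (sum_rsum (p := p) (w := fun r k k' =>
    cellD (beta r) x0 (row m r) k k' * cellD (beta r) y0 k (row p r) (row p r.+1))) => //.
  move=> k h; apply: rsum_DD_supp; first by rewrite !row_out.
  by case/orP: h => [->//|h]; rewrite [X in _ || X](_ : _ = true) ?orbT //; lia.
rewrite !E.
have := @rsum_DD l beta x y (row m) (row p) l (row_dec m) (row_dec p) (row_le p 0).
rewrite (row_out m (leqnn l)) (row_out p (leqnn l)) => /(_ (conj erefl erefl)) /=.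
by case: ifP => [_ [_]//|_ h]; rewrite !h.
Qed.

Theorem kDA_inv l beta x (m p : shape l) :
  \sum_k kD beta x m k * kA beta (- x) k p = (m == p)%:R.
Proof.
rewrite /kD /kA; under eq_bigr do rewrite -big_split /=.
rewrite (@sum_rsum l m p (fun r k k' =>
    cellD (beta r) x (row m r) k k' * cellA (beta r) (- x) k (row p r) (row p r.+1))
    (wDA beta x (- x) (row m) (row p))) //; last first.
  by move=> k h; apply: rsum_DA_supp => //; rewrite !row_out.
rewrite (rsum_DA _ _ (row_dec m) (row_dec p) (row_le p 0) (row_le m 0)); last first.
  by rewrite !row_out.
congr (nat_of_bool _)%:R; apply/allP/eqP => [h|-> //].
apply: shape_ext => r rl; apply/esym/eqP/h; by rewrite mem_iota.
Qed.

End Kernels.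

(** * Coefficients of the kernels in the time parameter *)

Section CoefficientKernels.
Variables (R : comNzRingType) (l : nat).
Implicit Types (beta : nat -> R) (k p m : shape l).

Definition pA beta k p : {poly R} := kA (fun r => (beta r)%:P) 'X k p.
Definition pD beta k p : {poly R} := kD (fun r => (beta r)%:P) 'X k p.

Lemma horner_pA beta x k p : (pA beta k p).[x] = kA beta x k p.
Proof.
rewrite /pA /kA horner_prod; apply: eq_bigr => r _; rewrite /cellA.
by case: ifP; rewrite ?hornerE // -polyC_exp hornerE.
Qed.

Lemma horner_pD beta x k p : (pD beta k p).[x] = kD beta x k p.
Proof.
rewrite /pD /kD horner_prod; apply: eq_bigr => r _; rewrite /cellD.
case: ifP => _; rewrite ?hornerE //; case: ifP => _; rewrite ?hornerE //.
by case: (_ < _)%N; rewrite ?mulr1n ?mulr0n !hornerE.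
Qed.

Lemma kA_sub beta x k p r : (row p r < row k r)%N -> kA beta x k p = 0.
Proof.
case: (ltnP r l) => [rl|lr] h; last by rewrite !row_out in h.
by rewrite /kA (bigD1 (Ordinal rl)) //= /cellA leqNgt h mul0r.
Qed.

(** In the lowest row where the shapes differ the next row is unchanged, so there either the row
    shrinks or [x] has a positive exponent. *)
Lemma kA_0 beta k p : kA beta 0 k p = (k == p)%:R.
Proof.
case: (eqVneq k p) => [<-|nkp].
  rewrite /kA big1 // => r _; rewrite /cellA leqnn (maxn_idPl (row_dec _ _)) subnn.
  by rewrite (_ : _ - _ = 0)%N ?mulr1 //; apply/eqP; rewrite subn_eq0 row_dec.
case: (boolP [forall r : 'I_l, (row k r == row p r)]) => [/forallP h|].
  by case/eqP: nkp; apply: shape_ext => r rl; apply/eqP/(h (Ordinal rl)).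
rewrite negb_forall => /existsP[r0 hr0].
have [r [hr1 hr2]] : exists r : 'I_l, row k r != row p r /\
    forall s, (r < s)%N -> row k s = row p s.
  case: (@arg_maxnP _ r0 (fun r : 'I_l => row k r != row p r) (fun r => r) hr0) => r h1 h2.
  exists r; split=> // s rs; case: (ltnP s l) => [sl|ls]; last by rewrite !row_out.
  by apply/eqP; apply: contraTT rs => /(h2 (Ordinal sl)) /=; rewrite -leqNgt.
rewrite /kA (bigD1 r) //= /cellA; case: ifP => kp; last by rewrite mul0r.
rewrite expr0n -hr2 // (maxn_idPl (row_dec _ _)) subn_eq0.
by rewrite leqNgt ltn_neqAle hr1 kp /= mulr0 mul0r.
Qed.

(** The inversion formula at 0, where [kA] is already the identity. *)
Lemma kD_0 beta k p : kD beta 0 k p = (k == p)%:R.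
Proof.
rewrite -(kDA_inv beta 0) (bigD1 p) //= oppr0 kA_0 eqxx mulr1.
by rewrite big1 ?addr0 // => j /negbTE jp; rewrite kA_0 jp mulr0.
Qed.

Lemma pA_coef0 beta k p : (pA beta k p)`_0 = (k == p)%:R.
Proof. by rewrite -horner_coef0 horner_pA kA_0. Qed.

Lemma pD_coef0 beta k p : (pD beta k p)`_0 = (k == p)%:R.
Proof. by rewrite -horner_coef0 horner_pD kD_0. Qed.

(** Commutation is used over polynomials in two variables, ['X%:P] and ['X], and the coefficient of
    bidegree (a, b) is extracted. *)
Lemma pD_comm beta a b m p :
  \sum_k (pD beta m k)`_a * (pD beta k p)`_b =
  \sum_k (pD beta m k)`_b * (pD beta k p)`_a.
Proof.
pose B r := ((beta r)%:P)%:P : {poly {poly R}}.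
have E1 k k' : kD B 'X%:P k k' = (pD beta k k')%:P.
  rewrite /kD /pD /kD rmorph_prod; apply: eq_bigr => r _; rewrite /cellD /B.
  case: ifP => [_|_]; first by rewrite rmorph1.
  case: ifP => [_|_]; last by rewrite rmorph0.
  by rewrite rmorphD rmorphMn.
have E2 k k' : kD B 'X k k' = map_poly polyC (pD beta k k').
  rewrite /kD /pD /kD rmorph_prod; apply: eq_bigr => r _; rewrite /cellD /B.
  case: ifP => [_|_]; first by rewrite rmorph1.
  case: ifP => [_|_]; last by rewrite rmorph0.
  by rewrite rmorphD /= map_polyX rmorphMn /= map_polyC.
have /(congr1 (fun q : {poly {poly R}} => q`_b`_a)) := kD_comm B 'X%:P 'X m p.
rewrite !coef_sum; under eq_bigr do rewrite E1 E2 coefCM coef_map /= coefMC.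
move=> ->; apply: eq_bigr => k _.
by rewrite E1 E2 coefMC coef_map /= coefCM.
Qed.

(** The operator form of sum_a (-1)^(d-a) e_a h_{d-a} = [d = 0]: the inversion at ['X], in degree
    d. *)
Lemma pDA_inv beta d m p :
  \sum_(a < d.+1) (-1) ^+ (d - a) * \sum_k (pD beta m k)`_a * (pA beta k p)`_(d - a) =
  ((d == 0%N) && (m == p))%:R.
Proof.
have E k k' : kA (fun r => (beta r)%:P) (- 'X) k k' =
    \poly_(i < size (pA beta k k')) ((-1) ^+ i * (pA beta k k')`_i).
  transitivity (pA beta k k' \Po (- 'X)).
    rewrite /pA /kA rmorph_prod; apply: eq_bigr => r _; rewrite /cellA.
    by case: ifP => _; rewrite ?rmorph0 // rmorphM !rmorphXn /= comp_polyC comp_polyX.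
  rewrite comp_polyE poly_def; apply: eq_bigr => i _.
  rewrite (exprNn 'X) (_ : (-1) ^+ i = ((-1) ^+ i)%:P); last by rewrite rmorphXn rmorphN1.
  by rewrite mul_polyC scalerA mulrC.
have cE k k' i : (kA (fun r => (beta r)%:P) (- 'X) k k')`_i = (-1) ^+ i * (pA beta k k')`_i.
  by rewrite E coef_poly; case: ltnP => // /(nth_default 0) ->; rewrite mulr0.
have /(congr1 (fun q : {poly R} => q`_d)) := kDA_inv (fun r => (beta r)%:P) 'X m p.
rewrite coef_sum -polyC_natr coefC => h.
transitivity (if d == 0%N then (m == p)%:R else 0 : R); last by case: eqP.
rewrite -h; under eq_bigr do rewrite mulr_sumr.
rewrite exchange_big; apply: eq_bigr => k _; rewrite coefM; apply: eq_bigr => i _.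
by rewrite cE mulrCA.
Qed.

End CoefficientKernels.

(** * Words in the elementary and complete functions *)

(* Letters (false, a) and (true, a) stand for e_a and h_a. *)
Notation letter := (bool * nat)%type.

Section Words.
Variable R : comNzRingType.

(** [phi] stands for a linear functional on free words. Commutation is imposed on the e letters; the
    last relation expresses each h letter through e letters. *)
Definition word_relations (phi : seq letter -> R) : Prop :=
  [/\ forall u v b, phi (u ++ (b, 0%N) :: v) = phi (u ++ v),
      forall u v a b, phi (u ++ (false, a) :: (false, b) :: v) =
                      phi (u ++ (false, b) :: (false, a) :: v)
    & forall u v d, (0 < d)%N ->
      \sum_(a < d.+1) (-1) ^+ (d - a) * phi (u ++ (false, a : nat) :: (true, d - a)%N :: v) = 0].

Let ew (s : seq nat) : seq letter := [seq (false, a) | a <- s].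

Lemma word_perm phi s t : word_relations phi -> perm_eq s t -> phi (ew s) = phi (ew t).
Proof.
case=> _ comm _.
have swap u v x s1 : phi (u ++ ew (x :: s1) ++ v) = phi (u ++ ew (rcons s1 x) ++ v).
  elim: s1 u => // y s1 IH u; rewrite /= comm.
  by have := IH (rcons u (false, y)); rewrite -!cats1 -!catA.
suff gen u : perm_eq s t -> phi (u ++ ew s) = phi (u ++ ew t) by exact: (gen [::]).
elim: s t u => [|x s IH] t u st; first by rewrite (perm_nilP (_ : perm_eq t [::])) // perm_sym.
have /splitPr tE : x \in t by rewrite -(perm_mem st) mem_head.
case: tE st => t1 t2 st.
have {}st : perm_eq s (t1 ++ t2).
  by rewrite -(perm_cons x) (permPl st) perm_catC /= perm_cons perm_catC.
rewrite /= -cat_rcons (IH _ _ st) cat_rcons /ew !map_cat /=.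
have := swap u (ew t2) x t1; rewrite /ew map_rcons cat_rcons /= => ->.
by [].
Qed.

Lemma word_nonzero phi s : word_relations phi ->
  phi (ew s) = phi (ew [seq a <- s | (0 < a)%N]).
Proof.
case=> zero _ _.
suff gen u : phi (u ++ ew s) = phi (u ++ ew [seq a <- s | (0 < a)%N]) by exact: (gen [::]).
elim: s u => // -[|a] s IH u /=; first by rewrite zero.
by have := IH (rcons u (false, a.+1)); rewrite -!cats1 -!catA.
Qed.

(** Each h_a counts a + 1, so erasing h_0 lowers the weight, and so does replacing h_d by e_a
    h_{d-a} with a >= 1. *)
Let weight (w : seq letter) : nat := sumn [seq (if c.1 then c.2.+1 else 0)%N | c <- w].

(** Solving the alternating relation for h_d removes the h letters, by induction on the weight; a
    word in e letters can then be sorted and freed of e_0. *)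
Lemma word_zero phi : word_relations phi ->
  (forall s, sorted geq s -> all (leq 1) s -> phi (ew s) = 0) -> forall w, phi w = 0.
Proof.
move=> hphi h0.
have e0 s : phi (ew s) = 0.
  rewrite word_nonzero // (word_perm (t := sort geq [seq a <- s | (0 < a)%N])) //; last first.
    by rewrite perm_sym perm_sort.
  rewrite h0 //; first by apply: sort_sorted => a b; exact: leq_total.
  by rewrite all_sort filter_all.
move=> w; have [N] := ubnP (weight w); elim: N w => // N IH w.
rewrite ltnS => wN.
case: (boolP (has (fun c : letter => c.1) w)) => [|nh]; last first.
  rewrite (_ : w = ew (map snd w)) //.
  elim: w nh {wN} => //= -[[] a] w IHw //= /IHw <-; by [].
move=> /hasP[[b d] /= wbd hb]; rewrite {}hb in wbd.
case/splitPr: wbd wN => u v wN.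
have wt a c v' : weight (u ++ (false, a) :: (true, c) :: v') = weight (u ++ (true, c) :: v').
  by rewrite /weight !map_cat !sumn_cat.
case: hphi => zero _ rel.
case: d wN => [|d] wN.
  rewrite zero; apply: IH; apply: leq_trans wN.
  by rewrite /weight !map_cat !sumn_cat /= ltn_add2l.
(* The term a = 0 is the given word up to sign; all other terms have smaller weight. *)
have := rel u v d.+1 isT; rewrite big_ord_recl /= zero subn0.
rewrite big1 ?addr0 => [/(congr1 (fun y => (-1) ^+ d.+1 * y))|i _].
  by rewrite signrMK mulr0.
rewrite IH ?mulr0 //; apply: leq_trans wN; rewrite /bump /= wt.
rewrite /weight !map_cat !sumn_cat /= ltn_add2l ltn_add2r ltnS.
by rewrite add1n subSS ltnS leq_subr.
Qed.

Lemma word_relations_comb (I : Type) (r : seq I) (phi : seq letter -> R)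
    (c : I -> R) (psi : I -> seq letter -> R) :
  word_relations phi -> (forall i, word_relations (psi i)) ->
  word_relations (fun w => phi w - \sum_(i <- r) c i * psi i w).
Proof.
move=> [z1 c1 r1] h; split=> [u v b|u v a b|u v d d0].
- rewrite z1; congr (_ - _); apply: eq_bigr => i _; by have [-> _ _] := h i.
- rewrite c1; congr (_ - _); apply: eq_bigr => i _; by have [_ -> _] := h i.
- under eq_bigr do rewrite mulrBr mulr_sumr.
  rewrite big_split /= r1 // sumrN exchange_big /= big1 ?subr0 // => i _.
  have [_ _ r2] := h i; under eq_bigr do rewrite mulrCA.
  by rewrite -mulr_sumr r2 ?mulr0.
Qed.

(** * Words of operators on shapes *)

Section ShapeWords.
Variable l : nat.
Implicit Types (beta : nat -> R) (k p a z : shape l).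

Definition kletter beta (c : letter) k p : R :=
  if c.1 then (pA beta k p)`_c.2 else (pD beta k p)`_c.2.

(** The (a, z) entry of the product of the operators attached to the letters, e_a acting by the
    coefficients of [kD] and h_a by those of [kA]. *)
Definition kword beta (w : seq letter) a z : R :=
  psum (size w) (fun i => kletter beta (nth (false, 0%N) w i)) a z.

Lemma kword_nil beta a z : kword beta [::] a z = (a == z)%:R.
Proof. exact: psum0. Qed.

Lemma kword_cons beta c w a z :
  kword beta (c :: w) a z = \sum_b kletter beta c a b * kword beta w b z.
Proof. by rewrite /kword psumS. Qed.

Lemma kword_cat beta u w a z :
  kword beta (u ++ w) a z = \sum_b kword beta u a b * kword beta w b z.
Proof.
elim: u a => [|c u IH] a /=.
  rewrite (bigD1 a) //= big1 ?addr0 => [|b /negbTE ba].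
    by rewrite kword_nil eqxx mul1r.
  by rewrite kword_nil eq_sym ba mul0r.
rewrite kword_cons.
transitivity (\sum_j \sum_b kletter beta c a j * (kword beta u j b * kword beta w b z)).
  by apply: eq_bigr => b _; rewrite IH mulr_sumr.
rewrite exchange_big; apply: eq_bigr => b _; rewrite kword_cons mulr_suml.
by apply: eq_bigr => j _; rewrite mulrA.
Qed.

Lemma kword_relations beta a z : word_relations (fun w => kword beta w a z).
Proof.
split=> [u v b|u v c d|u v d d0].
- rewrite !kword_cat; apply: eq_bigr => j _; congr (_ * _).
  rewrite kword_cons (bigD1 j) //= big1 ?addr0 => [|i /negbTE ij].
    by case: b; rewrite /kletter /= ?pA_coef0 ?pD_coef0 eqxx mul1r.
  by case: b; rewrite /kletter /= ?pA_coef0 ?pD_coef0 eq_sym ij mul0r.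
- rewrite !kword_cat; apply: eq_bigr => j _; congr (_ * _).
  rewrite !kword_cons.
  under eq_bigr do rewrite kword_cons mulr_sumr.
  under [RHS]eq_bigr do rewrite kword_cons mulr_sumr.
  rewrite exchange_big [RHS]exchange_big; apply: eq_bigr => i _ /=.
  under eq_bigr do rewrite mulrA; under [RHS]eq_bigr do rewrite mulrA.
  by rewrite -!mulr_suml; congr (_ * _); exact: pD_comm.
- under eq_bigr do rewrite kword_cat mulr_sumr.
  rewrite exchange_big big1 // => j _ /=.
  under eq_bigr do rewrite mulrCA.
  rewrite -mulr_sumr [X in _ * X](_ : _ = 0) ?mulr0 //.
  transitivity (\sum_i kword beta v i z * (\sum_(c < d.+1) (-1) ^+ (d - c) *
     \sum_k (pD beta j k)`_c * (pA beta k i)`_(d - c))); last first.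
    by apply: big1 => i _; rewrite pDA_inv gtn_eqF // mulr0.
  under [RHS]eq_bigr do rewrite mulr_sumr.
  rewrite exchange_big /=; apply: eq_bigr => c _.
  transitivity ((-1) ^+ (d - c) * \sum_k \sum_i (pD beta j k)`_c *
      ((pA beta k i)`_(d - c) * kword beta v i z)).
    rewrite kword_cons; congr (_ * _); apply: eq_bigr => k _.
    by rewrite kword_cons mulr_sumr.
  rewrite exchange_big mulr_sumr; apply: eq_bigr => i _ /=.
  rewrite mulrCA; congr (_ * _); rewrite mulr_sumr; apply: eq_bigr => k _.
  by ring.
Qed.

End ShapeWords.
End Words.

(** * Evaluation of path sums *)

Section RationalSums.
Variable R : realType.
Implicit Types (u : nat -> R) (x : R).

(** The convolution condition becomes an identity of low-degree coefficients of polynomials, so that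
    sums and products of rational series reduce to polynomial algebra. *)
Lemma rational_truncP (p q : {poly R}) u :
  (forall k, \sum_(i < k.+1) q`_i * u (k - i)%N = p`_k) <->
  (forall k D, (k < D)%N -> (q * \poly_(i < D) u i)`_k = p`_k).
Proof.
have E k D : (k < D)%N ->
    (q * \poly_(i < D) u i)`_k = \sum_(i < k.+1) q`_i * u (k - i)%N.
  move=> kD; rewrite coefM; apply: eq_bigr => i _.
  by rewrite coef_poly (leq_ltn_trans (leq_subr _ _) kD).
by split=> h k => [D kD|]; rewrite -?h ?E // -(h k k.+1) // E.
Qed.

Lemma rational_sum_ext u u' v : u =1 u' -> rational_sum u v -> rational_sum u' v.
Proof.
move=> uu' [p [q [q1 qu ->]]]; exists p, q; split=> // k.
by rewrite -qu; apply: eq_bigr => i _; rewrite uu'.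
Qed.

Lemma rational_sum_poly (p : {poly R}) x : rational_sum (fun d => p`_d * x ^+ d) p.[x].
Proof.
exists (\poly_(i < size p) (p`_i * x ^+ i)), 1; split; rewrite ?hornerC ?oner_neq0 //.
  move=> k; rewrite big_ord_recl big1 => [|i _]; last by rewrite coefC mul0r.
  rewrite coefC eqxx mul1r addr0 subn0 coef_poly.
  by case: ltnP => // /(nth_default 0) ->; rewrite mul0r.
rewrite divr1 horner_poly horner_coef; apply: eq_bigr => i _.
by rewrite expr1n mulr1.
Qed.

Lemma rational_sumD u1 u2 v1 v2 : rational_sum u1 v1 -> rational_sum u2 v2 ->
  rational_sum (fun d => u1 d + u2 d) (v1 + v2).
Proof.
move=> [p1 [q1 [n1 /rational_truncP h1 ->]]] [p2 [q2 [n2 /rational_truncP h2 ->]]].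
exists (p1 * q2 + p2 * q1), (q1 * q2); split.
- by rewrite hornerM mulf_neq0.
- have [_ H] := rational_truncP (p1 * q2 + p2 * q1) (q1 * q2) (fun d => u1 d + u2 d).
  apply: H => k D kD.
  rewrite (_ : \poly_(i < D) _ = \poly_(i < D) u1 i + \poly_(i < D) u2 i); last first.
    by apply/polyP => i; rewrite coefD !coef_poly; case: ifP; rewrite ?addr0.
  set U1 := \poly_(i < D) u1 i; set U2 := \poly_(i < D) u2 i.
  rewrite (_ : _ * (U1 + U2) = q2 * (q1 * U1) + q1 * (q2 * U2)); last by ring.
  rewrite (mulrC p1) (mulrC p2) !coefD !coefM.
  by congr (_ + _); apply: eq_bigr => i _; congr (_ * _); [rewrite h1|rewrite h2];
     rewrite // (leq_ltn_trans (leq_subr _ _)).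
- by rewrite hornerD !hornerM addf_div.
Qed.

Lemma rational_sum_sum (I : Type) (r : seq I) (P : pred I) (u : I -> nat -> R) (v : I -> R) :
  (forall i, P i -> rational_sum (u i) (v i)) ->
  rational_sum (fun d => \sum_(i <- r | P i) u i d) (\sum_(i <- r | P i) v i).
Proof.
move=> h; elim: r => [|i r IH].
  rewrite big_nil; apply: (@rational_sum_ext (fun d => (0 : {poly R})`_d * 0 ^+ d)).
    by move=> d; rewrite big_nil coef0 mul0r.
  by rewrite -[X in rational_sum _ X](horner0 0); exact: rational_sum_poly.
rewrite big_cons; case: ifP => Pi; last first.
  by apply: rational_sum_ext IH => d; rewrite big_cons Pi.
apply: (@rational_sum_ext (fun d => u i d + \sum_(i <- r | P i) u i d)).
  by move=> d; rewrite big_cons Pi.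
by apply: rational_sumD => //; exact: h.
Qed.

Lemma coef_prod_eq (I : finType) (a b : I -> {poly R}) k :
  (forall i j, (j <= k)%N -> (a i)`_j = (b i)`_j) ->
  forall j, (j <= k)%N -> (\prod_i a i)`_j = (\prod_i b i)`_j.
Proof.
move=> h; elim/big_rec2: _ => // i p q _ IH j jk.
rewrite !coefM; apply: eq_bigr => s _; rewrite IH ?(leq_trans (leq_subr _ _)) //.
by rewrite h // (leq_trans _ jk) // -ltnS.
Qed.

(** Multiplicativity of the evaluation: numerators and denominators multiply, because a coefficient
    of degree k of a product depends on the factors up to degree k only. *)
Lemma rational_sum_cprod (I : finType) (s : I -> nat -> R) (V : I -> R) :
  (forall i, rational_sum (s i) (V i)) -> rational_sum (cprod s) (\prod_i V i).
Proof.
move=> /choice[p /choice[q h]].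
exists (\prod_i p i), (\prod_i q i); split.
- rewrite horner_prod; apply/prodf_neq0 => i _; by case: (h i).
- have [_ H] := rational_truncP (\prod_i p i) (\prod_i q i) (cprod s).
  apply: H => k D kD.
  transitivity ((\prod_i (q i * \poly_(j < D) s i j))`_k).
    rewrite big_split /= !coefM; apply: eq_bigr => i _; congr (_ * _).
    by rewrite coef_poly (leq_ltn_trans (leq_subr _ _) kD) -cprod_poly //
       (leq_ltn_trans (leq_subr _ _)).
  apply: (@coef_prod_eq _ _ _ k) => // i j jk.
  by have [_ /rational_truncP h1 _] := h i; rewrite h1 // (leq_ltn_trans jk).
- by rewrite !horner_prod -prodf_div; apply: eq_bigr => i _; case: (h i).
Qed.

Lemma rational_sum_geom a x : 1 + a * x != 0 ->
  rational_sum (fun d => (- a) ^+ d * x ^+ d) (1 + a * x)^-1.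
Proof.
move=> ax; exists 1, (1 + (a * x) *: 'X); split; rewrite ?hornerE //.
  case=> [|k]; first by rewrite big_ord_recl big_ord0 coefD coefZ coefX !coefC /= mulr0 !addr0 !expr0 !mulr1.
  rewrite big_ord_recl big_ord_recl /= big1 ?addr0 => [|i _]; last first.
    by rewrite coefD coefZ coefX !coefC /= mulr0 addr0 mul0r.
  rewrite !coefD !coefZ !coefX !coefC /= subn0 subSS subn0 !exprS.
  by rewrite mulr0 addr0 add0r mulr1; ring.
Qed.

Lemma rational_sum_geomS a x : 1 + a * x != 0 ->
  rational_sum (fun d => if d is e.+1 then (- a) ^+ e * x ^+ d else 0) (x / (1 + a * x)).
Proof.
move=> ax; exists (x *: 'X), (1 + (a * x) *: 'X); split; rewrite ?hornerE //.
case=> [|[|k]].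
- by rewrite big_ord_recl big_ord0 coefZ coefX !mulr0 addr0.
- rewrite !big_ord_recl big_ord0 /= !coefD !coefZ !coefX !coefC /= !expr0.
  by rewrite ?expr1; ring.
rewrite big_ord_recl big_ord_recl /= big1 ?addr0 => [|i _]; last first.
  by rewrite coefD coefZ coefX !coefC /= mulr0 addr0 mul0r.
rewrite !coefD !coefZ !coefX !coefC /= subn0 subSS subn0 !exprS.
by rewrite !mulr0 addr0 add0r mulr1; ring.
Qed.

Lemma fps_evalE n (x : nat -> R) (F : fps R) v :
  rational_sum (hcomp n x F) v -> fps_eval n x F = v.
Proof.
by move=> Fv; apply: xget_unique => // v' /rational_sum_unique; apply.
Qed.

Lemma mset_ext (m m' : {mset nat}%mset) : (forall i, m i = m' i) -> m = m'.
Proof. by move=> h; apply/msetP. Qed.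

Definition word_of n (v : {ffun 'I_n -> nat}) : seq 'I_n :=
  sort (fun i j : 'I_n => (i <= j)%N) (flatten [seq nseq (v i) i | i <- enum 'I_n]).

Lemma count_word_of n (v : {ffun 'I_n -> nat}) i : count_mem i (word_of v) = v i.
Proof.
rewrite /word_of (permP (_ : perm_eq _ (flatten [seq nseq (v i) i | i <- enum 'I_n]))); last first.
  by rewrite perm_sort.
rewrite count_flatten -map_comp sumnE big_map big_enum /= (bigD1 i) //=.
rewrite count_nseq /= eqxx mul1n big1 ?addn0 // => j /negbTE ji.
by rewrite count_nseq /= ji.
Qed.

Lemma size_count n (s : seq 'I_n) : size s = (\sum_i count_mem i s)%N.
Proof.
elim: s => [|j s IH] /=; first by rewrite big1.
rewrite big_split /= -IH (bigD1 j) //= eqxx big1 ?addn0 ?add1n // => i.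
by rewrite eq_sym => /negbTE ->.
Qed.

(** Counting letters and sorting are mutually inverse between sorted d-tuples and exponent vectors
    of total degree d. *)
Lemma hcomp_mult n (x : nat -> R) (F : fps R) d :
  hcomp n x F d = \sum_(v : {ffun 'I_n -> 'I_d.+1} | (\sum_i v i)%N == d)
    F (seq_mset (map val (word_of [ffun i => v i : nat]))) * \prod_(i < n) x i ^+ v i.
Proof.
pose h (t : d.-tuple 'I_n) : {ffun 'I_n -> 'I_d.+1} := [ffun i => inord (count_mem i t)].
pose h' (v : {ffun 'I_n -> 'I_d.+1}) : option (d.-tuple 'I_n) :=
  insub (word_of [ffun i => v i : nat]).
have ht t i : h t i = count_mem i t :> nat.
  by rewrite ffunE inordK // ltnS -[X in (_ <= X)%N](size_tuple t) count_size.
have sw (v : {ffun 'I_n -> 'I_d.+1}) : size (word_of [ffun i => v i : nat]) = (\sum_i v i)%N.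
  by rewrite size_count; apply: eq_bigr => i _; rewrite count_word_of ffunE.
have srt (v : {ffun 'I_n -> nat}) : sorted (fun i j : 'I_n => (i <= j)%N) (word_of v).
  by apply: sort_sorted => i j; exact: leq_total.
have wh (t : d.-tuple 'I_n) : sorted leq (map val t) ->
    word_of [ffun i => h t i : nat] = t.
  rewrite sorted_map => st; apply: (@sorted_eq _ (fun i j : 'I_n => (i <= j)%N)) => //.
  - by move=> i j k; exact: leq_trans.
  - by move=> i j /anti_leq /val_inj.
  - by apply/allP => i _ /=; rewrite count_word_of ffunE ht.
rewrite [RHS](reindex_omap h h') /= => [|v /eqP vd]; last first.
  rewrite /h' insubT /= ?sw ?vd // => ?; congr Some; apply/ffunP => i.
  by apply/val_inj; rewrite /= ht /= count_word_of ffunE.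
apply: eq_big => [t|t st].
  have -> /= : (\sum_i h t i)%N == d.
    by rewrite -[X in _ == X](size_tuple t) size_count; apply/eqP/eq_bigr => i _.
  apply/idP/eqP => [st|].
    by rewrite /h' wh // valK.
  rewrite /h'; case: insubP => // t' _ tE [tt']; rewrite -tt' tE sorted_map; exact: srt.
congr (_ * _); first by rewrite wh.
rewrite (perm_big (word_of [ffun i => h t i : nat])) ?wh // {st}.
transitivity (\prod_(i < n) \prod_(j <- t | j == i) x j).
  by rewrite (partition_big id xpredT).
apply: eq_bigr => i _; rewrite ht.
by rewrite (eq_bigr (fun=> x i)) => [|j /eqP -> //]; rewrite big_const_seq iter_mulr_1.
Qed.

(** Each chain contributes a product of series in separate variables, whose homogeneous components
    are Cauchy products; this reduces the evaluation to one variable at a time. *)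
Theorem fps_eval_chains n (x : nat -> R) (F : fps R) (I : finType) (P : pred I)
    (k : I -> nat -> nat -> R) (V : I -> nat -> R) :
  (forall m : {mset nat}%mset, (forall e, (n <= e)%N -> m e = 0%N) ->
     F m = \sum_(c | P c) \prod_(i < n) k c i (m i)) ->
  (forall c i, P c -> (i < n)%N -> rational_sum (fun d => k c i d * x i ^+ d) (V c i)) ->
  fps_eval n x F = \sum_(c | P c) \prod_(i < n) V c i.
Proof.
move=> hF hV; apply: fps_evalE.
apply: (@rational_sum_ext (fun d => \sum_(c | P c)
    cprod (fun (i : 'I_n) j => k c i j * x i ^+ j) d)); last first.
  apply: rational_sum_sum => c Pc; apply: rational_sum_cprod => i; exact: hV.
move=> d; rewrite hcomp_mult /cprod exchange_big /=; apply: eq_bigr => v vd.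
have cnt i : (seq_mset (map val (word_of [ffun i => v i : nat])) : {mset nat}%mset) i =
    if insub i is Some j then v j : nat else 0%N.
  rewrite mset_seqE.
  case: insubP => [j _ <-|ni].
    by rewrite count_map (eq_count (a2 := pred1 j)) ?count_word_of ?ffunE // => j'.
  by apply/count_memPn/mapP => -[j _ ij]; rewrite ij ltn_ord in ni.
rewrite hF => [|e ne]; last by rewrite cnt insubF // ltnNge ne.
rewrite mulr_suml; apply: eq_bigr => c Pc; rewrite -big_split /=.
by apply: eq_bigr => i _; rewrite cnt valK.
Qed.

End RationalSums.

Lemma sum_interval (a b m p : nat) : (m <= a)%N -> (b <= p)%N ->
  (\sum_(m <= c < p) ((a <= c) && (c < b)))%N = (b - a)%N.
Proof.
move=> ma bp.
transitivity (\sum_(m <= c < p | (a <= c) && (c < b)) 1)%N.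
  by rewrite [RHS]big_mkcond /=; apply: eq_bigr => c _; case: (_ && _).
rewrite -(big_nat_widen m b p (fun c => a <= c)%N) // -(big_nat_widenl a m b xpredT) //.
by rewrite sum_nat_const_nat muln1.
Qed.

Lemma count_initial_nat (m p : nat) (P : pred nat) c : (m <= p)%N ->
  (forall c, (m <= c)%N -> (c.+1 < p)%N -> P c.+1 -> P c) ->
  (c < m + \sum_(m <= c < p) P c)%N = (c < m)%N || ((c < p)%N && P c).
Proof.
move=> mp Pdec.
have -> : (\sum_(m <= c < p) P c = \sum_(i < p - m) P (i + m))%N.
  by rewrite -{1}[m]add0n big_addn big_mkord.
have := @count_initial (p - m) (fun s => (s < p - m)%N && P (s + m)%N).
case: (ltnP c m) => [cm _|mc H]; first by rewrite (leq_trans cm) ?leq_addr.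
have E : (\sum_(i < p - m) P (i + m) = \sum_(i < p - m) ((i < p - m) && P (i + m)))%N.
  by apply: eq_bigr => i _; rewrite ltn_ord.
rewrite E -ltn_subLR // H /=.
- by rewrite subnK // ltn_sub2rE.
- move=> s /andP[s1 Ps]; rewrite (ltnW s1) Pdec ?leq_addl //; lia.
- by move=> s /andP[].
Qed.

Lemma eq_from_lt (n a b : nat) : (a <= n)%N -> (b <= n)%N ->
  (forall i, (i <= n)%N -> (a < i)%N = (b < i)%N) -> a = b.
Proof.
move=> an bn h; apply/eqP; rewrite eqn_leq leqNgt -h // ltnn.
by rewrite leqNgt h // ltnn.
Qed.

(** * Tableaux as chains of shapes *)

Section Levels.
Variables (l n : nat) (mu lam : shape l).
Implicit Types (t : nat -> nat -> nat) (c : {ffun 'I_n -> shape l}).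

Definition chain_mono c : Prop :=
  nx lam c 0%N = mu /\
  forall i r, (i < n)%N -> (row (nx lam c i) r <= row (nx lam c i.+1) r)%N.

Lemma chain_le c i j r : chain_mono c -> (i <= j)%N -> (j <= n)%N ->
  (row (nx lam c i) r <= row (nx lam c j) r)%N.
Proof.
move=> [_ h] /subnK <-; elim: (j - i)%N => // k IH; rewrite addSn => jn.
by rewrite (leq_trans (IH _)) ?h // ltnW.
Qed.

Lemma chain_sub c r i : chain_mono c -> (i <= n)%N ->
  (row mu r <= row (nx lam c i) r <= row lam r)%N.
Proof.
move=> hc iN; have [h0 _] := hc.
have := chain_le r hc (leq0n i) iN; rewrite h0 => -> /=.
by have := chain_le r hc iN (leqnn n); rewrite [nx lam c n]nx_out.
Qed.

(** The step at which the box enters the chain, counted as the number of steps after which it is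
    still missing; along a monotone chain this is n for a box beyond [lam]. *)
Definition level_of c (r col : nat) : nat :=
  (\sum_(i < n) (row (nx lam c i.+1) r <= col))%N.

Lemma level_ofP c r col i : chain_mono c -> (row mu r <= col)%N -> (i <= n)%N ->
  (level_of c r col < i)%N = (col < row (nx lam c i) r)%N.
Proof.
move=> hc mc; case: i => [|i] iN.
  by have [-> _] := hc; rewrite ltn0 ltnNge mc.
rewrite ltnS leqNgt.
have E : level_of c r col = (\sum_(s < n) ((s < n) && (row (nx lam c s.+1) r <= col)))%N.
  by apply: eq_bigr => s _; rewrite ltn_ord.
rewrite E (count_initial (P := fun s => (s < n)%N && (row (nx lam c s.+1) r <= col)%N)).
- by rewrite iN -ltnNge.
- move=> s /andP[s1 h]; rewrite (ltnW s1) (leq_trans _ h) //.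
  by apply: chain_le => //; exact: ltnW.
- by move=> s /andP[].
Qed.

Lemma level_of_le c r col : (level_of c r col <= n)%N.
Proof.
rewrite -[X in (_ <= X)%N]card_ord -sum1_card; by apply: leq_sum => i _; exact: leq_b1.
Qed.

(** Row r of the shape formed by [mu] and the boxes of level below i. *)
Definition lev_row t (i r : nat) : nat :=
  (row mu r + \sum_(row mu r <= col < row lam r) (t r col < i))%N.

Definition lev_chain t : {ffun 'I_n -> shape l} := [ffun i : 'I_n => mk_shape l (lev_row t i)].

(** Weak growth in both directions is what makes the boxes of level below i a shape. Strictness down
    columns, for hook-valued tableaux, becomes a condition on the steps of the chain. *)
Definition level_fun t : Prop :=
  [/\ forall r, (row mu r <= row lam r)%N,
      forall r col, (row mu r <= col)%N -> (col.+1 < row lam r)%N ->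
        (t r col <= t r col.+1)%N,
      forall r col, (row mu r <= col)%N -> (col < row lam r.+1)%N ->
        (t r col <= t r.+1 col)%N
    & forall r col, (row mu r <= col)%N -> (col < row lam r)%N -> (t r col < n)%N].

Lemma lev_rowP t i r col : level_fun t ->
  (col < lev_row t i r)%N = (col < row mu r)%N || ((col < row lam r)%N && (t r col < i)%N).
Proof.
case=> ml hr _ _; rewrite /lev_row (count_initial_nat (P := fun s => (t r s < i)%N)) //.
by move=> s ms sl; apply: leq_ltn_trans; exact: hr.
Qed.

Lemma lev_row_shape t i : level_fun t -> shape_fun l (lev_row t i).
Proof.
move=> ht; have [ml _ hc _] := ht; split=> [r| |r lr].
- rewrite leqNgt; apply/negP => h; have := h; rewrite lev_rowP //.
  have : (lev_row t i r < lev_row t i r)%N = false by rewrite ltnn.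
  rewrite lev_rowP // => /negbT; rewrite negb_or -leqNgt => /andP[m1 h1].
  have m2 := leq_trans (row_dec mu r) m1.
  rewrite ltnNge m2 /= => /andP[c1 c2].
  case/negP: h1; rewrite (leq_trans c1 (row_dec _ _)) /=.
  exact: leq_ltn_trans (hc _ _ m1 c1) c2.
- rewrite leqNgt lev_rowP // negb_or -!leqNgt row_le /=.
  by rewrite negb_and -leqNgt row_le.
- by rewrite /lev_row !row_out // big_geq.
Qed.

Lemma lev_chainP t i r col : level_fun t -> (i <= n)%N ->
  (col < row (nx lam (lev_chain t) i) r)%N =
  (col < row mu r)%N || ((col < row lam r)%N && (t r col < i)%N).
Proof.
move=> ht iN; rewrite -lev_rowP // (nx_ffun n lam (fun i => mk_shape l (lev_row t i))).
case: (ltnP i n) => [_|ni]; first by rewrite row_mk //; exact: lev_row_shape.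
have -> : i = n by apply/eqP; rewrite eqn_leq iN.
have [ml _ _ hn] := ht; rewrite lev_rowP //.
case: (ltnP col (row mu r)) => [h|h] /=; first exact: leq_trans h (ml r).
by case: ltnP => //= h'; rewrite hn.
Qed.

Lemma lev_chain_mono t : level_fun t -> chain_mono (lev_chain t).
Proof.
move=> ht; split=> [|i r iN].
  apply: shape_ext_lt => r col; rewrite lev_chainP //.
  by rewrite ltn0 andbF orbF.
rewrite leqNgt; apply/negP => h; have := h; rewrite lev_chainP //; last exact: ltnW.
have : (row (nx lam (lev_chain t) i.+1) r < row (nx lam (lev_chain t) i.+1) r)%N = false.
  by rewrite ltnn.
rewrite lev_chainP // => /negbT; rewrite negb_or => /andP[/negbTE -> h1] /= /andP[h2 h3].
by case/negP: h1; rewrite h2 /= ltnW.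
Qed.

Lemma lev_chainK c t : chain_mono c -> level_fun t ->
  (forall r col, (row mu r <= col)%N -> (col < row lam r)%N -> t r col = level_of c r col) ->
  lev_chain t = c.
Proof.
move=> hc ht tE; apply/ffunP => i; rewrite -!(nx_ord lam).
apply: shape_ext_lt => r col; rewrite lev_chainP //; last exact: ltnW.
case/andP: (chain_sub r hc (ltnW (ltn_ord i))) => m1 m2.
case: (ltnP col (row mu r)) => [h|h] /=; first by rewrite (leq_trans h).
case: (ltnP col (row lam r)) => [h'|h'] /=; last by rewrite ltnNge (leq_trans m2).
by rewrite tE // level_ofP //; exact: ltnW.
Qed.

Lemma level_of_fun c : chain_mono c -> level_fun (level_of c).
Proof.
move=> hc; split.
- by move=> r; case/andP: (chain_sub r hc (leqnn n)) => h1 h2; exact: leq_trans h1 h2.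
- by move=> r col _ _; apply: leq_sum => i _; case: (leqP _ col) => // /leqW ->.
- move=> r col _ _; apply: leq_sum => i _; case: (leqP _ col) => // h.
  by rewrite (leq_trans (row_dec _ _) h).
- by move=> r col h1 h2; rewrite level_ofP // nx_out.
Qed.

Lemma level_of_lev t r col : level_fun t -> (row mu r <= col)%N -> (col < row lam r)%N ->
  level_of (lev_chain t) r col = t r col.
Proof.
move=> ht h1 h2; have hc := lev_chain_mono ht; have [_ _ _ hn] := ht.
apply: (@eq_from_lt n); rewrite ?level_of_le ?(ltnW (hn _ _ h1 h2)) // => i iN.
by rewrite level_ofP // lev_chainP // ltnNge h1 h2.
Qed.

End Levels.

(** * Partitions as lists, their shapes and their boxes *)

Definition shape_of l (s : seq nat) : shape l := mk_shape l (nth 0%N s).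

Definition fits l (s : seq nat) : bool :=
  [&& is_partition s, (size s <= l)%N & (head 0%N s <= l)%N].

Lemma nth_partition s r : is_partition s -> (nth 0 s r.+1 <= nth 0 s r)%N.
Proof.
case/andP=> ss _; case: (ltnP r.+1 (size s)) => [rs|/(nth_default 0%N) -> //].
have geqT : transitive geq by move=> a b c ab ca; exact: leq_trans ca ab.
exact: (sorted_ltn_nth geqT 0%N ss r r.+1 (ltnW rs) rs (ltnSn r)).
Qed.

Lemma row_shape_of l s r : fits l s -> row (shape_of l s) r = nth 0%N s r.
Proof.
case/and3P=> ps sl s0; rewrite row_mk //; split=> [k| |k lk].
- exact: nth_partition.
- by rewrite nth0.
- by rewrite nth_default // (leq_trans sl).
Qed.

Lemma fits_inj l s s' : fits l s -> fits l s' -> shape_of l s = shape_of l s' -> s = s'.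
Proof.
move=> hs hs' E.
have nE r : nth 0%N s r = nth 0%N s' r by rewrite -!(row_shape_of _ (l := l)) ?E.
have sz a b : is_partition a -> (forall r, nth 0%N a r = nth 0%N b r) -> (size a <= size b)%N.
  move=> /andP[_ na] h; rewrite leqNgt; apply/negP => ba.
  by case/negP: na; rewrite -[X in X \in _](nth_default 0%N (leqnn (size b))) -h mem_nth.
case/and3P: hs => hs _ _; case/and3P: hs' => hs' _ _.
by apply: (@eq_from_nth _ 0%N) => // ; apply/eqP; rewrite eqn_leq !sz.
Qed.

Section Boxes.
Variables (lam mu : seq nat).

Lemma mem_boxes r c : ((r, c) \in skew_boxes lam mu) = (nth 0 mu r <= c < nth 0 lam r)%N.
Proof.
apply/allpairsPdep/idP => /= [[r' [c' [_ h [-> ->]]]]|/andP[h1 h2]].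
  by move: h; rewrite mem_iota; lia.
exists r, c; split=> //.
  rewrite mem_iota /= add0n; case: (ltnP r (size lam)) => // /(nth_default 0%N) e.
  by rewrite e in h2.
by rewrite mem_iota h1 subnKC // ltnW // (leq_ltn_trans h1).
Qed.

Lemma uniq_boxes : uniq (skew_boxes lam mu).
Proof.
apply: allpairs_uniq_dep => [|r _|[r c] [r' c'] _ _ [-> ->]]; rewrite ?iota_uniq //.
Qed.

Definition box_at r c : option (box lam mu) := insub (r, c).

Lemma big_box (T : Type) (idx : T) (op : Monoid.com_law idx) l (F : nat -> nat -> T) :
  (size lam <= l)%N ->
  \big[op/idx]_(b : box lam mu) F (val b).1 (val b).2 =
  \big[op/idx]_(r < l) \big[op/idx]_(nth 0%N mu r <= c < nth 0%N lam r) F r c.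
Proof.
move=> sl.
transitivity (\big[op/idx]_(x <- skew_boxes lam mu) F x.1 x.2).
  rewrite -(big_map (val : box lam mu -> _) xpredT (fun x => F x.1 x.2)).
  apply: perm_big; apply: uniq_perm.
  - by rewrite (map_inj_uniq val_inj) index_enum_uniq.
  - exact: uniq_boxes.
  - move=> x; apply/mapP/idP => [[b _ ->]|hx]; first exact: valP.
    by exists (Sub x hx : box lam mu) => //; rewrite mem_index_enum.
rewrite /skew_boxes big_allpairs_dep /= -(big_mkord xpredT (fun r =>
  \big[op/idx]_(nth 0%N mu r <= c < nth 0%N lam r) F r c)).
rewrite (big_cat_nat (n := size lam)) //= [X in op _ X]big_nat_cond [X in op _ X]big1 => [|r].
  by rewrite Monoid.mulm1 /index_iota subn0.
by rewrite andbT => /andP[/(nth_default 0%N) -> _]; rewrite big_geq.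
Qed.

End Boxes.

(** Tableaux range over an infinite type; a bijection with finitely many chains turns their sum into
    an ordinary finite one. *)
Lemma fsbig_reindex (R : zmodType) (T : choiceType) (I : finType) (P : pred I)
    (Q : set T) (h : I -> T) (F : T -> R) :
  (forall i, P i -> Q (h i)) -> {in P &, injective h} ->
  (forall t, Q t -> exists2 i, P i & h i = t) ->
  \sum_(t \in Q) F t = \sum_(i | P i) F (h i).
Proof.
move=> h1 h2 h3.
rewrite (@reindex_fsbig _ _ _ _ _ h [set` P]%classic Q); last first.
  split=> [i Pi|i j|t Qt].
  - exact: h1.
  - by rewrite !inE => Pi Pj; exact: h2.
  - by have [i Pi <-] := h3 _ Qt; exists i.
by rewrite -(@bigfs _ _ _ _ (index_enum I)) ?index_enum_uniq // => i; rewrite mem_index_enum.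
Qed.

Section PACoef.
Variables (R : comNzRingType) (l : nat).
Implicit Types (beta : nat -> R) (k p : shape l).

Definition contained k p : bool := [forall r : 'I_l, (row k r <= row p r)%N].

Lemma containedP k p : reflect (forall r, row k r <= row p r)%N (contained k p).
Proof.
apply: (iffP forallP) => [h r|h r //].
by case: (ltnP r l) => [rl|lr]; [exact: (h (Ordinal rl))|rewrite !row_out].
Qed.

Definition degA k p : nat := (\sum_(r < l) (row p r - maxn (row k r) (row p r.+1)))%N.

Definition wtA beta k p : R := \prod_(r < l) beta r ^+ (row p r.+1 - row k r).

(** An entry of this kernel is a single monomial: the two shapes of a step determine how often the
    entry is counted. *)
Lemma pA_coef beta k p d :
  (pA beta k p)`_d = if contained k p && (d == degA k p) then wtA beta k p else 0.
Proof.
rewrite /pA /kA; case: containedP => [h|nh] /=.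
  rewrite (eq_bigr (fun r : 'I_l => (beta r ^+ (row p r.+1 - row k r))%:P *
      'X^(row p r - maxn (row k r) (row p r.+1)))) => [|r _]; last first.
    by rewrite /cellA h polyC_exp.
  rewrite big_split /= -rmorph_prod -expr_sum coefCM coefXn -/(degA k p) -/(wtA beta k p).
  by case: eqP; rewrite ?mulr1 ?mulr0.
case: (boolP [forall r : 'I_l, (row k r <= row p r)%N]) => [/containedP//|].
rewrite negb_forall => /existsP[r hr].
by rewrite (bigD1 r) //= /cellA (negbTE hr) mul0r coef0.
Qed.

End PACoef.

(** * Reverse plane partitions as chains *)

Section RPPChains.
Variables (R : realType) (l n : nat) (lam mu : seq nat).
Hypotheses (flam : fits l lam) (fmu : fits l mu).
Hypothesis hsub : sub_part mu lam.
Variables (beta : nat -> R) (m : {mset nat}%mset).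
Hypothesis hm : forall e, (n <= e)%N -> m e = 0%N.

Let z : shape l := shape_of l lam.
Let a : shape l := shape_of l mu.
Let rz r : row z r = nth 0%N lam r := row_shape_of r flam.
Let ra r : row a r = nth 0%N mu r := row_shape_of r fmu.

Let ok_chain (c : {ffun 'I_n -> shape l}) : bool :=
  (nx z c 0%N == a) && [forall i : 'I_n,
    contained (nx z c i) (nx z c i.+1) && (m i == degA (nx z c i) (nx z c i.+1))].

Lemma ok_chain_mono c : ok_chain c -> chain_mono a z c.
Proof.
case/andP=> /eqP c0 /forallP h; split=> // i r iN.
by case/andP: (h (Ordinal iN)) => /containedP/(_ r).
Qed.

Let fill (c : {ffun 'I_n -> shape l}) : {ffun box lam mu -> nat} :=
  [ffun b => level_of z c (val b).1 (val b).2].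

Lemma box_bounds (b : box lam mu) :
  (row a (val b).1 <= (val b).2)%N /\ ((val b).2 < row z (val b).1)%N.
Proof.
have : val b \in skew_boxes lam mu := valP b.
case: (val b) => r col /=.
by rewrite mem_boxes rz ra => /andP[].
Qed.

Lemma box_exists r col : (row a r <= col)%N -> (col < row z r)%N ->
  exists b : box lam mu, val b = (r, col).
Proof.
rewrite ra rz => h1 h2.
have hb : (r, col) \in skew_boxes lam mu by rewrite mem_boxes h1 h2.
by exists (Sub (r, col) hb).
Qed.

Lemma fill_lt c b i : chain_mono a z c -> (i <= n)%N ->
  (fill c b < i)%N = ((val b).2 < row (nx z c i) (val b).1)%N.
Proof. by move=> hc iN; rewrite ffunE (level_ofP hc) //; case: (box_bounds b). Qed.

Lemma fill_eq c b i : chain_mono a z c -> (i < n)%N ->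
  (fill c b == i) = (row (nx z c i) (val b).1 <= (val b).2 < row (nx z c i.+1) (val b).1)%N.
Proof.
move=> hc iN; rewrite eqn_leq -ltnS fill_lt // andbC; congr (_ && _).
by rewrite leqNgt fill_lt ?(ltnW iN) // -leqNgt.
Qed.

Lemma fill_bound c b : chain_mono a z c -> (fill c b < n)%N.
Proof. by move=> hc; rewrite fill_lt // nx_out //; case: (box_bounds b). Qed.

(** Entries grow down a column, so the box below carries the same entry i precisely when it is
    present after step i. *)
Lemma fill_merged c b i : chain_mono a z c -> (i < n)%N -> fill c b = i ->
  merged (fill c) b = ((val b).2 < row (nx z c i.+1) (val b).1.+1)%N.
Proof.
move=> hc iN /eqP bi; have := bi; rewrite fill_eq // => /andP[h1 h2].
apply/existsP/idP => [[b' /andP[/eqP vb']]|h].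
  by rewrite (eqP bi) fill_eq // vb' /= => /andP[].
have [b' vb'] : exists b' : box lam mu, val b' = ((val b).1.+1, (val b).2).
  case: (box_bounds b) => e1 e2; apply: box_exists.
    exact: leq_trans (row_dec _ _) e1.
  by apply: leq_trans h _; case/andP: (chain_sub (val b).1.+1 hc iN).
exists b'; rewrite /below vb' eqxx (eqP bi) fill_eq // vb' /= h andbT.
exact: leq_trans (row_dec _ _) h1.
Qed.

Lemma fill_rpp c : chain_mono a z c -> is_rpp (fill c).
Proof.
move=> hc; apply/forallP => b; apply/forallP => b'; apply/implyP.
have [_ hr hcol _] := level_of_fun hc.
have [e1 e2] := box_bounds b; have [e1' e2'] := box_bounds b'.
rewrite !ffunE; case/orP => /eqP e; rewrite e /= in e2' *; [exact: hr|exact: hcol].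
Qed.

Lemma card_boxes (P : nat -> nat -> bool) :
  #|[pred b : box lam mu | P (val b).1 (val b).2]| =
  (\sum_(r < l) \sum_(row a r <= col < row z r) P r col)%N.
Proof.
rewrite -sum1_card big_mkcond /=.
rewrite (eq_bigr (fun b : box lam mu => nat_of_bool (P (val b).1 (val b).2))) => [|b _]; last first.
  by rewrite inE; case: P.
rewrite (@big_box lam mu _ _ _ l (fun r col => nat_of_bool (P r col))); last first.
  by case/and3P: flam.
by apply: eq_bigr => r _; rewrite ra rz.
Qed.

Lemma fill_content_count c i : chain_mono a z c -> (i < n)%N ->
  rpp_content (fill c) i = degA (nx z c i) (nx z c i.+1).
Proof.
move=> hc iN; rewrite /rpp_content mset_seqE count_map -size_filter.
transitivity (#|[pred b : box lam mu | ~~ merged (fill c) b && (fill c b == i)]|).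
  rewrite cardE /enum_mem -filter_predI; congr size; apply: eq_filter => b.
  by rewrite !inE andbC.
rewrite (eq_card (B := [pred b : box lam mu |
   (maxn (row (nx z c i) (val b).1) (row (nx z c i.+1) (val b).1.+1) <= (val b).2)%N &&
   ((val b).2 < row (nx z c i.+1) (val b).1)%N])) => [|b]; last first.
  rewrite !inE; case: (boolP (fill c b == i)) => [bi|].
    rewrite (fill_merged hc iN (eqP bi)) andbT geq_max.
    by move: bi; rewrite fill_eq // => /andP[-> ->]; rewrite andbT -leqNgt.
  rewrite fill_eq // andbF geq_max => h; apply/esym/negbTE; apply: contra h.
  by case/andP=> /andP[-> _] ->.
rewrite (card_boxes (fun r col => (maxn (row (nx z c i) r) (row (nx z c i.+1) r.+1) <= col)%N &&
   (col < row (nx z c i.+1) r)%N)).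
apply: eq_bigr => r _; apply: sum_interval.
  by rewrite leq_max; case/andP: (chain_sub r hc (ltnW iN)) => ->.
by case/andP: (chain_sub r hc iN).
Qed.

Lemma fill_merged_row c r : chain_mono a z c -> (r < l)%N ->
  merged_in_row (fill c) r = (\sum_(i < n) (row (nx z c i.+1) r.+1 - row (nx z c i) r))%N.
Proof.
move=> hc rl; rewrite /merged_in_row.
pose Q (i : 'I_n) r' col := (r' == r) && ((row (nx z c i) r <= col) &&
  (col < row (nx z c i.+1) r.+1))%N.
rewrite -sum1_card big_mkcond /=.
transitivity (\sum_(b : box lam mu) \sum_(i < n) Q i (val b).1 (val b).2)%N.
  apply: eq_bigr => b _; rewrite inE /Q.
  case: eqP => [br|] /=; last by rewrite big1.
  have bn := fill_bound b hc.
  rewrite (bigD1 (Ordinal bn)) //= big1 ?addn0 => [|i ib].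
    rewrite (fill_merged hc bn erefl) br.
    have := eqxx (fill c b); rewrite fill_eq // br => /andP[-> _] /=.
    by case: (_ < _)%N.
  have : (fill c b == i) = false by rewrite eq_sym; apply: contraNF ib => /eqP h; apply/eqP/val_inj.
  rewrite fill_eq // br; case: (leqP (row (nx z c i) r)) => //= h1 /negbT; rewrite -leqNgt => h2.
  by rewrite ltnNge (leq_trans (row_dec _ _) h2).
rewrite exchange_big; apply: eq_bigr => i _.
rewrite (@big_box lam mu _ _ _ l (fun r col => nat_of_bool (Q i r col))); last first.
  by case/and3P: flam.
rewrite (bigD1 (Ordinal rl)) //= [X in (_ + X)%N]big1 ?addn0 => [|r' /negbTE rr'].
  rewrite -rz -ra /Q eqxx /=; apply: sum_interval.
    by case/andP: (chain_sub r hc (ltnW (ltn_ord i))).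
  case/andP: (chain_sub r.+1 hc (ltn_ord i)) => _ h.
  exact: leq_trans h (row_dec _ _).
by rewrite big1 // => col _; rewrite /Q -val_eqE /= in rr' *; rewrite rr'.
Qed.

(** A merged box does not count in the content, but the box below has the same entry; descending the
    run reaches a counted box, to which the bound on [m] applies. *)
Lemma content_out (T : {ffun box lam mu -> nat}) : rpp_content T = m ->
  forall b, (T b < n)%N.
Proof.
move=> Tm.
have un b : ~~ merged T b -> (T b < n)%N.
  move=> nb; rewrite ltnNge; apply/negP => /hm; rewrite -Tm mset_seqE.
  apply/eqP; rewrite -lt0n -has_count; apply/hasP; exists (T b); rewrite /= ?eqxx //.
  by apply: fintype.image_f; rewrite inE.
move=> b; have [k] := ubnP (l - (val b).1)%N; elim: k b => // k IH b hk.
case: (boolP (merged T b)) => [/existsP[b' /andP[/eqP vb' /eqP <-]]|]; last exact: un.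
apply: IH; rewrite vb' /=.
have [_] := box_bounds b; case: (ltnP (val b).1 l) => [bl _|lb]; last by rewrite row_out.
by rewrite -ltnS (leq_trans _ hk) // ltnS subnSK.
Qed.

Let tot (T : {ffun box lam mu -> nat}) (r col : nat) : nat :=
  if box_at lam mu r col is Some b then T b else 0%N.

Lemma tot_box T b : tot T (val b).1 (val b).2 = T b.
Proof. by rewrite /tot /box_at -surjective_pairing valK. Qed.

Lemma tot_level T : is_rpp T -> rpp_content T = m -> level_fun n a z (tot T).
Proof.
move=> /forallP rT Tm; split.
- move=> r; rewrite ra rz; case: (ltnP r (size mu)) => [rs|/(nth_default 0%N) -> //].
  by have /allP/(_ r) := hsub; rewrite mem_iota; apply.
- move=> r col h1 h2.
  have [b vb] := box_exists h1 (ltnW h2); have [b' vb'] := box_exists (leqW h1) h2.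
  have := tot_box T b; have := tot_box T b'; rewrite vb vb' /= => -> ->.
  by have /forallP/(_ b')/implyP := rT b; apply; rewrite /right_of vb vb' eqxx.
- move=> r col h1 h2.
  have [b vb] := box_exists h1 (leq_trans h2 (row_dec _ _)).
  have [b' vb'] := box_exists (leq_trans (row_dec _ _) h1) h2.
  have := tot_box T b; have := tot_box T b'; rewrite vb vb' /= => -> ->.
  by have /forallP/(_ b')/implyP := rT b; apply; rewrite /below vb vb' eqxx orbT.
- move=> r col h1 h2; have [b vb] := box_exists h1 h2.
  by have := tot_box T b; rewrite vb /= => ->; exact: content_out.
Qed.

Theorem g_skew_chains :
  g_skew lam mu beta m = psum n (fun i k p => (pA beta k p)`_(m i)) a z.
Proof.
rewrite /g_skew hsub (@fsbig_reindex _ _ _ ok_chain _ fill).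
- rewrite /psum [RHS](bigID ok_chain) /= [X in _ + X]big1 ?addr0 => [|c /andP[c0]]; last first.
    rewrite /ok_chain c0 negb_forall => /existsP[i hi].
    by rewrite (bigD1 i) //= pA_coef (negbTE hi) mul0r.
  apply: eq_big => [c|c hc].
    by case h: (ok_chain c) => //; rewrite ?andbF //; case/andP: h => ->.
  have mc := ok_chain_mono hc.
  transitivity (\prod_(r < l) beta r ^+ merged_in_row (fill c) r).
    rewrite [LHS](big_ord_widen l (fun r => beta r ^+ merged_in_row (fill c) r)); last by case/and3P: flam.
    rewrite big_mkcond /=; apply: eq_bigr => r _; case: ltnP => // sr.
    rewrite /merged_in_row eq_card0 ?expr0 // => b; rewrite !inE.
    apply/negbTE; rewrite negb_and; apply/orP; left; apply/eqP => br.
    by have [_] := box_bounds b; rewrite rz br nth_default.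
  transitivity (\prod_(r < l) \prod_(i < n)
      beta r ^+ (row (nx z c i.+1) r.+1 - row (nx z c i) r)).
    by apply: eq_bigr => r _; rewrite fill_merged_row // expr_sum.
  rewrite exchange_big /=; apply: eq_bigr => i _.
  by case/andP: hc => _ /forallP/(_ i) hi; rewrite pA_coef hi.
- move=> c hc; have mc := ok_chain_mono hc; split; first exact: fill_rpp.
  apply: mset_ext => i; case: (ltnP i n) => [iN|/[dup] ni /hm ->].
    rewrite fill_content_count //.
    by case/andP: hc => _ /forallP/(_ (Ordinal iN)) /andP[_ /eqP].
  rewrite mset_seqE; apply/count_memPn/fintype.imageP => -[b _ ib].
  by have := fill_bound b mc; rewrite -ib ltnNge ni.
- move=> c c' hc hc' E; have mc := ok_chain_mono hc; have mc' := ok_chain_mono hc'.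
  rewrite -(@lev_chainK l n a z c (level_of z c')) //; first by apply: lev_chainK => //; exact: level_of_fun.
    exact: level_of_fun.
  move=> r col h1 h2; have [b vb] := box_exists h1 h2.
  by have := congr1 (fun f : {ffun _ -> nat} => f b) E; rewrite !ffunE vb.
- move=> T [rT Tm]; have lT := tot_level rT Tm.
  have mc := lev_chain_mono lT.
  have fT : fill (lev_chain n a z (tot T)) = T.
    apply/ffunP => b; rewrite ffunE level_of_lev ?tot_box //; by case: (box_bounds b).
  exists (lev_chain n a z (tot T)) => //; have [c0 cS] := mc.
  rewrite /ok_chain c0 eqxx; apply/forallP => i; apply/andP; split.
    by apply/containedP => r; apply: cS.
  by rewrite -fill_content_count // fT Tm.
Qed.

End RPPChains.

(** * Hook-valued tableaux *)

Section Strips.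
Variable l : nat.
Implicit Types (k p : shape l).

Definition hstrip k p : bool :=
  contained k p && [forall r : 'I_l, (row p r.+1 <= row k r)%N].

Lemma hstripP k p : reflect
  ((forall r, row k r <= row p r)%N /\ (forall r, row p r.+1 <= row k r)%N) (hstrip k p).
Proof.
apply: (iffP andP) => [[/containedP h1 /forallP h2]|[h1 h2]]; split=> //.
- by move=> r; case: (ltnP r l) => [rl|lr]; [exact: (h2 (Ordinal rl))|rewrite !row_out // leqW].
- exact/containedP.
- exact/forallP.
Qed.

End Strips.

Section StepKernel.
Variables (R : comNzRingType) (l : nat) (multi : bool) (gamma : nat -> nat -> R).
Implicit Types (k p : shape l).

Definition newb k p (r c : nat) : bool := (row k r <= c < row p r)%N.

(* The boxes of the old shape that may receive further copies of the entry. *)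
Definition optb k p (r c : nat) : bool := (c.+1 == row k r) && (row p r.+1 <= c)%N.

(** A new box must take the entry. [multi] permits repeated copies (row-valued tableaux); otherwise
    a box holds at most one copy (set-valued tableaux). *)
Definition allow k p (r c v : nat) : bool :=
  if newb k p r c then (if multi then (0 < v)%N else v == 1%N)
  else if optb k p r c then multi || (v <= 1)%N else v == 0%N.

(** Only the first entry ever put into a box of lam/mu is free: in a new box one copy of the step
    costs nothing, in an old box every copy costs a factor. *)
Definition boxcoef k p (r c v : nat) : R :=
  if allow k p r c v then gamma r c ^+ (v - newb k p r c) else 0.

Definition kG k p (d : nat) : R :=
  if hstrip k p then cprod (fun b : 'I_l * 'I_l => boxcoef k p b.1 b.2) d else 0.

End StepKernel.

Section Multiplicities.
Variables (l n D : nat) (multi : bool).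

(* M i b is the number of copies of the entry i in the box b. *)
Definition mult := {ffun 'I_n -> {ffun 'I_l * 'I_l -> 'I_D.+1}}.

Definition Mx (M : mult) (i r c : nat) : nat :=
  if insub i is Some i' then if insub r is Some r' then
  if insub c is Some c' then M i' (r', c') else 0%N else 0%N else 0%N.

Lemma Mx_ord M (i : 'I_n) (r c : 'I_l) : Mx M i r c = M i (r, c).
Proof. by rewrite /Mx !valK. Qed.

Lemma Mx_bounds M i r c : (0 < Mx M i r c)%N -> [/\ (i < n)%N, (r < l)%N & (c < l)%N].
Proof.
rewrite /Mx; case: insubP => // i' hi _; case: insubP => // r' hr _.
by case: insubP.
Qed.

Definition valid_mult (a z : shape l) (M : mult) : Prop :=
  [/\ forall r c, (row a r <= c)%N -> (c < row z r)%N -> exists i, (0 < Mx M i r c)%N,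
      forall i r c, (0 < Mx M i r c)%N ->
        (row a r <= c < row z r)%N || (c.+1 == row a r) && (row a r.+1 <= c)%N,
      forall i i' r c, (0 < Mx M i r c)%N -> (0 < Mx M i' r c.+1)%N -> (i <= i')%N,
      forall i i' r c, (0 < Mx M i r c)%N -> (0 < Mx M i' r.+1 c)%N -> (i < i')%N
    & forall i r c, multi || (Mx M i r c <= 1)%N].

(** The level of the box in the associated chain; an empty box gets the value n. *)
Definition first_entry (M : mult) (r c : nat) : nat :=
  find (fun i => (0 < Mx M i r c)%N) (iota 0 n).

Lemma first_entryP M r c i : (i <= n)%N ->
  reflect (exists2 j, (j < i)%N & (0 < Mx M j r c)%N) (first_entry M r c < i)%N.
Proof.
move=> iN; pose P i := (0 < Mx M i r c)%N; rewrite /first_entry -/P; apply: (iffP idP) => [h|[j ji Pj]].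
  have hP : has P (iota 0 n) by rewrite has_find size_iota (leq_trans h).
  exists (find P (iota 0 n)) => //.
  by have := nth_find 0%N hP; rewrite nth_iota ?(leq_trans h).
rewrite ltnNge; apply/negP => h.
have := before_find 0%N (leq_trans ji h); rewrite nth_iota ?(leq_trans ji) // add0n.
by rewrite /P Pj.
Qed.

Section Chains.
Variables (a z : shape l).
Hypothesis az : forall r, (row a r <= row z r)%N.

Lemma first_entry_in M r c : valid_mult a z M -> (row a r <= c)%N -> (c < row z r)%N ->
  (first_entry M r c < n)%N /\ (0 < Mx M (first_entry M r c) r c)%N.
Proof.
move=> [v1 _ _ _ _] h1 h2; have [i hi] := v1 _ _ h1 h2.
have [iN _ _] := Mx_bounds hi.
have fN : (first_entry M r c < n)%N by apply/first_entryP => //; exists i.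
split=> //.
have hP : has (fun i => (0 < Mx M i r c)%N) (iota 0 n) by rewrite has_find size_iota.
by have := nth_find 0%N hP; rewrite nth_iota // -/(first_entry M r c).
Qed.

Lemma first_entry_level M : valid_mult a z M -> level_fun n a z (first_entry M).
Proof.
move=> vM; have [v1 v2 v3 v4 v5] := vM; split=> // [r c h1 h2|r c h1 h2|r c h1 h2].
- have [_ e1] := first_entry_in vM h1 (ltnW h2).
  have [_ e2] := first_entry_in vM (leqW h1) h2.
  exact: v3 e1 e2.
- have [_ e1] := first_entry_in vM h1 (leq_trans h2 (row_dec _ _)).
  have [_ e2] := first_entry_in vM (leq_trans (row_dec _ _) h1) h2.
  exact: ltnW (v4 _ _ _ _ e1 e2).
- by have [] := first_entry_in vM h1 h2.
Qed.

Definition ok_mult (M : mult) (c : {ffun 'I_n -> shape l}) : Prop :=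
  [/\ nx z c 0%N = a,
      forall i, (i < n)%N -> hstrip (nx z c i) (nx z c i.+1)
    & forall i r col, (i < n)%N ->
        allow multi (nx z c i) (nx z c i.+1) r col (Mx M i r col)].

(** Strictness down columns makes each step a horizontal strip. An old box can receive the current
    entry only if no smaller entry lies to its right and none that is at most as large lies below:
    it ends its old row and is not covered by the new shape. *)
Lemma valid_ok M : valid_mult a z M -> ok_mult M (lev_chain n a z (first_entry M)).
Proof.
move=> vM; have [v1 v2 v3 v4 v5] := vM.
have lM := first_entry_level vM; have [c0 cS] := lev_chain_mono lM.
set c := lev_chain n a z (first_entry M) in c0 cS *.
have cP i r col : (i <= n)%N -> (col < row (nx z c i) r)%N =
    (col < row a r)%N || ((col < row z r)%N && (first_entry M r col < i)%N).
  by move=> iN; rewrite /c lev_chainP.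
have hs i : (i < n)%N -> hstrip (nx z c i) (nx z c i.+1).
  move=> iN; apply/hstripP; split=> [r|r]; first exact: cS.
  rewrite leqNgt; apply/negP => h; have := h; rewrite cP //.
  have : (row (nx z c i) r < row (nx z c i) r)%N = false by rewrite ltnn.
  rewrite cP; last exact: ltnW.
  set col := row (nx z c i) r => /negbT; rewrite negb_or -leqNgt => /andP[m1 h1].
  rewrite ltnNge (leq_trans (row_dec _ _) m1) /= => /andP[h2 h3].
  have h2' := leq_trans h2 (row_dec _ _).
  have [_ e1] := first_entry_in vM m1 h2'.
  have [_ e2] := first_entry_in vM (leq_trans (row_dec _ _) m1) h2.
  case/negP: h1; rewrite h2' /=.
  by apply: leq_trans (v4 _ _ _ _ e1 e2) _; rewrite -ltnS.
split=> // i r col iN; rewrite /allow /newb.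
case: (ltnP col (row (nx z c i.+1) r)) => h1; last first.
  rewrite andbF.
  have -> : Mx M i r col = 0%N.
    apply/eqP; rewrite -leqn0 leqNgt; apply/negP => Mp.
    move: h1; rewrite leqNgt cP // => /negP[].
    case: (ltnP col (row a r)) => //= ha.
    have /orP[/andP[_ ->]|/andP[/eqP e _]] := v2 _ _ _ Mp; last by rewrite -e ltnn in ha.
    by apply/first_entryP => //; exists i.
  by case: ifP => //; rewrite orbT.
case: (leqP (row (nx z c i) r) col) => h2 /=.
  have Mp : (0 < Mx M i r col)%N.
    have := h2; rewrite leqNgt cP ?(ltnW iN) // negb_or => /andP[/negbTE na nf].
    have := h1; rewrite cP // na /= => /andP[zc]; rewrite zc /= in nf.
    move=> /first_entryP[//|j ji Mj].
    move: ji; rewrite ltnS leq_eqVlt => /orP[/eqP <- //|ji].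
    by case/negP: nf; apply/first_entryP; [exact: ltnW|exists j].
  case: ifP => // nm; have := v5 i r col; rewrite nm /=.
  by rewrite eqn_leq Mp andbT.
case: ifP => [_|no]; first exact: v5.
rewrite -leqn0 leqNgt; apply/negP => Mp; move/negP: no; apply; apply/andP.
have bz : (col < row z r)%N.
  move: h1; rewrite cP // => /orP[h|/andP[] //]; exact: leq_trans h (az r).
have skew : ~~ (row a r <= col)%N -> (col.+1 == row a r) && (row a r.+1 <= col)%N.
  by move=> na; have := v2 _ _ _ Mp; rewrite (negbTE na).
split.
  rewrite eqn_leq h2 /= leqNgt; apply/negP; rewrite cP ?(ltnW iN) // => /orP[h|/andP[h]].
    have /skew /andP[/eqP e _] : ~~ (row a r <= col)%N by rewrite -ltnNge ltnW.
    by rewrite e ltnn in h.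
  move=> /first_entryP[|j ji Mj]; first exact: ltnW.
  by have := v3 _ _ _ _ Mp Mj; rewrite leqNgt ji.
rewrite leqNgt; apply/negP; rewrite cP // => /orP[h|/andP[h]].
  have /skew /andP[_ e] : ~~ (row a r <= col)%N by rewrite -ltnNge (leq_trans h) // row_dec.
  by rewrite ltnNge e in h.
move=> /first_entryP[//|j ji Mj].
by have := v4 _ _ _ _ Mp Mj; rewrite ltnNge -ltnS ji.
Qed.

Lemma ok_mono M c : ok_mult M c -> chain_mono a z c.
Proof.
by case=> c0 hs _; split=> // i r /hs /hstripP[h _].
Qed.

Lemma allow_pos (k p : shape l) r col v : allow multi k p r col v -> (0 < v)%N ->
  newb k p r col || optb k p r col.
Proof.
rewrite /allow; case: ifP => //= _; case: ifP => // _ /eqP ->; by [].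
Qed.

(** A box joins the chain exactly when it receives its first entry, so the filling determines the
    chain. *)
Lemma ok_valid M c : ok_mult M c ->
  valid_mult a z M /\ lev_chain n a z (first_entry M) = c.
Proof.
move=> okM; have [c0 hs al] := okM; have mc := ok_mono okM.
have pos i r col : (0 < Mx M i r col)%N -> (i < n)%N /\
    (newb (nx z c i) (nx z c i.+1) r col \/
     (col.+1 = row (nx z c i) r /\ (row (nx z c i.+1) r.+1 <= col)%N)).
  move=> Mp; have [iN _ _] := Mx_bounds Mp; split=> //.
  by have /orP[->|/andP[/eqP e1 e2]] := allow_pos (al _ _ _ iN) Mp; [left|right].
have le i r : (i < n)%N -> (row (nx z c i) r <= row (nx z c i.+1) r)%N.
  by move=> /hs /hstripP[].
have st i r : (i < n)%N -> (row (nx z c i.+1) r.+1 <= row (nx z c i) r)%N.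
  by move=> /hs /hstripP[].
have cle i j r : (i <= j)%N -> (j <= n)%N -> (row (nx z c i) r <= row (nx z c j) r)%N.
  exact: chain_le.
have inn i r col : (0 < Mx M i r col)%N -> (col < row (nx z c i.+1) r)%N.
  move=> /pos[iN [/andP[_ //]|[e _]]]; by rewrite (leq_trans _ (le i r iN)) // e.
have lev i r col : (row a r <= col)%N -> (col < row z r)%N -> (i <= n)%N ->
    (first_entry M r col < i)%N = (col < row (nx z c i) r)%N.
  move=> h1 h2 iN; apply/first_entryP/idP => // [[j ji /inn h]|].
    exact: leq_trans h (cle _ _ _ ji iN).
  elim: i iN => [|i IH] iN h; first by rewrite c0 ltnNge h1 in h.
  case: (ltnP col (row (nx z c i) r)) => h'.
    by have [j ji Mj] := IH (ltnW iN) h'; exists j => //; exact: ltnW.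
  exists i => //; have := al i r col iN; rewrite /allow /newb h' h /=.
  by case: multi => // /eqP ->.
have vM : valid_mult a z M.
  split.
  - move=> r col h1 h2; have := lev n r col h1 h2 (leqnn n).
    by rewrite nx_out // h2 => /first_entryP[//|j _ Mj]; exists j.
  - move=> i r col Mp; have [iN] := pos _ _ _ Mp.
    have zc : (col < row z r)%N.
      apply: leq_trans (inn _ _ _ Mp) _.
      by rewrite -[X in (_ <= row X r)%N](nx_out z c (leqnn n)) cle.
    have aci s : (row a s <= row (nx z c i) s)%N by rewrite -c0 cle // ltnW.
    rewrite zc andbT; case: (leqP (row a r) col) => //= ac.
    move=> [/andP[h _]|[e1 e2]]; first by rewrite ltnNge (leq_trans (aci r) h) in ac.
    rewrite eqn_leq ac e1 aci /=.
    by apply: leq_trans e2; apply: leq_trans (aci _) (le _ _ iN).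
  - move=> i i' r col Mp Mp'; rewrite leqNgt; apply/negP => ii.
    have [iN] := pos _ _ _ Mp; have h := inn _ _ _ Mp'.
    have {}h := leq_trans h (cle _ _ r ii (ltnW iN)).
    case=> [/andP[h' _]|[e _]]; last by rewrite e ltnn in h.
    by move: (leq_trans h h'); rewrite ltnNge leqnSn.
  - move=> i i' r col Mp Mp'; rewrite ltnNge; apply/negP => ii.
    have [iN] := pos _ _ _ Mp; have h := inn _ _ _ Mp'.
    have {}h : (col < row (nx z c i.+1) r.+1)%N by apply: leq_trans h (cle _ _ _ _ iN).
    case=> [/andP[h' _]|[_ e]]; last by rewrite ltnNge e in h.
    by move: (leq_trans h (st i r iN)); rewrite ltnNge h'.
  - move=> i r col; case: (ltnP i n) => [iN|ni]; last first.
      by rewrite /Mx insubF ?orbT // ltnNge ni.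
    have := al i r col iN; rewrite /allow.
    case: ifP => _; first by case: multi => //= /eqP ->.
    by case: ifP => // _ /eqP ->; rewrite orbT.
split=> //; apply: lev_chainK => //; first exact: first_entry_level.
move=> r col h1 h2; apply: (@eq_from_lt n).
- by rewrite ltnW //; case: (first_entry_in vM h1 h2).
- exact: level_of_le.
- by move=> i iN; rewrite lev // (level_ofP mc).
Qed.

Lemma sum_newb M c r col : ok_mult M c ->
  (\sum_(i < n) newb (nx z c i) (nx z c i.+1) r col)%N = (row a r <= col < row z r)%N.
Proof.
move=> okM; have mc := ok_mono okM; have [c0 _ _] := okM.
have H k : (k <= n)%N ->
   (\sum_(i < k) newb (nx z c i) (nx z c i.+1) r col)%N =
   (row a r <= col < row (nx z c k) r)%N.
  elim: k => [|k IH] kN; first by rewrite big_ord0 c0; case: leqP => // h; rewrite ltnNge h.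
  rewrite big_ord_recr /= IH; last exact: ltnW.
  have h1 : (row a r <= row (nx z c k) r)%N by rewrite -c0 (chain_le _ mc) // ltnW.
  have h2 : (row (nx z c k) r <= row (nx z c k.+1) r)%N by rewrite (chain_le _ mc).
  by rewrite /newb; lia.
by rewrite H // nx_out.
Qed.

(** A valid filling belongs to exactly one chain, so the sum is taken over pairs of a filling and a
    chain. For a fixed chain the conditions on the filling separate by step and by box, which
    factors the sum. *)
Theorem sum_mult_chains (R : comNzRingType) (gamma : nat -> nat -> R) (m : nat -> nat) :
  (forall i, (i < n)%N -> (m i <= D)%N) ->
  \sum_(M : mult | `[< valid_mult a z M >] && [forall i : 'I_n, (\sum_b M i b)%N == m i])
    \prod_(b : 'I_l * 'I_l)
       gamma b.1 b.2 ^+ (\sum_(i < n) M i b - (row a b.1 <= b.2 < row z b.1))%N =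
  psum n (fun i k p => kG multi gamma k p (m i)) a z.
Proof.
move=> mD.
transitivity (\sum_(M : mult) \sum_(c : {ffun 'I_n -> shape l})
   if `[< ok_mult M c >] && [forall i : 'I_n, (\sum_b M i b)%N == m i] then
    \prod_(b : 'I_l * 'I_l)
       gamma b.1 b.2 ^+ (\sum_(i < n) M i b - (row a b.1 <= b.2 < row z b.1))%N else 0).
  rewrite big_mkcond /=; apply: eq_bigr => M _.
  case: (asboolP (valid_mult a z M)) => [vM|nvM] /=; last first.
    by rewrite big1 // => c _; case: asboolP => // /ok_valid[].
  rewrite (bigD1 (lev_chain n a z (first_entry M))) //= [X in _ + X]big1 ?addr0.
    by rewrite asboolT //; exact: valid_ok.
  by move=> c /eqP nc; case: asboolP => // /ok_valid[_ e]; case: nc.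
rewrite exchange_big /= /psum [RHS]big_mkcond /=; apply: eq_bigr => c _.
case: (boolP (nx z c 0%N == a)) => [/eqP c0|nc0]; last first.
  rewrite big1 // => M _; case: asboolP => // -[e _ _]; by rewrite e eqxx in nc0.
case: (boolP [forall i : 'I_n, hstrip (nx z c i) (nx z c i.+1)]) => [/forallP hs|]; last first.
  move=> nh; rewrite big1 => [|M _].
    by move: nh; rewrite negb_forall => /existsP[i /negbTE hi];
       rewrite (bigD1 i) //= /kG hi mul0r.
  case: asboolP => // -[_ hs _]; case/negP: nh; apply/forallP => i; exact: hs.
transitivity (\prod_(i < n) \sum_(v : {ffun 'I_l * 'I_l -> 'I_D.+1} | (\sum_b v b)%N == m i)
    \prod_(b : 'I_l * 'I_l) boxcoef multi gamma (nx z c i) (nx z c i.+1) b.1 b.2 (v b)); last first.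
  by apply: eq_bigr => i _; rewrite /kG hs (cprodE _ (D := D.+1)) // ltnS mD.
rewrite (bigA_distr_big_dep (fun (i : 'I_n) (v : {ffun 'I_l * 'I_l -> 'I_D.+1}) =>
   (\sum_b v b)%N == m i)) /= [RHS]big_mkcond /=; apply: eq_bigr => M _.
rewrite (_ : (M \in family _) = [forall i : 'I_n, (\sum_b M i b)%N == m i]); last first.
  by apply/familyP/forallP => h i; have := h i.
case: ifP => [/andP[/asboolP okM ->]|].
  rewrite exchange_big /=; apply: eq_bigr => b _; have [_ _ al] := okM.
  transitivity (\prod_(i < n) gamma b.1 b.2 ^+ (M i b - newb (nx z c i) (nx z c i.+1) b.1 b.2)).
    rewrite -expr_sum; congr (_ ^+ _); rewrite -(sum_newb b.1 b.2 okM) -sumnB //.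
    move=> i _; have := al i b.1 b.2 (ltn_ord i); rewrite Mx_ord -surjective_pairing /allow.
    by case: newb => //; case: multi => // /eqP ->.
  apply: eq_bigr => i _; rewrite /boxcoef.
  by have := al i b.1 b.2 (ltn_ord i); rewrite Mx_ord -surjective_pairing => ->.
case: (boolP [forall i : 'I_n, _]) => // _; rewrite andbT => /negbT/asboolPn nok.
case: (boolP [forall i : 'I_n, forall b : 'I_l * 'I_l,
   allow multi (nx z c i) (nx z c i.+1) b.1 b.2 (M i b)]) => [/forallP h|].
  case: nok; split=> // [i iN|i r col iN]; first exact: (hs (Ordinal iN)).
  case: (ltnP r l) => [rl|lr].
    case: (ltnP col l) => [cl|lc].
      have /forallP/(_ (Ordinal rl, Ordinal cl)) := h (Ordinal iN).
      by rewrite -Mx_ord.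
    have -> : Mx M i r col = 0%N.
      by apply/eqP; rewrite -leqn0 leqNgt; apply/negP => /Mx_bounds[_ _]; rewrite ltnNge lc.
    rewrite /allow (_ : newb _ _ _ _ = false); last first.
      apply/negbTE/negP => /andP[_ h']; move: (leq_trans h' (row_le _ _)).
      by rewrite ltnNge lc.
    by case: ifP => //; rewrite orbT.
  have -> : Mx M i r col = 0%N.
    by apply/eqP; rewrite -leqn0 leqNgt; apply/negP => /Mx_bounds[_]; rewrite ltnNge lr.
  rewrite /allow (_ : newb _ _ _ _ = false); last by rewrite /newb !row_out.
  by case: ifP => //; rewrite orbT.
rewrite negb_forall => /existsP[i]; rewrite negb_forall => /existsP[b /negbTE hb].
by rewrite (bigD1 i) //= (bigD1 b) //= /boxcoef hb mul0r mul0r.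
Qed.

End Chains.
End Multiplicities.

(** * Sorted words with prescribed multiplicities *)

Section SortedWords.
Variable n : nat.
Implicit Types (v : nat -> nat) (s : seq nat).

Definition ssq v : seq nat := sort leq (flatten [seq nseq (v i) i | i <- iota 0 n]).

Lemma count_ssq v i : count_mem i (ssq v) = if (i < n)%N then v i else 0%N.
Proof.
rewrite /ssq (permP (_ : perm_eq _ (flatten [seq nseq (v i) i | i <- iota 0 n]))); last first.
  by rewrite perm_sort.
rewrite count_flatten -map_comp sumnE big_map /=; case: ltnP => h.
  rewrite (bigD1_seq i) /= ?mem_iota ?iota_uniq // count_nseq /= eqxx mul1n.
  by rewrite big1 ?addn0 // => j /negbTE ji; rewrite count_nseq /= ji.
rewrite big_seq big1 // => j; rewrite mem_iota => /andP[_ js].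
by rewrite count_nseq /=; case: eqP => // ji; move: js; rewrite ji add0n ltnNge h.
Qed.

Lemma mem_ssq v i : (i \in ssq v) = (i < n)%N && (0 < v i)%N.
Proof.
by rewrite -has_pred1 has_count count_ssq; case: (ltnP i n).
Qed.

Lemma sorted_ssq v : sorted leq (ssq v).
Proof. exact: sort_sorted leq_total _. Qed.

Lemma ssqE s v : sorted leq s -> (forall i, (i \in s) -> (i < n)%N) ->
  (forall i, (i < n)%N -> v i = count_mem i s) -> ssq v = s.
Proof.
move=> ss sn vs; apply: (sorted_eq leq_trans anti_leq) => //; first exact: sorted_ssq.
apply/allP => i _ /=; rewrite count_ssq; case: ltnP => [/vs -> //|ni].
apply/eqP/esym/count_memPn; apply/negP => /sn; by rewrite ltnNge ni.
Qed.

Lemma size_ssq v : size (ssq v) = (\sum_(i < n) v i)%N.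
Proof.
rewrite size_sort size_flatten /seq.shape -map_comp sumnE big_map /=.
rewrite -[X in iota 0 X]subn0 -/(index_iota 0 n) big_mkord.
by apply: eq_bigr => i _; rewrite /= size_nseq.
Qed.

End SortedWords.

(** * Row-valued and set-valued tableaux as chains *)

Section HookChains.
Variables (R : realType) (l n : nat) (multi : bool) (lam mu : seq nat).
Hypotheses (flam : fits l lam) (fmu : fits l mu) (hsub : sub_part mu lam).
Variables (alpha beta : nat -> R) (m : {mset nat}%mset).
Hypothesis hm : forall e, (n <= e)%N -> m e = 0%N.
(* Row-valued tableaux (multi) carry only arms, set-valued tableaux only legs. *)
Hypothesis hab : if multi then beta = (fun=> 0) else alpha = (fun=> 0).

Let z : shape l := shape_of l lam.
Let a : shape l := shape_of l mu.
Let rz r : row z r = nth 0%N lam r := row_shape_of r flam.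
Let ra r : row a r = nth 0%N mu r := row_shape_of r fmu.
Let D : nat := (\sum_(i < n) m i)%N.
(** As one of [alpha], [beta] vanishes, this is both the weight of each further entry of a box and
    the factor of a removed corner. *)
Let gamma (r c : nat) : R := - (alpha c + beta r).

Let mD i : (i < n)%N -> (m i <= D)%N.
Proof. by move=> iN; rewrite /D (bigD1 (Ordinal iN)) //= leq_addr. Qed.

Lemma sub_rows r : (row a r <= row z r)%N.
Proof.
rewrite ra rz; case: (ltnP r (size mu)) => [rs|/(nth_default 0%N) -> //].
by have /allP/(_ r) := hsub; rewrite mem_iota; apply.
Qed.

Let mk_hook (s : seq nat) : hook :=
  if multi then (head 0%N s, behead s, [::]) else (head 0%N s, [::], behead s).

Let flat_hook (h : hook) : bool := if multi then nilp h.2 else nilp h.1.2.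

Lemma mk_hook_entries s : s != [::] -> hook_entries (mk_hook s) = s.
Proof. by case: s => // x s _; rewrite /mk_hook; case: multi; rewrite /hook_entries /= ?cats0. Qed.

Lemma mk_hookK h : flat_hook h -> mk_hook (hook_entries h) = h.
Proof.
case: h => [[x ar] le]; rewrite /flat_hook /mk_hook /hook_entries /=.
by case: multi => /nilP ->; rewrite ?cats0.
Qed.

Lemma hook_weight h r c : flat_hook h ->
  (- alpha c) ^+ hook_arm h * (- beta r) ^+ hook_leg h =
  gamma r c ^+ (size (hook_entries h)).-1.
Proof.
case: h => [[x ar] le]; rewrite /flat_hook /hook_arm /hook_leg /hook_entries /= /gamma.
by move: hab; case: multi => -> /nilP -> /=; rewrite ?cats0 ?addr0 ?add0r ?expr0 ?mulr1 ?mul1r.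
Qed.

Lemma hook_sorted h : flat_hook h -> is_hook_tableau h =
  sorted leq (hook_entries h) && (multi || uniq (hook_entries h)).
Proof.
case: h => [[x ar] le]; rewrite /flat_hook /is_hook_tableau /hook_entries /=.
case: multi => /nilP -> /=; rewrite ?cats0 ?andbT //.
by rewrite -[path ltn x le]/(sorted ltn (x :: le)) ltn_sorted_uniq_leq andbC.
Qed.

Section FixedCorners.
Variable S : {set 'I_(size mu)}.
Hypothesis corS : [forall (r | r \in S), is_corner_row mu r].

Let nu : seq nat := remove_corners S.

Let inS (r : nat) : bool := if insub r is Some i then i \in S else false.

Lemma nth_nu r : nth 0%N nu r = (nth 0%N mu r - inS r)%N.
Proof.
rewrite /nu /remove_corners /inS; case: insubP => [i _ ir|nr].
  have {ir}-> : r = nat_of_ord i by rewrite -ir.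
  by rewrite (nth_map (i : 'I_(size mu))) ?size_enum_ord // (nth_ord_enum i i).
by rewrite -leqNgt in nr; rewrite !nth_default // size_map size_enum_ord.
Qed.

Lemma inS_corner r : inS r -> (row a r.+1 < row a r)%N.
Proof.
rewrite /inS; case: insubP => // i _ <- iS.
by have /forall_inP/(_ i iS) := corS; rewrite /is_corner_row !ra.
Qed.

Lemma mem_nu_boxes r c : ((r, c) \in skew_boxes lam nu) =
  (row a r <= c < row z r)%N || inS r && (c.+1 == row a r).
Proof.
rewrite mem_boxes nth_nu -ra -rz; have := sub_rows r; have := @inS_corner r.
by case: (inS r) => //=; [move=> /(_ isT)|move=> _]; lia.
Qed.

Let multT := mult l n D.

(** Reads the set of removed corners off the filling; the guard [0 < row a r] keeps [.-1] a true
    predecessor. *)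
Definition corner_rows (M : multT) : {set 'I_(size mu)} :=
  [set r : 'I_(size mu) | (0 < row a r)%N && [exists i : 'I_n, (0 < Mx M i r (row a r).-1)%N]].

Let okM (M : multT) : bool := `[< valid_mult multi a z M >] &&
  [forall i : 'I_n, (\sum_b M i b)%N == m i] && (corner_rows M == S).

Lemma okM_box M i r c : okM M -> (0 < Mx M i r c)%N -> (r, c) \in skew_boxes lam nu.
Proof.
case/andP=> /andP[/asboolP[_ v2 _ _ _] _] /eqP cS Mp; rewrite mem_nu_boxes.
have /orP[-> //|/andP[/eqP e _]] := v2 _ _ _ Mp.
rewrite e eqxx andbT; apply/orP; right.
have rs : (r < size mu)%N.
  by rewrite ltnNge; apply/negP => h; move: e; rewrite ra nth_default.
rewrite /inS insubT -cS inE /= -e /=; have [iN _ _] := Mx_bounds Mp.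
by apply/existsP; exists (Ordinal iN).
Qed.

Let fill (M : multT) : {ffun box lam nu -> hook} :=
  [ffun b => mk_hook (ssq n (fun i => Mx M i (val b).1 (val b).2))].

Lemma okM_nonempty M (b : box lam nu) : okM M ->
  ssq n (fun i => Mx M i (val b).1 (val b).2) != [::].
Proof.
move=> oM; have : val b \in skew_boxes lam nu by exact: valP.
case: (val b) => r c /=; rewrite mem_nu_boxes => hb.
have [i Mp] : exists i, (0 < Mx M i r c)%N.
  case/andP: oM => /andP[/asboolP[v1 _ _ _ _] _] /eqP cS.
  case/orP: hb => [/andP[h1 h2]|/andP[rS /eqP e]]; first exact: v1.
  move: rS; rewrite /inS; case: insubP => // i _ ir; rewrite -cS inE ir -e /=.
  by move=> /existsP[j]; exists j.
have [iN _ _] := Mx_bounds Mp.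
by apply/eqP => e; have := mem_ssq n (fun i => Mx M i r c) i; rewrite e iN Mp.
Qed.

Lemma fill_entries M b : okM M ->
  hook_entries (fill M b) = ssq n (fun i => Mx M i (val b).1 (val b).2).
Proof. by move=> oM; rewrite ffunE mk_hook_entries // okM_nonempty. Qed.

Lemma fill_flat M b : flat_hook (fill M b).
Proof. by rewrite ffunE /flat_hook /mk_hook; case: multi. Qed.

Lemma big_nu_box (U : Type) (idx : U) (op : Monoid.com_law idx) (F : nat -> nat -> U) :
  (forall r c, (r, c) \notin skew_boxes lam nu -> F r c = idx) ->
  \big[op/idx]_(b : box lam nu) F (val b).1 (val b).2 =
  \big[op/idx]_(b : 'I_l * 'I_l) F b.1 b.2.
Proof.
move=> F0; rewrite (@big_box lam nu _ _ _ l); last by case/and3P: flam.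
rewrite -(pair_big xpredT xpredT (fun r c : 'I_l => F r c)) /=; apply: eq_bigr => r _.
rewrite -(big_mkord xpredT (fun c => F r c)) -rz nth_nu -ra.
have h1 : (row a r - inS r <= row z r)%N by apply: leq_trans (leq_subr _ _) (sub_rows r).
rewrite (@big_cat_nat _ _ _ (row a r - inS r) 0 l) ?(leq_trans h1) ?row_le //=.
rewrite (@big_cat_nat _ _ _ (row z r) (row a r - inS r) l) ?row_le //=.
rewrite [X in op X _]big_nat_cond [X in op X _]big1 => [|c]; last first.
  by rewrite andbT => /andP[_ h]; apply: F0; rewrite mem_boxes nth_nu -ra; lia.
rewrite [X in op _ (op _ X)]big_nat_cond [X in op _ (op _ X)]big1 => [|c]; last first.
  by rewrite andbT => /andP[h _]; apply: F0; rewrite mem_boxes -rz; lia.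
by rewrite Monoid.mul1m Monoid.mulm1.
Qed.

Lemma content_count (T : {ffun box lam nu -> hook}) i :
  hook_content T i = (\sum_b count_mem i (hook_entries (T b)))%N.
Proof.
rewrite /hook_content mset_seqE count_flatten -map_comp sumnE big_map big_enum /=.
by apply: eq_bigr.
Qed.

Lemma fill_valid M : okM M ->
  [/\ is_hook_valued (fill M), hook_content (fill M) = m & forall b, flat_hook (fill M b)].
Proof.
move=> oM; have := oM; case/andP=> /andP[/asboolP[v1 v2 v3 v4 v5] /forallP cs] _.
split; last by move=> b; exact: fill_flat.
  apply/andP; split; apply/forallP => b.
    rewrite hook_sorted ?fill_flat // fill_entries // sorted_ssq /=.
    case: (boolP multi) => //= nm; apply: count_mem_uniq => i.
    rewrite count_ssq -has_pred1 has_count count_ssq; case: ltnP => // iN.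
    by have := v5 i (val b).1 (val b).2; rewrite (negbTE nm) /=; case: (Mx _ _ _ _) => [|[|]].
  apply/forallP => b'; apply/andP; split; apply/implyP => /eqP vb'.
    apply/allrelP => x y; rewrite !fill_entries // !mem_ssq vb' /= => /andP[_ h1] /andP[_ h2].
    exact: v3 h1 h2.
  apply/allrelP => x y; rewrite !fill_entries // !mem_ssq vb' /= => /andP[_ h1] /andP[_ h2].
  exact: v4 h1 h2.
apply: mset_ext => i; rewrite content_count.
transitivity (\sum_(b : box lam nu) if (i < n)%N then Mx M i (val b).1 (val b).2 else 0)%N.
  by apply: eq_bigr => b _; rewrite fill_entries // count_ssq.
case: ltnP => [iN|/hm ->]; last by rewrite big1.
rewrite (@big_nu_box _ _ _ (Mx M i)) => [|r c nb].
  rewrite -(eqP (cs (Ordinal iN))); apply: eq_bigr => -[r c] _ /=.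
  exact: (Mx_ord M (Ordinal iN) r c).
by apply/eqP; rewrite -leqn0 leqNgt; apply: contra nb; exact: okM_box.
Qed.

(** In a removed corner the hook pays [gamma] for every entry but one, and the product over [S] pays
    for that one. In a box of lam/mu one entry stays free. *)
Lemma fill_weight M : okM M ->
  (\prod_(r in S) - (alpha (nth 0%N mu r).-1 + beta r)) *
  \prod_(b : box lam nu) ((- alpha (val b).2) ^+ hook_arm (fill M b) *
    (- beta (val b).1) ^+ hook_leg (fill M b)) =
  \prod_(b : 'I_l * 'I_l)
    gamma b.1 b.2 ^+ (\sum_(i < n) M i b - (row a b.1 <= b.2 < row z b.1))%N.
Proof.
move=> oM.
have sM (r c : 'I_l) : (\sum_(i < n) M i (r, c))%N = (\sum_(i < n) Mx M i r c)%N.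
  by apply: eq_bigr => i _; rewrite Mx_ord.
pose w1 (r c : nat) : R := if (r, c) \in skew_boxes lam nu
  then gamma r c ^+ (\sum_(i < n) Mx M i r c).-1 else 1.
pose w2 (r c : nat) : R := if inS r && (c.+1 == row a r) then gamma r c else 1.
transitivity ((\prod_(b : 'I_l * 'I_l) w2 b.1 b.2) * (\prod_(b : 'I_l * 'I_l) w1 b.1 b.2)).
  congr (_ * _).
    rewrite -(pair_big xpredT xpredT (fun r c : 'I_l => w2 r c)) /=.
    transitivity (\prod_(r < l) if inS r then gamma r (nth 0%N mu r).-1 else 1).
      rewrite big_mkcond /= [RHS](bigID (fun r : 'I_l => (r < size mu)%N)) /=.
      rewrite [X in _ * X]big1 ?mulr1 => [|r nr]; last by rewrite /inS insubN.
      rewrite -(big_ord_widen l (fun r => if inS r then gamma r (nth 0%N mu r).-1 else 1)).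
        by apply: eq_bigr => r _; rewrite /inS valK.
      by case/and3P: fmu.
    apply: eq_bigr => r _; rewrite /w2; case: (boolP (inS r)) => rS /=; last by rewrite big1.
    have := inS_corner rS; case E: (row a r) => [//|k] _; rewrite -ra E /=.
    have kl : (k < l)%N by rewrite -E row_le.
    rewrite (bigD1 (Ordinal kl)) //= eqxx big1 ?mulr1 // => c ck.
    by rewrite eqSS -val_eqE /= in ck *; rewrite (negbTE ck).
  rewrite -(@big_nu_box _ _ _ w1) => [|r c /negbTE nb]; last by rewrite /w1 nb.
  apply: eq_bigr => b _; rewrite hook_weight ?fill_flat // fill_entries // size_ssq /w1.
  by rewrite -surjective_pairing (valP b).
rewrite -big_split /=; apply: eq_bigr => -[r c] _ /=; rewrite sM /w1 /w2 mem_nu_boxes.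
case: (boolP (inS r && (c.+1 == row a r))) => [/andP[rS /eqP e]|h].
  have -> : (row a r <= c)%N = false by rewrite -e ltnn.
  rewrite orbT subn0 -exprS prednK //.
  have hb : (r : nat, c : nat) \in skew_boxes lam nu by rewrite mem_nu_boxes rS e eqxx orbT.
  have := okM_nonempty (Sub (r : nat, c : nat) hb) oM.
  by rewrite -size_eq0 size_ssq /= lt0n.
rewrite orbF mul1r; case: ifP => h'; first by rewrite subn1.
rewrite subn0 big1 ?expr0 // => i _; apply/eqP; rewrite -leqn0 leqNgt; apply/negP => Mp.
by have := okM_box oM Mp; rewrite mem_nu_boxes h' (negbTE h).
Qed.

Lemma hook_sum_mult :
  (\prod_(r in S) - (alpha (nth 0%N mu r).-1 + beta r)) * G_skew lam nu alpha beta m =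
  \sum_(M | okM M) \prod_(b : 'I_l * 'I_l)
    gamma b.1 b.2 ^+ (\sum_(i < n) M i b - (row a b.1 <= b.2 < row z b.1))%N.
Proof.
rewrite /G_skew; set A := (X in \sum_(T \in X) _).
pose A' : set {ffun box lam nu -> hook} :=
  [set T | [/\ is_hook_valued T, hook_content T = m & forall b, flat_hook (T b)]]%classic.
(* A hook extending in the direction whose parameters vanish has weight 0, so only flat hooks
   contribute. *)
rewrite -(@fsbig_widen _ _ _ _ A' A); first last.
- move=> T [[hT cT] nA] /=; have [b nb] : exists b, ~~ flat_hook (T b).
    apply: contrapT => h; apply: nA; split=> // b.
    by apply/negPn/negP => nb; apply: h; exists b.
  rewrite (bigD1 b) //= [X in X * _](_ : _ = 0) ?mul0r //.
  move: hab nb; rewrite /flat_hook /nilp /hook_arm /hook_leg; case: multi => -> nb.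
    by rewrite oppr0 expr0n (negbTE nb) mulr0.
  by rewrite oppr0 expr0n (negbTE nb) mul0r.
- by move=> T [].
rewrite (@fsbig_reindex _ _ _ okM _ fill).
- by rewrite mulr_sumr; apply: eq_bigr => M /fill_weight.
- by move=> M /fill_valid[h1 h2 h3].
- move=> M M' oM oM' E; apply/ffunP => i; apply/ffunP => -[r c]; apply/val_inj => /=.
  rewrite -!Mx_ord.
  case: (boolP ((r : nat, c : nat) \in skew_boxes lam nu)) => hb.
    have := congr1 (fun f : {ffun box lam nu -> hook} =>
      count_mem (i : nat) (hook_entries (f (Sub (r : nat, c : nat) hb)))) E.
    by rewrite !fill_entries // !count_ssq ltn_ord.
  have Z (M0 : multT) : okM M0 -> Mx M0 i r c = 0%N.
    move=> oM0; apply/eqP; rewrite -leqn0 leqNgt; apply: contra hb; exact: okM_box.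
  by rewrite !Z.
(* Surjectivity: the multiplicities of the entries of [T] form a valid filling that gives [T]
   back. *)
move=> T [hT cT fT].
have ent b i : (count_mem i (hook_entries (T b)) <= m i)%N.
  by rewrite -cT content_count (bigD1 b) //= leq_addr.
have entn b i : i \in hook_entries (T b) -> (i < n)%N.
  rewrite -has_pred1 has_count => h; rewrite ltnNge; apply/negP => /hm e.
  by have := leq_trans h (ent b i); rewrite e.
pose cnt (i r c : nat) : nat :=
  if box_at lam nu r c is Some b then count_mem i (hook_entries (T b)) else 0%N.
pose M : multT := [ffun i : 'I_n => [ffun b : 'I_l * 'I_l => inord (cnt i b.1 b.2)]].
have cntD i r c : (i < n)%N -> (cnt i r c <= D)%N.
  move=> iN; rewrite /cnt; case: box_at => // b; exact: leq_trans (ent b i) (mD iN).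
have cntb i r c : (0 < cnt i r c)%N -> (i < n)%N /\
    exists2 b : box lam nu, val b = (r, c) & i \in hook_entries (T b).
  rewrite /cnt /box_at; case: insubP => // b _ vb h.
  have ib : i \in hook_entries (T b) by rewrite -has_pred1 has_count.
  by split; [exact: entn ib|exists b].
have cntbox (b : box lam nu) i : cnt i (val b).1 (val b).2 = count_mem i (hook_entries (T b)).
  by rewrite /cnt /box_at -surjective_pairing valK.
have MxE i r c : Mx M i r c = cnt i r c.
  case: (boolP ((i < n) && (r < l) && (c < l))%N) => [/andP[/andP[iN rl] cl]|h].
    by rewrite (Mx_ord M (Ordinal iN) (Ordinal rl) (Ordinal cl)) !ffunE /= inordK // ltnS cntD.
  have -> : Mx M i r c = 0%N.
    apply/eqP; rewrite -leqn0 leqNgt; apply: contra h => /Mx_bounds[-> -> ->]; by [].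
  apply/esym/eqP; rewrite -leqn0 leqNgt; apply: contra h => /cntb[-> [b vb _]].
  have : (r, c) \in skew_boxes lam nu by rewrite -vb; exact: valP.
  rewrite mem_boxes -rz => /andP[_ h2] /=; rewrite (leq_trans h2 (row_le _ _)) andbT.
  by case: (ltnP r l) h2 => // /row_out ->.
have hTt b : is_hook_tableau (T b) by case/andP: hT => /forallP.
have srt b : sorted leq (hook_entries (T b)) by have := hTt b; rewrite hook_sorted // => /andP[].
have rel b b' : (right_of b b' ==> allrel leq (hook_entries (T b)) (hook_entries (T b')))
  && (below b b' ==> allrel ltn (hook_entries (T b)) (hook_entries (T b'))).
  by case/andP: hT => _ /forallP/(_ b)/forallP.
have vM : valid_mult multi a z M.
  split.
  - move=> r c h1 h2; have hb : (r, c) \in skew_boxes lam nu by rewrite mem_nu_boxes h1 h2.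
    pose b : box lam nu := Sub (r, c) hb.
    exists (T b).1.1; rewrite MxE (cntbox b) -has_count has_pred1.
    by rewrite /hook_entries mem_head.
  - move=> i r c; rewrite MxE => /cntb[_ [b vb _]].
    have : (r, c) \in skew_boxes lam nu by rewrite -vb; exact: valP.
    rewrite mem_nu_boxes => /orP[-> //|/andP[/inS_corner h /eqP e]].
    by apply/orP; right; apply/andP; split; [rewrite e|rewrite -ltnS e].
  - move=> i i' r c; rewrite !MxE => /cntb[_ [b vb ib]] /cntb[_ [b' vb' ib']].
    have /andP[/implyP h _] := rel b b'.
    by apply: (allrelP (h _)) => //; rewrite /right_of vb vb'.
  - move=> i i' r c; rewrite !MxE => /cntb[_ [b vb ib]] /cntb[_ [b' vb' ib']].
    have /andP[_ /implyP h] := rel b b'.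
    by apply: (allrelP (h _)) => //; rewrite /below vb vb'.
  - move=> i r c; rewrite MxE; case: (boolP multi) => //= nm.
    rewrite /cnt; case: box_at => // b.
    have := hTt b; rewrite hook_sorted // (negbTE nm) orFb => /andP[_ u].
    by rewrite count_uniq_mem // leq_b1.
have csM (i : 'I_n) : (\sum_b M i b)%N = m i.
  rewrite -cT content_count; transitivity (\sum_(b : 'I_l * 'I_l) Mx M i b.1 b.2)%N.
    by apply: eq_bigr => -[r c] _; rewrite Mx_ord.
  rewrite -(@big_nu_box _ _ _ (Mx M i)) => [|r c nb]; last first.
    by rewrite MxE /cnt /box_at insubN.
  by apply: eq_bigr => b _; rewrite MxE cntbox.
exists M.
  rewrite /okM asboolT //=; apply/andP; split; first by apply/forallP => i; rewrite csM.
  apply/eqP/setP => r; rewrite inE; apply/idP/idP.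
    case/andP=> a0 /existsP[i]; rewrite MxE => /cntb[_ [b vb _]].
    have : (r : nat, (row a r).-1) \in skew_boxes lam nu by rewrite -vb; exact: valP.
    rewrite mem_nu_boxes leqNgt prednK // leqnn /= => /andP[].
    by rewrite /inS valK.
  move=> rS; have iS : inS r by rewrite /inS valK.
  have a0 : (0 < row a r)%N by apply: leq_ltn_trans (inS_corner iS).
  have hb : (r : nat, (row a r).-1) \in skew_boxes lam nu.
    by rewrite mem_nu_boxes iS prednK // eqxx orbT.
  pose b : box lam nu := Sub (r : nat, (row a r).-1) hb.
  rewrite a0 /=; have iN : ((T b).1.1 < n)%N by apply: (entn b); rewrite mem_head.
  apply/existsP; exists (Ordinal iN); rewrite MxE (cntbox b) -has_count has_pred1.
  by rewrite /hook_entries mem_head.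
apply/ffunP => b; rewrite ffunE -[RHS]mk_hookK //; congr mk_hook.
apply: ssqE => // [i|i _]; first exact: entn.
by rewrite MxE cntbox.
Qed.

End FixedCorners.

(** The sum over removed corners becomes the partition of all valid fillings by the corners of mu
    that they occupy. *)
Theorem hook_chains :
  G_dslash lam mu alpha beta m = psum n (fun i k p => kG multi gamma k p (m i)) a z.
Proof.
rewrite -(@sum_mult_chains l n D multi a z sub_rows R gamma m mD) /G_dslash hsub.
rewrite [RHS](partition_big corner_rows
  (fun S : {set 'I_(size mu)} => [forall (r | r \in S), is_corner_row mu r])) /=; last first.
  move=> M /andP[/asboolP[_ v2 _ _ _] _]; apply/forall_inP => r; rewrite inE.
  case/andP=> a0 /existsP[i /v2 /orP[|/andP[_ h]]]; first by rewrite leqNgt prednK // leqnn.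
  by rewrite /is_corner_row -!ra (leq_ltn_trans h) // prednK.
by apply: eq_bigr => S cS; rewrite hook_sum_mult.
Qed.

End HookChains.

(** * Kostka numbers and the involution omega *)

Section Conjugates.
Variable l : nat.
Implicit Types (c y k p : shape l) (s : seq nat).

Definition seq_of c : seq nat := [seq x <- mkseq (row c) l | (0 < x)%N].

Lemma nth_seq_of c r : nth 0%N (seq_of c) r = row c r.
Proof.
pose h := (\sum_(i < l) (0 < row c i))%N.
have hP i : (i < h)%N = (0 < row c i)%N.
  rewrite /h (count_initial (P := fun i => (0 < row c i)%N)) // => j.
    by move=> hj; apply: leq_trans hj (row_dec _ _).
  by case: (ltnP j l) => // /row_out ->.
have hl : (h <= l)%N by rewrite leqNgt hP row_out.
have -> : seq_of c = mkseq (row c) h.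
  have El : iota 0 l = iota 0 h ++ iota h (l - h) by rewrite -[in LHS](subnKC hl) iotaD.
  rewrite /seq_of /mkseq El map_cat filter_cat /=.
  rewrite [X in X ++ _](_ : _ = mkseq (row c) h) /mkseq; last first.
    by apply/all_filterP/allP => x /mapP[i]; rewrite mem_iota => /andP[_ ih] ->; rewrite -hP.
  rewrite [X in _ ++ X](_ : _ = [::]) ?cats0 //.
  apply/eqP; rewrite -[_ == _]negbK -has_filter; apply/hasPn => x /mapP[i].
  by rewrite mem_iota => /andP[ih _] ->; rewrite -hP -leqNgt.
case: (ltnP r h) => rh; first by rewrite nth_mkseq.
rewrite nth_default ?size_mkseq //; apply/esym/eqP.
by rewrite -leqn0 leqNgt -hP -leqNgt.
Qed.

Lemma partition_nth s : (forall r, nth 0 s r.+1 <= nth 0 s r)%N -> (0%N \notin s) ->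
  is_partition s.
Proof.
move=> h n0; rewrite /is_partition n0 andbT.
by apply/(sortedP 0%N) => i _; exact: h.
Qed.

Lemma fits_seq_of c : fits l (seq_of c).
Proof.
apply/and3P; split.
- apply: partition_nth => [r|]; first by rewrite !nth_seq_of row_dec.
  by rewrite mem_filter.
- by rewrite size_filter (leq_trans (count_size _ _)) // size_mkseq.
- by rewrite -nth0 nth_seq_of row_le.
Qed.

Lemma shape_of_seq c : shape_of l (seq_of c) = c.
Proof. by apply: shape_ext => r _; rewrite row_shape_of ?fits_seq_of // nth_seq_of. Qed.

Lemma nth_conj s j : is_partition s -> nth 0%N (conj_part s) j = count (fun x => j < x)%N s.
Proof.
move=> ps; case: (ltnP j (head 0%N s)) => h; first by rewrite nth_mkseq.
rewrite nth_default ?size_mkseq //; apply/esym/eqP; rewrite -leqn0 leqNgt -has_count.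
apply/hasPn => x /(nthP 0%N)[i _ <-]; rewrite -leqNgt; apply: leq_trans h.
rewrite -nth0; elim: i => // i IH; exact: leq_trans (nth_partition i ps) IH.
Qed.

Lemma count_lt_partition s j r : is_partition s ->
  (r < count (fun x => j < x)%N s)%N = (j < nth 0 s r)%N.
Proof.
move=> ps; rewrite -sum1_count big_mkcond /= (big_nth 0%N) big_mkord.
rewrite (eq_bigr (fun i : 'I_(size s) => nat_of_bool (j < nth 0 s i)%N)) => [|i _]; last first.
  by case: ltnP.
rewrite (count_initial (P := fun i => (j < nth 0 s i)%N)) // => i.
  by move=> h; apply: leq_trans h (nth_partition i ps).
by case: (ltnP i (size s)) => // /(nth_default 0%N) ->.
Qed.

Lemma conj_is_partition s : is_partition s -> is_partition (conj_part s).
Proof.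
move=> ps; apply: partition_nth => [r|].
  rewrite !nth_conj //; apply: sub_count => x /=; exact: ltnW.
apply/mapP => -[j]; rewrite mem_iota add0n => /andP[_ jh] /eqP.
rewrite eq_sym; apply/negP; rewrite -lt0n count_lt_partition //.
Qed.

Lemma fits_conj s : fits l s -> fits l (conj_part s).
Proof.
case/and3P=> ps sl s0; apply/and3P; split; first exact: conj_is_partition.
  by rewrite size_mkseq.
by rewrite -nth0 nth_conj // (leq_trans (count_size _ _)).
Qed.

Lemma shape_of_conj s : fits l s -> shape_of l (conj_part s) = tr (shape_of l s).
Proof.
move=> fs; have ps : is_partition s by case/and3P: fs.
apply: shape_ext_lt => r j; rewrite row_tr !row_shape_of ?fits_conj // nth_conj //.
by rewrite count_lt_partition.
Qed.

Lemma conj_seq_of y : conj_part (seq_of y) = seq_of (tr y).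
Proof.
apply: (@fits_inj l); rewrite ?fits_conj ?fits_seq_of //.
by rewrite shape_of_conj ?fits_seq_of // !shape_of_seq.
Qed.

Lemma conj_partK s : fits l s -> conj_part (conj_part s) = s.
Proof.
move=> fs; apply: (@fits_inj l) => //; first by rewrite !fits_conj.
by rewrite !shape_of_conj ?fits_conj // trK.
Qed.

Definition area c : nat := (\sum_(r < l) row c r)%N.

Lemma area_tr c : area (tr c) = area c.
Proof.
have rE (y : shape l) (r : nat) : row y r = (\sum_(j < l) (j < row y r))%N.
  rewrite -[LHS]subn0 -(@sum_interval 0 (row y r) 0 l) ?row_le // big_mkord.
  by apply: eq_bigr.
rewrite /area (eq_bigr _ (fun (r : 'I_l) _ => rE (tr c) r)) exchange_big /=.
apply: eq_bigr => r _; rewrite [RHS]rE; apply: eq_bigr => j _; by rewrite row_tr.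
Qed.

Definition vstrip k p : bool := [forall r : 'I_l, (row k r <= row p r <= (row k r).+1)%N].

Lemma vstripP k p : reflect (forall r, row k r <= row p r <= (row k r).+1)%N (vstrip k p).
Proof.
apply: (iffP forallP) => [h r|h r //].
by case: (ltnP r l) => [rl|lr]; [exact: (h (Ordinal rl))|rewrite !row_out].
Qed.

Lemma hstrip_tr k p : hstrip (tr k) (tr p) = vstrip k p.
Proof.
apply/hstripP/vstripP => [[h1 h2] r|h].
  apply/andP; split.
    rewrite leqNgt; apply/negP => h; have := h; rewrite -row_tr => h'.
    by have := leq_trans h' (h1 _); rewrite row_tr ltnn.
  rewrite leqNgt; apply/negP; rewrite -row_tr => h'.
  by have := leq_trans h' (h2 _); rewrite row_tr ltnn.
split=> r; rewrite leqNgt; apply/negP => h'; have := h'.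
  rewrite row_tr => h1; have /andP[h2 _] := h (row (tr p) r).
  by have := leq_trans h1 h2; rewrite -row_tr ltnn.
rewrite row_tr => h1; have /andP[_ h2] := h (row (tr k) r).
by have := leq_trans h1 h2; rewrite ltnS -row_tr ltnn.
Qed.

Lemma area_sub k p : (forall r, row k r <= row p r)%N ->
  (\sum_(r < l) (row p r - row k r))%N = (area p - area k)%N.
Proof. by move=> h; rewrite sumnB. Qed.

(** At beta = 0 a merged box contributes a factor 0. What remains is the Pieri rule for h_a;
    [pD_zero] is the one for e_a. *)
Lemma pA_zero (R : comNzRingType) k p :
  pA (fun=> 0 : R) k p = if hstrip k p then 'X^(area p - area k) else 0.
Proof.
rewrite /pA /kA; case: hstripP => [[h1 h2]|nh].
  rewrite -area_sub // expr_sum; apply: eq_bigr => r _; rewrite /cellA h1.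
  have /eqP -> : (row p r.+1 - row k r == 0)%N by rewrite subn_eq0.
  by rewrite mul1r (maxn_idPl _).
case: (boolP [forall r : 'I_l, (row k r <= row p r)%N && (row p r.+1 <= row k r)%N]).
  move/forallP=> h; case: nh; split=> r; case: (ltnP r l) => [rl|lr]; rewrite ?(row_out _ lr) //.
  - by case/andP: (h (Ordinal rl)).
  - by case/andP: (h (Ordinal rl)).
  - by rewrite row_out // leqW.
rewrite negb_forall => /existsP[r hr]; rewrite (bigD1 r) //= /cellA.
case: ifP => h; rewrite ?mul0r //; rewrite h /= -ltnNge in hr.
by rewrite polyC0 expr0n subn_eq0 leqNgt hr !mul0r.
Qed.

Lemma pD_zero (R : comNzRingType) k p :
  pD (fun=> 0 : R) k p = if vstrip k p then 'X^(area p - area k) else 0.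
Proof.
rewrite /pD /kD; case: vstripP => [h|nh].
  have h1 r : (row k r <= row p r)%N by case/andP: (h r).
  rewrite -area_sub // expr_sum; apply: eq_bigr => r _; rewrite /cellD.
  case: (eqVneq (row p r) (row k r)) => [->|ne]; first by rewrite subnn.
  have -> : row p r = (row k r).+1.
    by apply/eqP; rewrite eqn_leq; case/andP: (h r) => h1' -> /=; rewrite ltn_neqAle eq_sym ne.
  by rewrite eqxx subSnn polyC0 mul0rn addr0.
case: (boolP (vstrip k p)) => [/vstripP //|].
rewrite negb_forall => /existsP[r hr]; rewrite (bigD1 r) //= cellD_supp ?mul0r //.
  by apply: contraNneq hr => ->; rewrite leqnn leqnSn.
by apply: contraNneq hr => ->; rewrite leqnSn leqnn.
Qed.

Lemma pA_tr (R : comNzRingType) k p :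
  pA (fun=> 0 : R) (tr k) (tr p) = pD (fun=> 0) k p.
Proof. by rewrite pA_zero pD_zero hstrip_tr !area_tr. Qed.

Lemma tr0 : tr (shape0 l) = shape0 l.
Proof. by apply: shape_ext_lt => r j; rewrite row_tr !row0. Qed.

Lemma shape_of_nil : shape_of l [::] = shape0 l.
Proof.
apply: shape_ext => r _; rewrite row_shape_of ?nth_nil ?row0 //.
Qed.

End Conjugates.

(** * Kostka numbers and uniqueness of Schur expansions *)

Section Kostka.
Variable R : realType.
Implicit Types (nu kap : seq nat).

Definition word_mset nu : seq nat := flatten [seq nseq (nth 0%N nu i) i | i <- iota 0 (size nu)].

Lemma count_word_mset nu i : count_mem i (word_mset nu) = nth 0%N nu i.
Proof.
rewrite /word_mset count_flatten -map_comp sumnE big_map /=.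
case: (ltnP i (size nu)) => h.
  rewrite (bigD1_seq i) /= ?mem_iota ?iota_uniq // count_nseq /= eqxx mul1n.
  by rewrite big1 ?addn0 // => j /negbTE ji; rewrite count_nseq /= ji.
rewrite nth_default // big_seq big1 // => j; rewrite mem_iota => /andP[_ js].
by rewrite count_nseq /=; case: eqP => // ji; move: js; rewrite ji add0n ltnNge h.
Qed.

(** Both the sum of the row indices over the boxes of shape nu and the sum of the entries of any
    tableau of content nu. *)
Definition nstat nu : nat := (\sum_(i < size nu) i * nth 0%N nu i)%N.

Lemma sum_word_mset nu : (\sum_(e <- word_mset nu) e)%N = nstat nu.
Proof.
rewrite /word_mset big_flatten /= big_map -[X in iota 0 X]subn0 -/(index_iota _ _) big_mkord.
by apply: eq_bigr => i _; rewrite big_nseq iter_addn_0.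
Qed.

Lemma partition_ext nu kap : is_partition nu -> is_partition kap ->
  (forall r, nth 0%N nu r = nth 0%N kap r) -> nu = kap.
Proof.
move=> pn pk h; pose l := (maxn (maxn (size nu) (size kap)) (maxn (head 0%N nu) (head 0%N kap))).
have fn : fits l nu by rewrite /fits pn /l; lia.
have fk : fits l kap by rewrite /fits pk /l; lia.
apply: (fits_inj fn fk); apply: shape_ext => r _; by rewrite !row_shape_of.
Qed.

Lemma ssyt_row kap (T : {ffun box kap [::] -> nat}) b :
  is_partition kap -> is_ssyt T -> ((val b).1 <= T b)%N.
Proof.
move=> pk /forallP hT; have [N] := ubnP (val b).1; elim: N b => // N IH b.
case E: (val b) => [[|r] c] //=; rewrite ltnS => rN.
have hb : (r.+1, c) \in skew_boxes kap [::] by rewrite -E; exact: valP.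
have ha : (r, c) \in skew_boxes kap [::].
  move: hb; rewrite !mem_boxes !nth_nil /= => h; exact: leq_trans h (nth_partition r pk).
pose b' : box kap [::] := Sub (r, c) ha.
have vb' : val b' = (r, c) by [].
have h1 : (r <= T b')%N by have := IH b'; rewrite vb' /=; apply.
have /forallP/(_ b)/andP[_ /implyP h2] := hT b'.
by apply: leq_ltn_trans h1 (h2 _); rewrite /below vb' E /= eqxx.
Qed.

Definition kostka kap nu : R := schur R kap (seq_mset (word_mset nu)).

(** With indices from 0, an entry of a semistandard tableau is at least its row index. Summing over
    the boxes compares the statistics, and equality forces every entry to be its row index. *)
Lemma ssyt_stat kap nu (T : {ffun box kap [::] -> nat}) :
  is_partition kap -> is_partition nu ->
  is_ssyt T -> seq_mset [seq T b | b : box kap [::]] = seq_mset (word_mset nu) ->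
  (nstat kap <= nstat nu)%N /\
  ((nstat nu <= nstat kap)%N -> kap = nu /\ forall b, T b = (val b).1).
Proof.
move=> pk pn sT /eq_seq_msetP pm.
have s1 : (\sum_b T b)%N = nstat nu.
  by rewrite -sum_word_mset -(perm_big _ pm) /= big_image.
have s2 : (\sum_(b : box kap [::]) (val b).1)%N = nstat kap.
  rewrite (@big_box kap [::] _ _ _ (size kap) (fun r _ => r)) //; apply: eq_bigr => r _.
  by rewrite sum_nat_const_nat nth_nil subn0 mulnC.
have hT b : ((val b).1 <= T b)%N by exact: ssyt_row.
rewrite -s1 -s2; split=> [|h]; first by apply: leq_sum => b _.
have TE b : T b = (val b).1.
  apply/eqP; rewrite eqn_leq hT andbT leqNgt; apply/negP => lt.
  move: h; rewrite leqNgt => /negP[]; rewrite (bigD1 b) //= [X in (_ < X)%N](bigD1 b) //=.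
  by rewrite -addSn leq_add // leq_sum // => b' _; exact: hT.
split=> //; apply: partition_ext => // i.
rewrite -(count_word_mset nu) -(permP pm) count_map -size_filter.
transitivity (\sum_(b : box kap [::]) ((val b).1 == i))%N.
  rewrite (@big_box kap [::] _ _ _ (size kap) (fun r _ => nat_of_bool (r == i))) //.
  under eq_bigr do rewrite sum_nat_const_nat nth_nil subn0.
  case: (ltnP i (size kap)) => h'.
    rewrite (bigD1 (Ordinal h')) //= eqxx muln1 big1 ?addn0 // => r.
    by rewrite -val_eqE /= => /negbTE ->; rewrite muln0.
  rewrite nth_default // big1 // => r _; rewrite (_ : _ == i = false) ?muln0 //.
  by apply/eqP => ri; have := ltn_ord r; rewrite ri ltnNge h'.
rewrite size_filter -sum1_count big_enum_cond /= [RHS]big_mkcond /=.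
by apply: eq_bigr => b _; rewrite /= TE; case: eqP.
Qed.

Lemma kostka_triangular kap nu : is_partition kap -> is_partition nu ->
  kostka kap nu != 0 -> kap != nu -> (nstat kap < nstat nu)%N.
Proof.
move=> pk pn; rewrite /kostka /schur; set A := (X in \sum_(T \in X) _) => K0 ne.
have [T [sT cT]] : exists T, A T.
  apply: contrapT => nA; case/eqP: K0; rewrite (_ : A = set0) ?fsbig_set0 //.
  by rewrite -subset0 => T AT; apply: nA; exists T.
have [h1 h2] := ssyt_stat pk pn sT cT.
by rewrite ltnNge; apply/negP => h; case/eqP: ne; case: (h2 h).
Qed.

Lemma kostka_diag nu : is_partition nu -> kostka nu nu = 1.
Proof.
move=> pn; pose T0 : {ffun box nu [::] -> nat} := [ffun b => (val b).1].
have sT0 : is_ssyt T0.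
  apply/forallP => b; apply/forallP => b'; rewrite !ffunE; apply/andP; split; apply/implyP.
    by move/eqP => ->.
  by move/eqP => ->.
have cT0 : seq_mset [seq T0 b | b : box nu [::]] = seq_mset (word_mset nu).
  apply/eq_seq_msetP; apply/allP => i _ /=; rewrite count_word_mset count_map -size_filter.
  rewrite size_filter -sum1_count big_enum_cond /= big_mkcond /=.
  rewrite (eq_bigr (fun b : box nu [::] => nat_of_bool ((val b).1 == i))) => [|b _]; last first.
    by rewrite /= ffunE; case: eqP.
  rewrite (@big_box nu [::] _ _ _ (size nu) (fun r _ => nat_of_bool (r == i))) //.
  apply/eqP; under eq_bigr do rewrite sum_nat_const_nat nth_nil subn0.
  case: (ltnP i (size nu)) => h'.
    rewrite (bigD1 (Ordinal h')) //= eqxx muln1 big1 ?addn0 // => r.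
    by rewrite -val_eqE /= => /negbTE ->; rewrite muln0.
  rewrite nth_default // big1 // => r _; rewrite (_ : _ == i = false) ?muln0 //.
  by apply/eqP => ri; have := ltn_ord r; rewrite ri ltnNge h'.
rewrite /kostka /schur (_ : mkset _ = [set T0]%classic) ?fsbig_set1 //.
apply/seteqP; split=> [T [sT cT]|_ ->] //=.
have [_ /(_ (leqnn _))[_ h]] := ssyt_stat pn pn sT cT.
by apply/ffunP => b; rewrite h ffunE.
Qed.

(** Induction on [nstat]: in the equation for nu, triangularity leaves only coefficients already
    known to vanish and the diagonal term. *)
Lemma kostka_free (U : seq (seq nat)) (c : seq nat -> R) : uniq U -> all is_partition U ->
  (forall nu, nu \in U -> \sum_(kap <- U) c kap * kostka kap nu = 0) ->
  forall nu, nu \in U -> c nu = 0.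
Proof.
move=> uU /allP pU h nu; have [N] := ubnP (nstat nu); elim: N nu => // N IH nu.
rewrite ltnS => nuN nuU; have := h nu nuU.
rewrite (bigD1_seq nu) //= kostka_diag ?pU // mulr1 big_seq_cond big1 ?addr0 // => kap.
case/andP=> kU ne; case: (eqVneq (kostka kap nu) 0) => [->|K0]; first by rewrite mulr0.
rewrite IH ?mul0r //; apply: leq_trans nuN.
by apply: kostka_triangular => //; exact: pU.
Qed.

(** The lists in [omega_graph] may repeat a partition; here repetitions are absorbed into the
    coefficients. *)
Lemma sum_count (U N : seq (seq nat)) (F : seq nat -> R) : uniq U -> {subset N <= U} ->
  \sum_(nu <- N) F nu = \sum_(nu <- U) F nu *+ count_mem nu N.
Proof.
move=> uU; elim: N => [|x N IH] sub.
  by rewrite big_nil big1 // => nu _; rewrite mulr0n.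
rewrite big_cons IH; last by move=> y yN; apply: sub; rewrite inE yN orbT.
rewrite [RHS](eq_bigr (fun nu => F nu *+ (x == nu) + F nu *+ count_mem nu N)); last first.
  by move=> nu _; rewrite /= mulrnDr.
rewrite big_split /=; congr (_ + _).
rewrite (bigD1_seq x) ?sub ?mem_head //= eqxx mulr1n big1 ?addr0 // => nu.
by rewrite eq_sym => /negbTE ->.
Qed.

Lemma omega_graph_unique (f h h' : fps R) : omega_graph f h -> omega_graph f h' -> h = h'.
Proof.
move=> [N [c [pN fN hN]]] [N' [c' [pN' fN' hN']]].
pose U := undup (N ++ N').
have uU : uniq U by exact: undup_uniq.
have sN : {subset N <= U} by move=> x xN; rewrite mem_undup mem_cat xN.
have sN' : {subset N' <= U} by move=> x xN; rewrite mem_undup mem_cat xN orbT.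
pose e nu := c nu *+ count_mem nu N - c' nu *+ count_mem nu N'.
have E (F : seq nat -> R) :
    \sum_(nu <- N) c nu * F nu - \sum_(nu <- N') c' nu * F nu = \sum_(nu <- U) e nu * F nu.
  rewrite (sum_count (fun nu => c nu * F nu) uU sN) (sum_count (fun nu => c' nu * F nu) uU sN').
  rewrite -sumrB; apply: eq_bigr => nu _; rewrite /e.
  by rewrite -!mulrnAl mulrBl.
have e0 nu : nu \in U -> e nu = 0.
  apply: kostka_free => // [|kap _].
    apply/allP => x; rewrite mem_undup mem_cat => /orP[] xN.
      exact: (allP pN).
    exact: (allP pN').
  by rewrite -E /kostka -fN -fN' subrr.
apply/funext => m; apply/eqP; rewrite hN hN' -subr_eq0.
rewrite (E (fun nu => schur R (conj_part nu) m)) big_seq big1 // => nu /e0 ->.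
by rewrite mul0r.
Qed.

Lemma omegaE (f h : fps R) : omega_graph f h -> omega f = h.
Proof. by move=> H; apply: xget_unique => // h' H'; exact: omega_graph_unique H' H. Qed.

(** At beta = 0 fillings with a merged box have weight 0, and the remaining ones are the
    semistandard tableaux. *)
Lemma schur_g nu : is_partition nu -> schur R nu = g_skew nu [::] (fun=> 0).
Proof.
move=> pn; apply/funext => m; rewrite /schur /g_skew /=.
set A := (X in \sum_(T \in X) 1 = _); set B := (X in _ = \sum_(T \in X) _).
have un (T : {ffun box nu [::] -> nat}) : is_ssyt T -> forall b, merged T b = false.
  move=> /forallP sT b; apply/negbTE/existsPn => b'; apply/negP => /andP[bb' /eqP e].
  by have /forallP/(_ b')/andP[_ /implyP/(_ bb')] := sT b; rewrite e ltnn.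
have ct (T : {ffun box nu [::] -> nat}) : (forall b, merged T b = false) ->
    rpp_content T = seq_mset [seq T b | b : box nu [::]].
  move=> uT; rewrite /rpp_content; congr (seq_mset (map _ _)).
  by apply: eq_enum => b; rewrite !inE uT.
have wt (T : {ffun box nu [::] -> nat}) : (forall b, merged T b = false) ->
    \prod_(r < size nu) (0 : R) ^+ merged_in_row T r = 1.
  move=> uT; apply: big1 => r _; rewrite /merged_in_row eq_card0 ?expr0 // => b.
  by rewrite !inE uT andbF.
transitivity (\sum_(T \in A) \prod_(r < size nu) (0 : R) ^+ merged_in_row T r).
  by apply: eq_fsbigr => T; rewrite inE => -[/un uT _]; rewrite wt.
apply: fsbig_widen => [T [sT cT]|T [[rT cT] nA] /=].
  split; last by rewrite ct //; exact: un.
  apply/forallP => b; apply/forallP => b'; have /forallP/(_ b)/forallP/(_ b')/andP[/implyP h1 /implyP h2] := sT.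
  by apply/implyP => /orP[/h1 //|/h2 /ltnW].
case: (boolP [exists b, merged T b]) => [/existsP[b mb]|].
  have br : ((val b).1 < size nu)%N.
    have : val b \in skew_boxes nu [::] by exact: valP.
    case: (val b) => r c; rewrite mem_boxes nth_nil /= => h.
    by case: (ltnP r (size nu)) => // /(nth_default 0%N) e; rewrite e in h.
  rewrite (bigD1 (Ordinal br)) //= expr0n (_ : merged_in_row T _ == 0%N = false) ?mul0r //.
  apply/negbTE; rewrite -lt0n; apply/card_gt0P; exists b; by rewrite !inE eqxx mb.
move=> /existsPn uT; have {}uT b : merged T b = false by exact/negbTE/uT.
case: nA; split; last by rewrite -ct.
apply/forallP => b; apply/forallP => b'.
have /forallP/(_ b)/forallP/(_ b')/implyP h := rT.
apply/andP; split; apply/implyP => bb'; first by apply: h; rewrite bb'.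
rewrite ltn_neqAle h ?bb' ?orbT // andbT; apply/eqP => e.
by have := uT b; rewrite /merged => /existsP[]; exists b'; rewrite bb' e eqxx.
Qed.

End Kostka.

(** For a square system uniqueness gives existence; this turns the independence of Schur functions
    into an expansion. *)
Lemma linear_solve (F : fieldType) (I : finType) (K : I -> I -> F) :
  (forall c : I -> F, (forall j, \sum_i c i * K i j = 0) -> forall i, c i = 0) ->
  forall phi : I -> F, exists c : I -> F, forall j, \sum_i c i * K i j = phi j.
Proof.
move=> inj phi; pose A : 'M[F]_#|I| := \matrix_(i, j) K (enum_val i) (enum_val j).
have vA (v : 'rV_#|I|) j : (v *m A) 0 (enum_rank j) = \sum_i v 0 (enum_rank i) * K i j.
  rewrite mxE (reindex_onto enum_rank enum_val) /=; last by move=> i _; rewrite enum_valK.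
  by apply: eq_big => [i|i _]; rewrite ?enum_rankK ?eqxx // mxE !enum_rankK.
have uA : A \in unitmx.
  rewrite -row_free_unit; apply: inj_row_free => v v0; apply/rowP => i.
  rewrite -(enum_valK i) mxE (inj (fun i => v 0 (enum_rank i))) // => j.
  by rewrite -vA v0 mxE.
pose v : 'rV_#|I| := (\row_i phi (enum_val i)) *m invmx A.
exists (fun i => v 0 (enum_rank i)) => j.
by rewrite -vA /v mulmxKV // mxE enum_rankK.
Qed.

Lemma mset_bound (m : {mset nat}%mset) : exists n, forall e, (n <= e)%N -> m e = 0%N.
Proof.
exists (\max_(e <- (m : seq nat)) e).+1 => e he.
rewrite -(seq_mset_id m) mset_seqE; apply/count_memPn/negP => em.
by move: he; rewrite ltnNge (leq_bigmax_seq (F := id)).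
Qed.

Lemma size_pD (R : comNzRingType) l (beta : nat -> R) (k p : shape l) d :
  (pD beta k p)`_d != 0 -> (d + area k <= area p)%N.
Proof.
case: (boolP [forall r : 'I_l, (row k r <= row p r)%N]) => [/forallP h|]; last first.
  rewrite negb_forall => /existsP[r]; rewrite -ltnNge => h; case/eqP.
  rewrite /pD /kD (bigD1 r) //= cellD_supp ?mul0r ?coef0 //.
    by rewrite ltn_eqF.
  by rewrite ltn_eqF // leqW.
have hs : (size (pD beta k p) <= (\sum_(r < l) (row p r - row k r)).+1)%N.
  rewrite /pD /kD; elim/big_rec2: _ => [|r s q _ IH]; first by rewrite size_polyC leq_b1.
  apply: leq_trans (size_polyMleq _ _) _.
  have h1 : (size (cellD (beta r)%:P 'X (row k r) (row p r) (row p r.+1)) <=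
       (row p r - row k r).+1)%N.
    rewrite /cellD; case: eqP => [->|_]; first by rewrite size_poly1.
    case: eqP => [->|_]; last by rewrite size_poly0.
    rewrite subSnn; apply: leq_trans (size_polyD _ _) _; rewrite geq_max size_polyX leqnn /=.
    by case: (_ < _)%N; rewrite ?mulr1n ?mulr0n ?size_poly0 // size_polyC; case: (_ != _).
  by rewrite -subn1 leq_subLR add1n; lia.
move=> pd; have : (d < size (pD beta k p))%N.
  by rewrite ltnNge; apply: contra pd => /(nth_default 0) ->.
move=> /leq_trans/(_ hs); rewrite ltnS sumnB // -/(area p) -/(area k) => hd.
have hA : (area k <= area p)%N by apply: leq_sum => r _; exact: h.
by rewrite -(subnK hA) leq_add2r.
Qed.

(** A nonzero path sum contains a chain of nonzero steps, along which the increments of [f] add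
    up. *)
Lemma psum_weight (R : comNzRingType) (X : finType) n (W : nat -> X -> X -> R)
    (wt : nat -> nat) (f : X -> nat) a z :
  (forall i k p, W i k p != 0 -> (wt i + f k <= f p)%N) ->
  psum n W a z != 0 -> (\sum_(i < n) wt i + f a <= f z)%N.
Proof.
elim: n W wt a => [|n IH] W wt a hW.
  by rewrite psum0 big_ord0 add0n; case: (a =P z) => [->|_] //; rewrite mulr0n eqxx.
rewrite psumS => h.
have [b hb] : exists b, W 0%N a b * psum n (fun i => W i.+1) b z != 0.
  apply/existsP; apply: contraNT h => /existsPn h; apply/eqP/big1 => b _.
  by apply/eqP; rewrite -[_ == _]negbK h.
have h1 : W 0%N a b != 0 by apply: contraNneq hb => ->; rewrite mul0r.
have h2 : psum n (fun i => W i.+1) b z != 0 by apply: contraNneq hb => ->; rewrite mulr0.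
have e1 := hW _ _ _ h1.
have e2 := IH _ (fun i => wt i.+1) _ (fun i k p => hW i.+1 k p) h2.
by rewrite big_ord_recl /= addnAC addnC; apply: leq_trans e2; apply: leq_add.
Qed.

Section SchurWords.
Variables (R : realType) (L : nat).

Lemma schur_h (y : shape L) (m : {mset nat}%mset) n : (forall e, (n <= e)%N -> m e = 0%N) ->
  schur R (seq_of y) m = psum n (fun i k p => (pA (fun=> 0 : R) k p)`_(m i)) (shape0 L) y.
Proof.
move=> hm; have fy := fits_seq_of y; rewrite schur_g; last by case/and3P: fy.
rewrite (g_skew_chains (l := L) fy _ _ _ hm) //.
by rewrite shape_of_nil shape_of_seq.
Qed.

Lemma schur_e (y : shape L) (m : {mset nat}%mset) n : (forall e, (n <= e)%N -> m e = 0%N) ->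
  schur R (seq_of (tr y)) m = psum n (fun i k p => (pD (fun=> 0 : R) k p)`_(m i)) (shape0 L) y.
Proof.
move=> hm; rewrite (schur_h _ hm) -[X in psum _ _ X _]tr0 (psum_inv _ _ _ _ (@trK L)).
by apply: eq_psum => i b c _; rewrite pA_tr.
Qed.

End SchurWords.

(** * The involution omega on dual Grothendieck functions *)

Section OmegaG.
Variables (R : realType) (l : nat) (lam mu : seq nat).
Hypotheses (flam : fits l lam) (fmu : fits l mu) (hsub : sub_part mu lam).
Variable beta : nat -> R.

Let z : shape l := shape_of l lam.
Let a : shape l := shape_of l mu.
(** Chains of [kD] from mu to lam have total degree at most [L]; partitions of that size fit in the
    L by L square, which therefore holds every Schur function needed. *)
Let L : nat := (area z - area a)%N.
Let ew (s : seq nat) : seq letter := [seq (false, x) | x <- s].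

Lemma kword_mset l' (b : nat -> R) e (m : nat -> nat) n (u v : shape l') :
  kword b [seq (e, m i) | i <- iota 0 n] u v =
  psum n (fun i k p => if e then (pA b k p)`_(m i) else (pD b k p)`_(m i)) u v.
Proof.
rewrite /kword size_map size_iota; apply: eq_psum => i k p iN.
by rewrite (nth_map 0%N) ?size_iota // nth_iota // add0n.
Qed.

Lemma kword_e l' (b : nat -> R) s (u v : shape l') :
  kword b (ew s) u v = psum (size s) (fun i k p => (pD b k p)`_(nth 0%N s i)) u v.
Proof.
rewrite /kword size_map; apply: eq_psum => i k p iN.
by rewrite (nth_map 0%N).
Qed.

Lemma kword_e_weight l' (b : nat -> R) s (u v : shape l') :
  kword b (ew s) u v != 0 -> (sumn s + area u <= area v)%N.
Proof.
rewrite kword_e => /(psum_weight (wt := nth 0%N s) (f := @area l')).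
by rewrite sumnE (big_nth 0%N) big_mkord; apply => i k p; exact: size_pD.
Qed.

Lemma kostka_e (y : shape L) s :
  kostka R (seq_of (tr y)) s = kword (fun=> 0) (ew s) (shape0 L) y.
Proof.
rewrite /kostka (@schur_e R L y _ (size s)) => [|e he].
  rewrite kword_e; apply: eq_psum => i k p _.
  by rewrite mset_seqE count_word_mset.
by rewrite mset_seqE count_word_mset nth_default.
Qed.

Lemma small_partition s : is_partition s -> (sumn s <= L)%N -> exists y : shape L,
  seq_of y = s /\ area y = sumn s.
Proof.
move=> ps sL; have fs : fits L s.
  rewrite /fits ps /=; case/andP: (ps) => _ n0; apply/andP; split.
    apply: leq_trans sL; elim: s n0 {ps} => //= x s IH; rewrite inE negb_or => /andP[x0 /IH h].
    by rewrite -add1n leq_add // lt0n eq_sym.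
  by apply: leq_trans sL; case: s {ps n0} => //= x s; exact: leq_addr.
exists (shape_of L s); split.
  by apply: (@fits_inj L) => //; rewrite ?fits_seq_of // shape_of_seq.
rewrite /area sumnE (big_nth 0%N) big_mkord (big_ord_widen L (nth 0%N s)); last by case/and3P: fs.
rewrite [RHS]big_mkcond /=; apply: eq_bigr => r _; rewrite row_shape_of //.
by case: ltnP => // /(nth_default 0%N).
Qed.

(** [C y] is to be the coefficient of s_y in g_{lam/mu}. The equations say that sum_y C y s_{y'} has
    the coefficients given by the chains of [kD], at all partitions of size at most [L]. *)
Lemma schur_coefficients : exists C : shape L -> R,
  (forall y : shape L, (L < area y)%N -> C y = 0) /\
  forall k : shape L, (area k <= L)%N -> \sum_y C y * kostka R (seq_of (tr y)) (seq_of k) =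
    kword beta (ew (seq_of k)) a z.
Proof.
(* An identity block on the shapes of area above [L] makes the system square over the whole type of
   shapes. *)
pose K (y k : shape L) : R := if (area y <= L)%N && (area k <= L)%N
  then kostka R (seq_of y) (seq_of k) else (y == k)%:R.
pose phi (k : shape L) : R := if (area k <= L)%N then kword beta (ew (seq_of k)) a z else 0.
have big c k : (L < area k)%N -> \sum_y c y * K y k = c k.
  move=> hk; rewrite (bigD1 k) //= big1 ?addr0 => [|y /negbTE yk]; rewrite /K [X in _ && X]leqNgt hk andbF.
    by rewrite eqxx mulr1.
  by rewrite yk mulr0.
have [c hc] : exists c : shape L -> R, forall k, \sum_y c y * K y k = phi k.
  apply: linear_solve => c hc.
  have c0 y : (L < area y)%N -> c y = 0 by move=> hy; rewrite -(hc y) big.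
  pose U := [seq seq_of y | y <- enum (shape L) & (area y <= L)%N].
  have inj : injective (@seq_of L) by move=> y y' e; rewrite -(shape_of_seq y) e shape_of_seq.
  have cU : forall nu, nu \in U -> c (shape_of L nu) = 0.
    apply: (@kostka_free R U (fun nu => c (shape_of L nu))).
    - by rewrite map_inj_uniq // filter_uniq // enum_uniq.
    - by apply/allP => _ /mapP[y _ ->]; case/and3P: (fits_seq_of y).
    - move=> nu /mapP[k]; rewrite mem_filter => /andP[hk _] ->.
      transitivity (\sum_y c y * K y k); last exact: hc.
      rewrite big_map big_filter big_enum_cond /= big_mkcond /=.
      apply: eq_bigr => y _; rewrite shape_of_seq /K hk andbT.
      by case: leqP => // /c0 ->; rewrite mul0r.
  move=> y; case: (leqP (area y) L) => [hy|/c0 //].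
  rewrite -(shape_of_seq y) cU //; apply/mapP; exists y => //.
  by rewrite mem_filter hy mem_enum.
have c0 y : (L < area y)%N -> c y = 0.
  by move=> hy; rewrite -(big c y hy) hc /phi leqNgt hy.
(* The system was solved for the coefficients of s_y; transposing the index gives those of
   s_{y'}. *)
exists (fun y => c (tr y)); split=> [y hy|k hk]; first by rewrite c0 // area_tr.
transitivity (phi k); last by rewrite /phi hk.
rewrite -hc (reindex_inj (inv_inj (@trK L))); apply: eq_bigr => y _.
rewrite trK /K hk andbT; case: leqP => // /c0 ->; by rewrite !mul0r.
Qed.

(** [Psi] obeys the word relations and vanishes on sorted e words, by the choice of [C] up to degree
    [L] and for degree reasons above it; hence it vanishes on all words. The h words give the Schur
    expansion of g_{lam/mu}, the e words that of its image. *)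
Theorem omega_g (m : {mset nat}%mset) n : (forall e, (n <= e)%N -> m e = 0%N) ->
  omega (g_skew lam mu beta) m = psum n (fun i k p => (pD beta k p)`_(m i)) a z.
Proof.
have [C [C0 hC]] := schur_coefficients.
pose Psi w := kword beta w a z -
  \sum_(y <- enum (shape L)) C y * kword (fun=> 0) w (shape0 L) y.
have Psi0 : forall w, Psi w = 0.
  apply: word_zero.
    apply: (word_relations_comb (enum (shape L)) (phi := fun w => kword beta w a z) C
      (psi := fun y w => kword (fun=> 0) w (shape0 L) y)); first exact: kword_relations.
    by move=> y; exact: kword_relations.
  move=> s ss pos; rewrite -/(ew s).
  have ps : is_partition s.
    by rewrite /is_partition ss; apply/negP => /(allP pos).
  have ar0 : area (shape0 L) = 0%N by apply: big1 => r _; rewrite row0.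
  case: (leqP (sumn s) L) => sL.
    have [k [ks ak]] := small_partition ps sL.
    rewrite /Psi -ks -hC; last by rewrite ak.
    rewrite big_enum /= -sumrB big1 // => y _.
    by rewrite kostka_e subrr.
  rewrite /Psi [kword beta _ _ _](_ : _ = 0); last first.
    apply/eqP; apply: contraTT sL => /kword_e_weight h.
    by rewrite -leqNgt /L -(addnK (area a) (sumn s)) leq_sub2r.
  rewrite big1 ?subr0 // => y _.
  case: (leqP (area y) L) => [hy|/C0 ->]; last by rewrite mul0r.
  rewrite [kword _ _ _ _](_ : _ = 0) ?mulr0 //.
  apply/eqP; apply: contraTT sL => /kword_e_weight.
  by rewrite ar0 addn0 -leqNgt => h; exact: leq_trans h hy.
have PsiE w : kword beta w a z = \sum_y C y * kword (fun=> 0) w (shape0 L) y.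
  by have /eqP := Psi0 w; rewrite subr_eq0 big_enum => /eqP.
have og : omega_graph (g_skew lam mu beta)
    (fun m => \sum_(nu <- [seq seq_of y | y <- enum (shape L)])
       C (shape_of L nu) * schur R (conj_part nu) m).
  exists [seq seq_of y | y <- enum (shape L)], (fun nu => C (shape_of L nu)); split=> //.
    by apply/allP => _ /mapP[y _ ->]; case/and3P: (fits_seq_of y).
  move=> m0; have [n0 hn0] := mset_bound (m0 : {mset nat}%mset).
  rewrite (g_skew_chains flam fmu hsub beta hn0) big_map big_enum /=.
  have := PsiE [seq (true, m0 i) | i <- iota 0 n0]; rewrite kword_mset => ->.
  apply: eq_bigr => y _; rewrite shape_of_seq kword_mset.
  by rewrite (schur_h R y hn0).
move=> hm; rewrite (omegaE og) big_map big_enum /=.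
have := PsiE [seq (false, m i) | i <- iota 0 n]; rewrite kword_mset => ->.
apply: eq_bigr => y _; rewrite shape_of_seq kword_mset conj_seq_of.
by rewrite (schur_e R y hm).
Qed.

End OmegaG.

Local Open Scope classical_set_scope.

(** * Transition probabilities *)

Section Markov.
Context (R : realType) (d : measure_display) (T : measurableType d).
Variables (P : probability T R) (l : nat) (w G : nat -> nat -> T -> nat).
Hypothesis hdrive : independent_drive P l w G.

Let pr (A : set T) : R := fine (P A).

Lemma pr_fin (A : set T) : measurable A -> P A = (pr A)%:E.
Proof. by move=> mA; rewrite /pr fineK // fin_num_measure. Qed.

Lemma measurable_w j i (A : set nat) : (j < l)%N -> measurable (w j i @^-1` A).
Proof.
move=> jl; have [mw _ _] := hdrive.
by rewrite -[X in measurable X]setTI; apply: mw.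
Qed.

Lemma measurable_config0 (mu : seq nat) : measurable (config_at l G 0 mu).
Proof.
have [_ mG _] := hdrive.
rewrite (_ : config_at l G 0 mu =
    \bigcap_(j in `I_l) (G j 0%N @^-1` [set nth 0%N mu j])); last first.
  by apply/seteqP; split=> t /= h j; [move=> jl; exact: h|move=> jl; exact: (h j)].
apply: fin_bigcap_measurable => // j jl.
by rewrite -[X in measurable X]setTI; apply: mG.
Qed.

(** Particles keep their order and never move back, which confines every trajectory from mu to lam
    to shapes inside lam. *)
Definition monotone_dynamics : Prop := forall t i,
  (forall j, (j.+1 < l)%N -> (G j.+1 i t <= G j i t)%N) ->
  (forall j, (j < l)%N -> (G j i t <= G j i.+1 t)%N) /\
  (forall j, (j.+1 < l)%N -> (G j.+1 i.+1 t <= G j i.+1 t)%N).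

Lemma monotone_orbit t mu : monotone_dynamics -> is_partition mu ->
  config_at l G 0 mu t -> forall i,
  (forall j, (j.+1 < l)%N -> (G j.+1 i t <= G j i t)%N) /\
  (forall k j, (k <= i)%N -> (j < l)%N -> (G j k t <= G j i t)%N).
Proof.
move=> md pmu h0; elim=> [|i [IH1 IH2]].
  split=> [j jl|k j]; last by rewrite leqn0 => /eqP ->.
  by rewrite !h0 ?(ltnW jl) //; exact: nth_partition.
have [h1 h2] := md t i IH1; split=> // k j; rewrite leq_eqVlt => /orP[/eqP -> //|ki] jl.
exact: leq_trans (IH2 _ _ ki jl) (h1 _ jl).
Qed.

Lemma transition_prob0 n lam mu : monotone_dynamics -> is_partition mu ->
  ~ (forall j, (j < l)%N -> (nth 0 mu j <= nth 0 lam j)%N) ->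
  transition_prob P l G n lam mu = 0.
Proof.
move=> md pmu nsub; rewrite /transition_prob (_ : _ `&` _ = set0).
  by rewrite measure0 /= mul0r.
rewrite -subset0 => t [hn h0]; apply: nsub => j jl.
have [_ h] := monotone_orbit md pmu h0 n.
by rewrite -(h0 j jl) -(hn j jl) h.
Qed.

(** [A j k p] holds the values of the weight that take particle j from [k] to [p]. A trajectory is
    thus an intersection of independent conditions, one per particle and step, and distinct
    trajectories are disjoint events. *)
Theorem transition_prob_psum n lam mu (A : nat -> shape l -> shape l -> pred nat) :
  fits l lam -> fits l mu -> monotone_dynamics ->
  (forall t i (k p : shape l), (forall j, (j < l)%N -> G j i t = row k j) ->
     (forall j, (j < l)%N -> G j i.+1 t = row p j) <->
     (forall j, (j < l)%N -> A j k p (w j i t))) ->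
  P (config_at l G 0 mu) <> 0%E ->
  transition_prob P l G n lam mu =
  psum n (fun i k p => \prod_(j < l) pr (w j i @^-1` [set v | A j k p v]))
    (shape_of l mu) (shape_of l lam).
Proof.
move=> flam fmu md step P0.
set z := shape_of l lam; set a := shape_of l mu.
have rz r : row z r = nth 0%N lam r by exact: row_shape_of.
have ra r : row a r = nth 0%N mu r by exact: row_shape_of.
pose E (c : {ffun 'I_n -> shape l}) : set T := config_at l G 0 mu `&`
  \bigcap_(k in [set: 'I_l * 'I_n]) (w k.1 k.2 @^-1`
     [set v | A k.1 (nx z c k.2) (nx z c k.2.+1) v]).
have Eorb c t : nx z c 0%N = a -> E c t <->
    forall i, (i <= n)%N -> forall j, (j < l)%N -> G j i t = row (nx z c i) j.
  move=> c0; split=> [[h0 h] i iN|h].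
    elim: i iN => [|i IH] iN; first by move=> j jl; rewrite c0 ra; exact: h0.
    apply/(step t i (nx z c i) (nx z c i.+1)); first by apply: IH; exact: ltnW.
    by move=> j jl; have := h (Ordinal jl, Ordinal iN) I.
  split=> [j jl|[j i] _ /=]; first by rewrite h // c0 ra.
  have [H _] := step t i _ (nx z c i.+1) (h i (ltnW (ltn_ord i))).
  exact: (H (h i.+1 (ltn_ord i)) j (ltn_ord j)).
have mE c : measurable (E c).
  apply: measurableI; first exact: measurable_config0.
  apply: fin_bigcap_measurable => // k _; exact: measurable_w.
have PE c : pr (E c) = pr (config_at l G 0 mu) *
    \prod_(i < n) \prod_(j < l) pr (w j i @^-1` [set v | A j (nx z c i) (nx z c i.+1) v]).
  have [_ _ ind] := hdrive.
  pose B : set ('I_l -> nat) := [set g | forall j : 'I_l, g j = nth 0%N mu j].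
  pose f (k : 'I_l * 'I_n) : 'I_l * nat := (k.1, k.2 : nat).
  pose J : {fset 'I_l * nat} := [fset f k | k in [set: 'I_l * 'I_n]%SET]%fset.
  have := ind B J (fun k => [set v | A k.1 (nx z c k.2) (nx z c k.2.+1) v]).
  have -> : [set t | B (fun j : 'I_l => G j 0%N t)] = config_at l G 0 mu.
    by apply/seteqP; split=> t /= h j; [move=> jl; exact: (h (Ordinal jl))|exact: h].
  rewrite (_ : _ `&` _ = E c); last first.
    congr (_ `&` _); apply/seteqP; split=> t /= h k.
      by move=> _; apply: (h (f k)); apply/imfsetP; exists k; rewrite ?inE.
    by move=> /imfsetP[k' _ ->] /=; exact: (h k' I).
  rewrite /pr => ->.
  rewrite [X in (_ * X)%E](_ : _ = (\prod_(k : 'I_l * 'I_n)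
     pr (w k.1 k.2 @^-1` [set v | A k.1 (nx z c k.2) (nx z c k.2.+1) v]))%:E); last first.
    rewrite big_imfset /=; last by move=> [j i] [j' i'] _ _ [-> /val_inj ->].
    rewrite -prodEFin big_enum /=; apply: eq_big => [k|k _]; first by rewrite inE.
    by rewrite pr_fin //; exact: measurable_w.
  by rewrite (pr_fin (measurable_config0 mu)) /= exchange_big pair_big.
have cover : config_at l G n lam `&` config_at l G 0 mu =
    \bigcup_(c in [set` [pred c | nx z c 0%N == a]]) E c.
  apply/seteqP; split=> t.
    move=> [hn h0]; have orb := monotone_orbit md (andP fmu).1 h0.
    pose g i (r : nat) := if (r < l)%N then G r i t else 0%N.
    have gS i : (i <= n)%N -> shape_fun l (g i).
      move=> iN; split=> [r| |r lr].
      - rewrite /g; case: (ltnP r.+1 l) => // rl; rewrite (ltnW rl).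
        by have [h _] := orb i; exact: h.
      (* Positions grow towards [lam], so the final bound holds at all earlier times. *)
      - rewrite /g; case: ltnP => // l0; have [_ h] := orb n.
        rewrite (leq_trans (h i 0%N iN l0)) // (hn 0%N l0) -rz; exact: row_le.
      - by rewrite /g ltnNge lr.
    pose c : {ffun 'I_n -> shape l} := [ffun i : 'I_n => mk_shape l (g i)].
    have cE i : (i <= n)%N -> forall j, (j < l)%N -> G j i t = row (nx z c i) j.
      move=> iN j jl; rewrite /c (nx_ffun n z (fun i => mk_shape l (g i))).
      case: (ltnP i n) => [_|ni]; first by rewrite row_mk ?/g ?jl //; exact: gS.
      have -> : i = n by apply/eqP; rewrite eqn_leq iN.
      by rewrite rz; exact: hn.
    have c0 : nx z c 0%N = a by apply: shape_ext => r rl; rewrite -cE // ra; exact: h0.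
    by exists c; [rewrite /= inE c0|apply/Eorb].
  move=> [c /=]; rewrite inE => /eqP c0 /(Eorb c t c0) h; split=> j jl.
    by rewrite h // nx_out // rz.
  by rewrite h // c0 ra.
have triv : trivIset [set` [pred c | nx z c 0%N == a]] E.
  move=> c c' /=; rewrite !inE => /eqP c0 /eqP c0' [t [/(Eorb c t c0) h /(Eorb c' t c0') h']].
  apply/ffunP => i; rewrite -!(nx_ord z); apply: shape_ext => r rl.
  by rewrite -h ?h' //; exact: ltnW.
have p0 : pr (config_at l G 0 mu) != 0.
  apply/eqP => e; apply: P0; by rewrite (pr_fin (measurable_config0 mu)) e.
rewrite /transition_prob cover measure_fin_bigcup //.
rewrite -(@bigfs _ _ _ _ (index_enum _)) ?index_enum_uniq //; last first.
  by move=> i _; rewrite mem_index_enum.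
rewrite (eq_bigr (fun c => (pr (E c))%:E)) => [|c _]; last exact: pr_fin.
rewrite sumEFin /= mulr_suml; apply: eq_big => [c|c _] //.
by rewrite PE -/(pr _) mulrAC divff // mul1r.
Qed.

Section Weights.
Variables (j i : nat) (jl : (j < l)%N).

(** Starts from total mass 1 and removes the values 0, ..., k-1 one at a time. *)
Lemma pr_geometric_ge (q : R) k : (forall k, pr (w j i @^-1` [set k]) = (1 - q) * q ^+ k) ->
  pr (w j i @^-1` [set v | (k <= v)%N]) = q ^+ k.
Proof.
move=> hq; elim: k => [|k IH].
  rewrite (_ : _ @^-1` _ = setT); last by apply/seteqP; split=> t.
  by rewrite /pr probability_setT.
have E : w j i @^-1` [set v | (k <= v)%N] =
    w j i @^-1` [set k] `|` w j i @^-1` [set v | (k < v)%N].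
  apply/seteqP; split=> t /=; first by rewrite leq_eqVlt => /orP[/eqP ->|]; [left|right].
  by case=> [->|/ltnW].
have : P (w j i @^-1` [set v | (k <= v)%N]) =
    (P (w j i @^-1` [set k]) + P (w j i @^-1` [set v | (k < v)%N]))%E.
  rewrite E; apply: measureU; [exact: measurable_w|exact: measurable_w|].
  by rewrite -subset0 => t [/= ->]; rewrite ltnn.
rewrite !(pr_fin (measurable_w _ _ jl)) -EFinD => -[]; rewrite IH hq => e.
by apply: (@addrI _ ((1 - q) * q ^+ k)); rewrite -e exprS; ring.
Qed.

(** The masses at 0 and 1 exhaust the total, so larger values form a null event. *)
Lemma pr_bernoulli (p0 p1 : R) (A : pred nat) : p0 + p1 = 1 ->
  pr (w j i @^-1` [set 0%N]) = p0 -> pr (w j i @^-1` [set 1%N]) = p1 ->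
  pr (w j i @^-1` [set v | A v]) = p0 *+ A 0%N + p1 *+ A 1%N.
Proof.
move=> p01 h0 h1.
have mw B : measurable (w j i @^-1` B) by exact: measurable_w.
have split2 (B C : set nat) : B `&` C = set0 ->
    pr (w j i @^-1` (B `|` C)) = pr (w j i @^-1` B) + pr (w j i @^-1` C).
  move=> BC; rewrite /pr preimage_setU measureU //; last first.
    by rewrite -preimage_setI BC preimage_set0.
  by rewrite fineD ?fin_num_measure.
have rest (B : set nat) : B `<=` [set v | (1 < v)%N] -> pr (w j i @^-1` B) = 0.
  move=> hB; have z2 : pr (w j i @^-1` [set v | (1 < v)%N]) = 0.
    have : pr (w j i @^-1` ([set 0%N] `|` ([set 1%N] `|` [set v | (1 < v)%N]))) = 1.
      rewrite (_ : _ @^-1` _ = setT); first by rewrite /pr probability_setT.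
      apply/seteqP; split=> t //= _.
      by case: (w j i t) => [|[|k]]; [left|right; left|right; right].
    rewrite split2; last by rewrite -subset0 => k [/= -> []].
    rewrite split2; last by rewrite -subset0 => k [/= ->].
    by rewrite h0 h1 addrA p01 => /eqP; rewrite -subr_eq0 addrAC subrr add0r => /eqP.
  apply/eqP; rewrite eq_le fine_ge0 ?measure_ge0 // andbT -z2.
  by rewrite /pr fine_le ?fin_num_measure // le_measure ?inE // => t; exact: hB.
have -> : [set v | A v] = ([set v | A v] `&` [set 0%N]) `|`
    (([set v | A v] `&` [set 1%N]) `|` ([set v | A v] `&` [set v | (1 < v)%N])).
  rewrite -!setIUr; apply/seteqP; split=> [v Av|v [] //]; split=> //.
  by case: v {Av} => [|[|k]]; [left|right; left|right; right].
rewrite split2; last first.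
  by rewrite -subset0 => k [/= [_ ->]] [[_ //]|[_ //]].
rewrite split2; last by rewrite -subset0 => k [/= [_ ->]] [_].
rewrite (rest ([set v | A v] `&` [set v | (1 < v)%N])) ?addr0; last by move=> v [].
congr (_ + _).
  case: (boolP (A 0%N)) => A0; last first.
    rewrite (_ : _ `&` _ = set0) ?preimage_set0 ?/pr ?measure0 //.
    by rewrite -subset0 => v [/= Av v0]; rewrite v0 (negbTE A0) in Av.
  by rewrite -h0 (_ : _ `&` _ = [set 0%N]) //; apply/seteqP; split=> v [] // ->; split.
case: (boolP (A 1%N)) => A1; last first.
  rewrite (_ : _ `&` _ = set0) ?preimage_set0 ?/pr ?measure0 //.
  by rewrite -subset0 => v [/= Av v1]; rewrite v1 (negbTE A1) in Av.
by rewrite -h1 (_ : _ `&` _ = [set 1%N]) //; apply/seteqP; split=> v [] // ->; split.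
Qed.

End Weights.
End Markov.

(** * Comparison of the kernels *)

Section Evaluation.
Variables (R : realType) (l : nat).
Implicit Types (k p : shape l).

Lemma fps_eval_psum n (x : nat -> R) (F : fps R) (a z : shape l)
    (kc : shape l -> shape l -> nat -> R) (V : nat -> shape l -> shape l -> R) :
  (forall m : {mset nat}%mset, (forall e, (n <= e)%N -> m e = 0%N) ->
     F m = psum n (fun i k p => kc k p (m i)) a z) ->
  (forall i k p, rational_sum (fun d => kc k p d * x i ^+ d) (V i k p)) ->
  fps_eval n x F = psum n V a z.
Proof.
move=> hF hV; apply: (@fps_eval_chains R n x F _ (fun c => nx z c 0%N == a)
  (fun c i d => kc (nx z c i) (nx z c i.+1) d) (fun c i => V i (nx z c i) (nx z c i.+1))).
  exact: hF.
by move=> c i _ _; exact: hV.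
Qed.

Lemma fps_eval0 n (x : nat -> R) (F : fps R) : (forall m, F m = 0) -> fps_eval n x F = 0.
Proof.
move=> F0; rewrite (@fps_eval_finite _ _ _ _ 0) ?big_ord0 // => d _.
by apply: big1 => t _; rewrite F0 mul0r.
Qed.

(** The rational function with coefficients [boxcoef]: a geometric series for [multi], a polynomial
    otherwise. *)
Definition boxval (multi : bool) (g x : R) (nw op : bool) : R :=
  if nw then (if multi then x / (1 - g * x) else x)
  else if op then (if multi then (1 - g * x)^-1 else 1 + g * x) else 1.

Definition kGv (multi : bool) (gamma : nat -> nat -> R) (x : R) k p : R :=
  if hstrip k p then \prod_(b : 'I_l * 'I_l)
    boxval multi (gamma b.1 b.2) x (newb k p b.1 b.2) (optb k p b.1 b.2)
  else 0.

Lemma kG_eval (multi : bool) (gamma : nat -> nat -> R) (x : R) k p :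
  (forall c r, multi -> 1 - gamma r c * x != 0) ->
  rational_sum (fun d => kG multi gamma k p d * x ^+ d) (kGv multi gamma x k p).
Proof.
move=> hg; rewrite /kG /kGv; case: ifP => _; last first.
  apply: (@rational_sum_ext _ (fun d => (0 : {poly R})`_d * x ^+ d)); first by move=> d; rewrite coef0.
  by rewrite -[X in rational_sum _ X](horner0 x); exact: rational_sum_poly.
apply: (@rational_sum_ext _ (cprod (fun (b : 'I_l * 'I_l) j =>
    boxcoef multi gamma k p b.1 b.2 j * x ^+ j))); first by move=> d; rewrite cprod_scale.
apply: rational_sum_cprod => -[r c] /=; rewrite /boxcoef /allow /boxval.
have hgx : multi -> 1 + (- gamma r c) * x != 0 by rewrite mulNr; exact: hg.
case: (newb k p r c).
  case: multi hgx {hg} => hgx.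
    have := rational_sum_geomS (hgx isT); rewrite mulNr => h.
    apply: rational_sum_ext h => -[|d] /=; first by rewrite mul0r.
    by rewrite opprK subn1.
  apply: (@rational_sum_ext _ (fun d => ('X : {poly R})`_d * x ^+ d)).
    by move=> [|[|d]]; rewrite coefX //= ?subnn ?expr0.
  by have := rational_sum_poly 'X x; rewrite hornerX.
case: (optb k p r c).
  case: multi hgx {hg} => hgx.
    have := rational_sum_geom (hgx isT); rewrite mulNr => h.
    by apply: rational_sum_ext h => d; rewrite opprK subn0.
  apply: (@rational_sum_ext _ (fun d => (1 + (gamma r c) *: 'X : {poly R})`_d * x ^+ d)).
    move=> [|[|d]]; rewrite coefD coefZ coefX coef1 /= ?subn0.
    - by rewrite mulr0 addr0 expr0.
    - by rewrite add0r mulr1 expr1.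
    - by rewrite mulr0 addr0.
  by have := rational_sum_poly (1 + gamma r c *: 'X) x; rewrite !hornerE.
apply: (@rational_sum_ext _ (fun d => (1 : {poly R})`_d * x ^+ d)).
  by move=> [|d]; rewrite coef1 //= expr0.
by have := rational_sum_poly 1 x; rewrite hornerE.
Qed.

(** A row has at most one optional box, the last old one, and it is uncovered exactly when
    [q < k]. *)
Lemma prod_row (X O : R) (k p q : nat) : (k <= l)%N -> (p <= l)%N ->
  \prod_(c < l) (if (k <= c < p)%N then X else if (c.+1 == k) && (q <= c)%N then O else 1) =
  X ^+ (p - k) * (if (q < k)%N then O else 1).
Proof.
move=> kl pl.
transitivity (\prod_(c < l) (if (k <= c < p)%N then X else 1) *
              \prod_(c < l) (if (c.+1 == k) && (q <= c)%N then O else 1)).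
  rewrite -big_split; apply: eq_bigr => c _ /=; case: ifP => h; last by rewrite mul1r.
  by rewrite (_ : c.+1 == k = false) ?mulr1 //; lia.
congr (_ * _).
  rewrite -(big_mkord xpredT (fun c => if (k <= c < p)%N then X else 1)) -big_mkcond /=.
  rewrite -(big_nat_widen 0 p l (fun c => k <= c)%N) // -(big_nat_widenl k 0 p xpredT) //.
  by rewrite prodr_const_nat.
case: (ltnP q k) => h.
  case: k kl h => // k kl h; rewrite (bigD1 (Ordinal kl)) //= eqxx /= -ltnS h big1 ?mulr1 // => c.
  by rewrite -val_eqE /= eqSS => /negbTE ->.
by apply: big1 => c _; case: eqP => //= e; rewrite leqNgt; move: h; rewrite -e => ->.
Qed.

Lemma kGv_rows (beta : nat -> R) (x : R) k p :
  kGv false (fun r _ => - (0 + beta r)) x k p =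
  if hstrip k p then \prod_(r < l) (x ^+ (row p r - row k r) *
    (if (row p r.+1 < row k r)%N then 1 - beta r * x else 1)) else 0.
Proof.
rewrite /kGv; case: ifP => // _.
rewrite -(pair_big xpredT xpredT (fun r c : 'I_l =>
   boxval false (- (0 + beta r)) x (newb k p r c) (optb k p r c))) /=.
apply: eq_bigr => r _; rewrite -(@prod_row x _ _ _ (row p r.+1)) ?row_le //.
by apply: eq_bigr => c _; rewrite /boxval add0r mulNr.
Qed.

Lemma kGv_tr (alpha : nat -> R) (x : R) k p :
  kGv true (fun _ c => - (alpha c + 0)) x (tr k) (tr p) =
  if vstrip k p then \prod_(j < l) (x ^+ (row p j - row k j) *
    (if row p j == row k j.+1 then 1 else (1 + alpha j * x)^-1)) else 0.
Proof.
rewrite /kGv hstrip_tr; case: vstripP => // hv.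
rewrite -(pair_big xpredT xpredT (fun r c : 'I_l => boxval true (- (alpha c + 0)) x
   (newb (tr k) (tr p) r c) (optb (tr k) (tr p) r c))) /= exchange_big /=.
apply: eq_bigr => j _; have /andP[h1 h2] := hv j; have h3 := row_dec k j.
(* Rows of [k] are columns of the tableau. If the column grows, its old last box is covered; the
   value [q = row k j] encodes this, as no r with [r.+1 = row k j] satisfies [q <= r]. *)
pose q := if row p j == row k j then row k j.+1 else row k j.
transitivity (\prod_(r < l) (if (row k j <= r < row p j)%N then x / (1 + alpha j * x)
    else if (r.+1 == row k j) && (q <= r)%N then (1 + alpha j * x)^-1 else 1)).
  apply: eq_bigr => r _; rewrite /boxval addr0 mulNr opprK.
  have -> : newb (tr k) (tr p) r j = (row k j <= r < row p j)%N.
    by rewrite /newb leqNgt !row_tr -leqNgt.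
  have -> : optb (tr k) (tr p) r j = (r < row k j)%N && (row k j.+1 <= r)%N && (row p j <= r.+1)%N.
    rewrite /optb eqn_leq row_tr [(row (tr k) r <= _)%N]leqNgt row_tr.
    by rewrite [(row (tr p) _ <= _)%N]leqNgt row_tr -!leqNgt.
  case: ifP => // hn; rewrite [X in if X then _ else _](_ : _ = (r.+1 == row k j) && (q <= r)%N) //.
  by rewrite /q; case: (row p j =P row k j) => e; lia.
rewrite prod_row ?row_le // /q; have [e|e] : row p j = row k j \/ row p j = (row k j).+1 by lia.
  rewrite e eqxx subnn !expr0 !mul1r; case: (ltngtP (row k j.+1) (row k j)) h3 => // h _; by rewrite h.
rewrite e subSnn !expr1 gtn_eqF // ltnn mulr1.
by rewrite gtn_eqF // ltnS.
Qed.

End Evaluation.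

(** * Row monomials and the conjugation of path sums *)

Section Assembly.
Variables (R : realType) (l : nat) (lam mu : seq nat).
Hypotheses (hlam : is_partition lam) (hmu : is_partition mu).
Hypotheses (hlaml : (size lam <= l)%N) (hmul : (size mu <= l)%N) (hlam1 : (head 0%N lam <= l)%N).

Lemma fits_lam : fits l lam. Proof. by rewrite /fits hlam hlaml hlam1. Qed.

Lemma sub_partP : reflect (forall j, (j < l)%N -> (nth 0 mu j <= nth 0 lam j)%N) (sub_part mu lam).
Proof.
apply: (iffP allP) => [h j jl|h j].
  case: (ltnP j (size mu)) => [js|/(nth_default 0%N) -> //].
  by apply: h; rewrite mem_iota.
by rewrite mem_iota add0n => js; apply: h; apply: leq_trans hmul.
Qed.

Lemma fits_mu : sub_part mu lam -> fits l mu.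
Proof.
move=> /sub_partP h; rewrite /fits hmu hmul /=.
case: (posnP l) => [l0|lp].
  by move: hmul; rewrite l0 leqn0 size_eq0 => /eqP ->.
by rewrite -nth0 (leq_trans (h 0%N lp)) // nth0.
Qed.

Definition rowmon (c : nat -> R) (k : shape l) : R := \prod_(j < l) c j ^+ row k j.

Lemma rowmon_skew (c : nat -> R) : (forall j, (j < l)%N -> c j != 0) -> sub_part mu lam ->
  skew_monomial l c lam mu =
  (rowmon c (shape_of l mu))^-1 * rowmon c (shape_of l lam).
Proof.
move=> c0 hs; rewrite /skew_monomial /rowmon -prodfV -big_split; apply: eq_bigr => j _ /=.
rewrite !row_shape_of ?fits_lam ?fits_mu // mulrC.
by rewrite expfzDr ?c0 // -exprnN.
Qed.

Lemma rowmon_neq0 (c : nat -> R) k : (forall j, (j < l)%N -> c j != 0) -> rowmon c k != 0.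
Proof. by move=> c0; apply/prodf_neq0 => j _; rewrite expf_neq0 // c0. Qed.

Lemma rowmon_ratio (c : nat -> R) (k p : shape l) : (forall j, (j < l)%N -> c j != 0) ->
  (forall r, row k r <= row p r)%N ->
  (rowmon c k)^-1 * rowmon c p = \prod_(j < l) c j ^+ (row p j - row k j).
Proof.
move=> c0 kp; rewrite /rowmon -prodfV -big_split; apply: eq_bigr => j _ /=.
by rewrite -{1}(subnKC (kp j)) exprD mulrA mulVf ?mul1r // expf_neq0 // c0.
Qed.

Lemma psum_rowmon n (c : nat -> R) (W V : nat -> shape l -> shape l -> R) (K : nat -> R) :
  (forall j, (j < l)%N -> c j != 0) -> sub_part mu lam ->
  (forall i k p, (i < n)%N -> W i k p = K i * ((rowmon c k)^-1 * rowmon c p) * V i k p) ->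
  psum n W (shape_of l mu) (shape_of l lam) =
  (\prod_(i < n) K i) * skew_monomial l c lam mu * psum n V (shape_of l mu) (shape_of l lam).
Proof.
move=> c0 hs hW.
rewrite (@psum_scale _ _ n W V K (rowmon c) (fun k => (rowmon c k)^-1)) //.
  by rewrite rowmon_skew.
by move=> k; rewrite mulfV // rowmon_neq0.
Qed.

End Assembly.

Section Bernoulli.
Context (R : realType) (l : nat) (d : measure_display) (T : measurableType d).
Variables (P : probability T R) (w G : nat -> nat -> T -> nat) (rho x : nat -> R).
Hypothesis hdrive : independent_drive P l w G.
Hypothesis hw : bernoulli_weights P l rho x w.
Hypothesis hrhox : forall i j, (j < l)%N -> 0 < rho j * x i.

Lemma pr_bern j i (A : pred nat) : (j < l)%N ->
  fine (P (w j i @^-1` [set v | A v])) =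
  (1 + rho j * x i)^-1 *+ A 0%N + (rho j * x i / (1 + rho j * x i)) *+ A 1%N.
Proof.
move=> jl; have [h1 h0] := hw i jl.
have n0 : 1 + rho j * x i != 0 by rewrite gt_eqF // addr_gt0 // hrhox.
apply: (pr_bernoulli hdrive jl).
- by rewrite -[X in X + _]mul1r -mulrDl divff.
- by rewrite -[_ @^-1` _]/[set t | w j i t = 0%N] h0 /= mul1r.
- by rewrite -[_ @^-1` _]/[set t | w j i t = 1%N] h1.
Qed.

End Bernoulli.

Section Geometric.
Context (R : realType) (l : nat) (d : measure_display) (T : measurableType d).
Variables (P : probability T R) (w G : nat -> nat -> T -> nat) (pi x : nat -> R).
Hypothesis hdrive : independent_drive P l w G.
Hypothesis hw : geometric_weights P l pi x w.

Lemma pr_geom_eq j i (A : pred nat) k : (j < l)%N -> (forall v, A v = (v == k)) ->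
  fine (P (w j i @^-1` [set v | A v])) = (1 - pi j * x i) * (pi j * x i) ^+ k.
Proof.
move=> jl hA; rewrite (_ : _ @^-1` _ = [set t | w j i t = k]) ?hw //.
by apply/seteqP; split=> t /=; rewrite hA => /eqP.
Qed.

Lemma pr_geom_ge j i (A : pred nat) k : (j < l)%N -> (forall v, A v = (k <= v)%N) ->
  fine (P (w j i @^-1` [set v | A v])) = (pi j * x i) ^+ k.
Proof.
move=> jl hA; rewrite (_ : [set v | A v] = [set v | (k <= v)%N]).
  by apply: (pr_geometric_ge hdrive jl) => k'; rewrite -[_ @^-1` _]/[set t | w j i t = k'] hw.
by apply/seteqP; split=> v /=; rewrite hA.
Qed.

Lemma pr_none j i (A : pred nat) : (forall v, A v = false) ->
  fine (P (w j i @^-1` [set v | A v])) = 0.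
Proof.
move=> hA; rewrite (_ : [set v | A v] = set0) ?preimage_set0 ?measure0 //.
by rewrite -subset0 => v /=; rewrite hA.
Qed.

End Geometric.

(** * One time step as separate conditions on the weights *)

Section Dynamics.
Context (d : measure_display) (T : measurableType d).
Variables (l : nat) (w G : nat -> nat -> T -> nat).

(** When a new position depends on the new position of the next label only, the new configuration is
    [p] exactly when each particle obeys the recursion with [p] inserted; induction starts at the
    last particle. *)
Lemma backward_step (f : nat -> nat -> nat -> nat) t i (k p : shape l) :
  (forall j, (j < l)%N -> G j i.+1 t =
     f (G j i t) (if (j.+1 < l)%N then G j.+1 i.+1 t else 0%N) (w j i t)) ->
  (forall j, (j < l)%N -> G j i t = row k j) ->
  (forall j, (j < l)%N -> G j i.+1 t = row p j) <->
  (forall j, (j < l)%N -> row p j == f (row k j) (row p j.+1) (w j i t)).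
Proof.
move=> hG hk; split=> [h j jl|h].
  rewrite -h // hG // hk //; apply/eqP; congr (f _ _ _).
  by case: ltnP => h'; [rewrite h|rewrite row_out].
suff H s j : (l - j <= s)%N -> (j < l)%N -> G j i.+1 t = row p j by move=> j jl; apply: (H l) => //; exact: leq_subr.
elim: s j => [|s IH] j hj jl; first by move: hj; rewrite leqn0 subn_eq0 leqNgt jl.
rewrite hG // hk // (eqP (h j jl)); congr (f _ _ _).
case: ltnP => h'; last by rewrite row_out.
by apply: IH => //; rewrite -ltnS -subnSK // in hj *.
Qed.

Lemma caseA_mono : caseA l w G -> monotone_dynamics l G.
Proof.
move=> hA t i _; split=> j jl.
  by rewrite hA //; apply: leq_trans (leq_maxl _ _) (leq_addr _ _).
rewrite [X in (_ <= X)%N]hA ?(ltnW jl) // jl.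
exact: leq_trans (leq_maxr _ _) (leq_addr _ _).
Qed.

(** The maximum satisfies a recursion from the last particle upwards, opposite to the update order,
    so that cases A and D share [backward_step]. *)
Lemma caseD_rec : caseD l w G -> forall t i j, (j < l)%N -> G j i.+1 t =
  maxn (G j i t + w j i t) (if (j.+1 < l)%N then G j.+1 i.+1 t else 0%N).
Proof.
move=> hD t i j jl; rewrite hD // big_ltn //; congr maxn.
by case: ltnP => h; [rewrite hD|rewrite big_geq].
Qed.

Lemma caseD_mono : caseD l w G -> monotone_dynamics l G.
Proof.
move=> /caseD_rec hD t i _; split=> j jl.
  by rewrite hD // (leq_trans (leq_addr (w j i t) _)) // leq_maxl.
by rewrite [X in (_ <= X)%N]hD ?(ltnW jl) // jl leq_maxr.
Qed.

Lemma caseB_mono : caseB l w G -> monotone_dynamics l G.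
Proof.
move=> hB t i dec.
have inc j : (j < l)%N -> (G j i t <= G j i.+1 t)%N.
  elim: j => [|j IH] jl; rewrite hB //; first by rewrite leq_addr.
  by rewrite leq_min leq_addr (leq_trans (dec j jl)) // IH // ltnW.
by split=> // j jl; rewrite hB // geq_minr.
Qed.

Lemma caseC_mono : caseC l w G -> monotone_dynamics l G.
Proof.
move=> hC t i dec.
have inc j : (j < l)%N -> (G j i t <= G j i.+1 t)%N.
  case: j => [|j] jl; rewrite hC //; first by rewrite leq_addr.
  by rewrite leq_min leq_addr dec.
split=> // j jl; rewrite hC //; apply: leq_trans (geq_minr _ _) _.
by apply: inc; exact: ltnW.
Qed.

(** The inequality holds along the dynamics; recorded in the condition on particle j, it lets the
    strip condition be read off one particle at a time. *)
Definition stepB j (k p : shape l) (v : nat) : bool := (row k j <= row p j)%N &&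
  (row p j == (if j is j'.+1 then minn (row k j + v) (row p j') else row k j + v)%N).

Lemma caseB_step : caseB l w G -> forall t i (k p : shape l),
  (forall j, (j < l)%N -> G j i t = row k j) ->
  (forall j, (j < l)%N -> G j i.+1 t = row p j) <->
  (forall j, (j < l)%N -> stepB j k p (w j i t)).
Proof.
move=> hB t i k p hk; split=> h.
  have [inc _] := caseB_mono hB (t := t) (i := i) (fun j jl =>
    eq_ind_r (fun a => a <= G j i t)%N (eq_ind_r (fun b => row k j.+1 <= b)%N (row_dec k j)
      (hk j (ltnW jl))) (hk j.+1 jl)).
  move=> j jl; rewrite /stepB -hk // -h // inc //= hB // hk //.
  by case: j jl => // j jl; rewrite -h // ltnW.
elim=> [|j IH] jl; have /andP[_ /eqP ->] := h _ jl; rewrite hB // hk //.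
by rewrite IH // ltnW.
Qed.

Definition stepC j (k p : shape l) (v : nat) : bool :=
  row p j == (if j is j'.+1 then minn (row k j + v) (row k j') else row k j + v)%N.

Lemma caseC_step : caseC l w G -> forall t i (k p : shape l),
  (forall j, (j < l)%N -> G j i t = row k j) ->
  (forall j, (j < l)%N -> G j i.+1 t = row p j) <->
  (forall j, (j < l)%N -> stepC j k p (w j i t)).
Proof.
move=> hC t i k p hk.
have E j : (j < l)%N -> G j i.+1 t =
    (if j is j'.+1 then minn (row k j + w j i t) (row k j') else row k j + w j i t)%N.
  by case: j => [|j] jl; rewrite hC // !hk // ltnW.
by split=> h j jl; [rewrite /stepC -h // E|rewrite E // -(eqP (h j jl))].
Qed.

End Dynamics.

(** The shift between particles and rows: the factor of particle r+1 is paired with row r, the first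
    particle gives the prefactor, and the surplus last row gives 1. *)
Lemma prod_shift (R : comNzRingType) (f g : nat -> R) L : (0 < L)%N ->
  (forall r, (r.+1 < L)%N -> f r.+1 = g r) -> g L.-1 = 1 ->
  \prod_(j < L) f j = f 0%N * \prod_(r < L) g r.
Proof.
case: L => // L _ fg gL; rewrite big_ord_recl big_ord_recr /= [g L]gL mulr1; congr (_ * _).
by apply: eq_bigr => r _; rewrite /bump add1n fg // ltnS.
Qed.

(** * One-step probabilities in terms of the kernels *)

Section StepKernels.
Variables (R : realType) (l : nat) (d : measure_display) (T : measurableType d).
Variables (P : probability T R) (w G : nat -> nat -> T -> nat) (pi rho x : nat -> R).
Hypothesis hdrive : independent_drive P l w G.
Hypothesis hpi : forall j, (j < l)%N -> pi j != 0.
Hypothesis hrho : forall j, (j < l)%N -> rho j != 0.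
Hypothesis hrhox : forall i j, (j < l)%N -> 0 < rho j * x i.
Implicit Types (k p : shape l).

Let pr (A : set T) : R := fine (P A).

(** The jump must be the exponent of [x] in [cellA]; the part of the move due to pushing contributes
    to the row monomial and is cancelled by the powers of [pi^-1]. *)
Lemma kernelA i k p : geometric_weights P l pi x w ->
  \prod_(j < l) pr (w j i @^-1` [set v | row p j == (maxn (row k j) (row p j.+1) + v)%N]) =
  (\prod_(j < l) (1 - pi j * x i)) * ((rowmon pi k)^-1 * rowmon pi p) *
  kA (fun r => (pi r)^-1) (x i) k p.
Proof.
move=> hw; case: (boolP (contained k p)) => [/containedP kp|nc].
  rewrite rowmon_ratio // -!big_split; apply: eq_bigr => j _ /=.
  set e := (row p j - maxn (row k j) (row p j.+1))%N.
  have hm : (maxn (row k j) (row p j.+1) <= row p j)%N by rewrite geq_max kp row_dec.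
  rewrite /pr (@pr_geom_eq R l d T P w pi x hw j i _ e) //; last by move=> v; rewrite /e; lia.
  rewrite /cellA kp -/e (_ : row p j - row k j = (row p j.+1 - row k j) + e)%N; last first.
    by rewrite /e; lia.
  rewrite exprMn exprD exprVn -!mulrA; congr (_ * _).
  rewrite [RHS]mulrCA; congr (_ * _).
  by rewrite mulrA mulfV ?mul1r // expf_neq0 // hpi.
move: nc; rewrite negb_forall => /existsP[r]; rewrite -ltnNge => hr.
rewrite (kA_sub _ _ hr) mulr0 (bigD1 r) //= /pr pr_none ?mul0r // => v.
by apply/eqP => e; lia.
Qed.

Lemma kernelC i k p : (0 < l)%N -> geometric_weights P l pi x w -> pi l = 0 ->
  \prod_(j < l) pr (w j i @^-1` [set v | stepC j k p v]) =
  (1 - pi 0%N * x i) * ((rowmon pi k)^-1 * rowmon pi p) *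
  kGv false (fun r _ => - (0 + pi r.+1)) (x i) k p.
Proof.
move=> l0 hw pl; rewrite kGv_rows; case: hstripP => [[kp st]|nh].
  (* A particle stopped at the old site of its predecessor has a geometric tail probability, without
     the factor [1 - pi j * x i]. *)
  pose o j := if (if j is j'.+1 then row p j == row k j' else false) then 1 else 1 - pi j * x i.
  transitivity (\prod_(j < l) ((pi j * x i) ^+ (row p j - row k j) * o j)).
    apply: eq_bigr => -[j jl] _ /=; rewrite /pr /o.
    case: j jl => [|j] jl.
      rewrite (@pr_geom_eq R l d T P w pi x hw 0%N i _ (row p 0 - row k 0)%N) // 1?mulrC // => v.
      by rewrite /stepC; have := kp 0%N; lia.
    case: eqP => e.
      rewrite (@pr_geom_ge R l d T P w G pi x hdrive hw j.+1 i _ (row p j.+1 - row k j.+1)%N) ?mulr1 // => v.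
      by rewrite /stepC; have := kp j.+1; lia.
    rewrite (@pr_geom_eq R l d T P w pi x hw j.+1 i _ (row p j.+1 - row k j.+1)%N) // 1?mulrC // => v.
    by rewrite /stepC; have := kp j.+1; have := st j; lia.
  rewrite rowmon_ratio // !big_split /= [X in _ = _ * (X * _)](_ : _ =
      \prod_(j < l) x i ^+ (row p j - row k j)) //.
  rewrite -[X in _ = _ * _ * (_ * X)]mul1r.
  have -> : \prod_(j < l) (pi j * x i) ^+ (row p j - row k j) =
      (\prod_(j < l) pi j ^+ (row p j - row k j)) * \prod_(j < l) x i ^+ (row p j - row k j).
    by rewrite -big_split; apply: eq_bigr => j _; rewrite exprMn.
  have -> : \prod_(j < l) o j = (1 - pi 0%N * x i) * \prod_(r < l)
      (if (row p r.+1 < row k r)%N then 1 - pi r.+1 * x i else 1).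
    apply: (@prod_shift R o (fun r =>
      if (row p r.+1 < row k r)%N then 1 - pi r.+1 * x i else 1)) => // [r rl|].
      rewrite /o; have := st r; rewrite leq_eqVlt.
      by case: eqP => [->|_ /= ->] //; rewrite ltnn.
    (* The convention [pi l = 0] makes the factor of the last row equal to 1. *)
    by rewrite prednK // pl mul0r subr0; case: ifP.
  by ring.
(* A nonzero product provides an admissible weight for every particle, and these force the
   horizontal strip inequalities. *)
rewrite mulr0; apply: contra_notP nh => /eqP.
rewrite /pr => /prodf_neq0 h.
have nz j : (j < l)%N -> exists v, stepC j k p v.
  move=> jl; apply: contrapT => nv; have := h (Ordinal jl) isT; case/eqP.
  by apply: pr_none => v; apply/negbTE/negP => sv; apply: nv; exists v.
split=> r; case: (ltnP r l) => [rl|lr]; rewrite ?(row_out _ lr) //.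
- have [v] := nz r rl; rewrite /stepC; case: r rl => [|r] rl /eqP ->; rewrite ?leq_addr //.
  by rewrite leq_min leq_addr row_dec.
- case: (ltnP r.+1 l) => [rl'|lr']; last by rewrite (row_out _ lr').
  by have [v] := nz r.+1 rl'; rewrite /stepC => /eqP ->; rewrite geq_minr.
- by rewrite row_out // leqW.
Qed.

Lemma kernelB i k p : (0 < l)%N -> bernoulli_weights P l rho x w -> rho l = 0 ->
  \prod_(j < l) pr (w j i @^-1` [set v | stepB j k p v]) =
  (1 + rho 0%N * x i)^-1 * ((rowmon rho k)^-1 * rowmon rho p) *
  kGv true (fun _ c => - (rho c.+1 + 0)) (x i) (tr k) (tr p).
Proof.
move=> l0 hw rl0; rewrite (kGv_tr (fun j => rho j.+1)).
have E j : (j < l)%N -> pr (w j i @^-1` [set v | stepB j k p v]) =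
   (1 + rho j * x i)^-1 *+ stepB j k p 0 + (rho j * x i / (1 + rho j * x i)) *+ stepB j k p 1.
  by move=> jl; exact: (pr_bern hdrive hw).
case: vstripP => [hv|nv].
  have kp r : (row k r <= row p r)%N by case/andP: (hv r).
  (* If the predecessor ends on the old site of particle j, that particle stays whatever its weight
     is: total probability 1. *)
  pose o j := if (if j is j'.+1 then row p j' == row k j else false) then 1
    else (1 + rho j * x i)^-1.
  transitivity (\prod_(j < l) ((rho j * x i) ^+ (row p j - row k j) * o j)).
    apply: eq_bigr => -[j jl] _ /=; rewrite E // /o.
    have n0 : 1 + rho j * x i != 0 by rewrite gt_eqF // addr_gt0 // hrhox.
    have [e|e] : row p j = row k j \/ row p j = (row k j).+1 by have := hv j; lia.
      case: j jl e n0 => [|j] jl e n0; rewrite /stepB e subnn expr0 mul1r leqnn /=.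
        by rewrite addn0 eqxx addn1 ltn_eqF // mulr1n mulr0n addr0.
      have h := leq_trans (row_dec k j) (kp j).
      rewrite addn0 (minn_idPl h) eqxx mulr1n; case: (row p j =P row k j.+1) => e'.
        rewrite e' (minn_idPr _) ?leq_addr // eqxx mulr1n.
        by rewrite -[X in X + _]mul1r -mulrDl divff.
      by rewrite (_ : _ == _ = false) ?mulr0n ?addr0 //; lia.
    case: j jl e n0 => [|j] jl e n0; rewrite /stepB e leqnSn /= subSnn expr1.
      by rewrite addn0 gtn_eqF // addn1 eqxx mulr0n mulr1n add0r.
    have h : (row p j.+1 <= row p j)%N := row_dec p j; rewrite e in h.
    rewrite addn0 (minn_idPl (ltnW h)) addn1 (minn_idPl h) eqxx gtn_eqF // mulr0n mulr1n add0r.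
    by rewrite gtn_eqF.
  rewrite rowmon_ratio // !big_split /=.
  have -> : \prod_(j < l) (rho j * x i) ^+ (row p j - row k j) =
      (\prod_(j < l) rho j ^+ (row p j - row k j)) * \prod_(j < l) x i ^+ (row p j - row k j).
    by rewrite -big_split; apply: eq_bigr => j _; rewrite exprMn.
  have -> : \prod_(j < l) o j = (1 + rho 0%N * x i)^-1 * \prod_(r < l)
      (if row p r == row k r.+1 then 1 else (1 + rho r.+1 * x i)^-1).
    apply: (@prod_shift R o (fun r =>
      if row p r == row k r.+1 then 1 else (1 + rho r.+1 * x i)^-1)) => //.
    by rewrite prednK // rl0 mul0r addr0 invr1; case: ifP.
  by ring.
rewrite mulr0; apply: contra_notP nv => /eqP/prodf_neq0 h r.
case: (ltnP r l) => [rl|lr]; last by rewrite !(row_out _ lr).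
have := h (Ordinal rl) isT; rewrite /= E //.
case: (boolP (stepB r k p 0)) => [/andP[-> /eqP e] _|_].
  by rewrite e; case: r rl {e} => [|r] rl; rewrite addn0 ?leqW // (leq_trans (geq_minl _ _)).
case: (boolP (stepB r k p 1)) => [/andP[-> /eqP e] _|_]; last by rewrite !mulr0n addr0 eqxx.
by rewrite /= e; case: r rl {e} => [|r] rl; rewrite addn1 ?geq_minl.
Qed.

(** A pushed particle moves for both values of its weight. The extra [rho^-1] in [cellD] accounts
    for this: (1 + rho x)^-1 rho (x + rho^-1) = 1. *)
Lemma kernelD i k p : bernoulli_weights P l rho x w ->
  \prod_(j < l) pr (w j i @^-1` [set v | row p j == maxn (row k j + v)%N (row p j.+1)]) =
  (\prod_(j < l) (1 + rho j * x i)^-1) * ((rowmon rho k)^-1 * rowmon rho p) *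
  kD (fun r => (rho r)^-1) (x i) k p.
Proof.
move=> hw; pose A j v := row p j == maxn (row k j + v)%N (row p j.+1).
have E j : (j < l)%N -> pr (w j i @^-1` [set v | A j v]) =
   (1 + rho j * x i)^-1 *+ A j 0%N + (rho j * x i / (1 + rho j * x i)) *+ A j 1%N.
  by move=> jl; exact: (pr_bern hdrive hw).
case: (boolP (vstrip k p)) => [/vstripP hv|nv].
  have kp r : (row k r <= row p r)%N by case/andP: (hv r).
  rewrite rowmon_ratio // -!big_split; apply: eq_bigr => -[j jl] _ /=; rewrite E //.
  have n0 : 1 + rho j * x i != 0 by rewrite gt_eqF // addr_gt0 // hrhox.
  have r0 := hrho jl; have dp := row_dec p j.
  have [e|e] : row p j = row k j \/ row p j = (row k j).+1 by have := hv j; lia.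
    rewrite /A /cellD e subnn eqxx expr0 !mulr1 addn0; rewrite e in dp.
    rewrite (maxn_idPl dp) eqxx (_ : _ == _ = false) ?mulr0n ?addr0 //.
    by rewrite addn1 (maxn_idPl (leqW dp)) ltn_eqF.
  rewrite /A /cellD e (_ : (row k j).+1 == row k j = false); last by rewrite gtn_eqF.
  rewrite eqxx subSnn expr1 addn1 addn0; rewrite e in dp.
  rewrite (maxn_idPl dp) eqxx mulr1n; case: (ltnP (row k j) (row p j.+1)) => h.
    rewrite (_ : _ == _ = true); last by lia.
    by rewrite !mulr1n; field; rewrite r0 n0.
  by rewrite ?(maxn_idPl h) gtn_eqF // !mulr0n add0r addr0; field.
have -> : kD (fun r => (rho r)^-1) (x i) k p = 0.
  move: nv; rewrite negb_forall => /existsP[r hr]; rewrite /kD (bigD1 r) //=.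
  by rewrite cellD_supp ?mul0r //; apply: contraNneq hr => ->; rewrite ?leqnn ?leqnSn.
rewrite mulr0; apply/eqP; apply: contraNT nv => /prodf_neq0 h.
have nz j : (j < l)%N -> A j 0%N \/ A j 1%N.
  move=> jl; have := h (Ordinal jl) isT; rewrite /= E //.
  by case: (A j 0%N); case: (A j 1%N); rewrite ?mulr0n ?addr0 ?eqxx //; [left|left|right].
apply/vstripP => r; apply/andP; split.
  case: (ltnP r l) => [rl|lr]; last by rewrite !(row_out _ lr).
  by case: (nz r rl) => /eqP ->; rewrite (leq_trans _ (leq_maxl _ _)) // leq_addr.
(* Induction from the last particle upwards: a pushed particle ends at [row p j.+1], which is at
   most [(row k j.+1).+1] and hence at most [(row k j).+1]. *)
suff H s j : (l - j <= s)%N -> (row p j <= (row k j).+1)%N by exact: (H l r (leq_subr _ _)).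
elim: s j => [|s IH] j hj.
  by rewrite row_out // -subn_eq0 -leqn0.
case: (ltnP j l) => [jl|lj]; last by rewrite row_out.
have h1 : (row p j.+1 <= (row k j).+1)%N.
  apply: leq_trans (IH j.+1 _) _; last by rewrite ltnS row_dec.
  by rewrite -ltnS -subnSK // in hj *.
by case: (nz j jl) => /eqP ->; rewrite geq_max h1 ?addn0 ?addn1 ?leqnSn ?leqnn.
Qed.

End StepKernels.

(** * The four transition formulas *)

Section FourCases.
Context (R : realType) (l : nat) (hl : (1 <= l)%N) (lam mu : seq nat).
Hypotheses (hlam : is_partition lam) (hmu : is_partition mu).
Hypotheses (hlaml : (size lam <= l)%N) (hmul : (size mu <= l)%N) (hlam1 : (head 0%N lam <= l)%N).
Variables (pi rho x : nat -> R).
Hypothesis hpi0 : forall j, (l <= j)%N -> pi j = 0.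
Hypothesis hrho0 : forall j, (l <= j)%N -> rho j = 0.
Hypothesis hpix : forall i j, (j < l)%N -> 0 < pi j * x i < 1.
Hypothesis hrhox : forall i j, (j < l)%N -> 0 < rho j * x i.
Variables (n : nat) (d : measure_display) (T : measurableType d) (P : probability T R).
Variables (w G : nat -> nat -> T -> nat).
Hypothesis hdrive : independent_drive P l w G.
Hypothesis hmu0 : P (config_at l G 0 mu) <> 0%E.

Let flam : fits l lam := fits_lam hlam hlaml hlam1.
Let fmu (hs : sub_part mu lam) : fits l mu := fits_mu hmu hmul hlam1 hs.
Let a : shape l := shape_of l mu.
Let z : shape l := shape_of l lam.

Let pi_neq0 j : (j < l)%N -> pi j != 0.
Proof.
move=> jl; apply: contraTneq (hpix 0%N jl) => ->.
by rewrite mul0r ltxx.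
Qed.

Let rho_neq0 j : (j < l)%N -> rho j != 0.
Proof.
move=> jl; apply: contraTneq (hrhox 0%N jl) => ->.
by rewrite mul0r ltxx.
Qed.

Lemma not_sub_prob : monotone_dynamics l G -> ~~ sub_part mu lam ->
  transition_prob P l G n lam mu = 0.
Proof.
by move=> md /negP ns; apply: transition_prob0 => // h; apply: ns; apply/(sub_partP lam hmul).
Qed.

Lemma conj_sub_part : sub_part (conj_part mu) (conj_part lam) = sub_part mu lam.
Proof.
have H s t : is_partition s -> is_partition t -> sub_part s t ->
    sub_part (conj_part s) (conj_part t).
  move=> ps pt /allP h; apply/allP => j _; rewrite !nth_conj //.
  rewrite leqNgt; apply/negP; rewrite count_lt_partition // => h'.
  have : (nth 0 s (count (fun x => j < x)%N t) <= nth 0 t (count (fun x => j < x)%N t))%N.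
    set r := count _ _; case: (ltnP r (size s)) => [rs|/(nth_default 0%N) -> //].
    by apply: h; rewrite mem_iota.
  by move=> /(leq_trans h'); rewrite -count_lt_partition // ltnn.
have K s : is_partition s -> conj_part (conj_part s) = s.
  by move=> ps; apply: (@conj_partK (maxn (size s) (head 0%N s))); rewrite /fits ps leq_maxl leq_maxr.
apply/idP/idP => h; last exact: H.
by have := H _ _ (conj_is_partition hmu) (conj_is_partition hlam) h; rewrite !K.
Qed.

Theorem prob_caseA : geometric_weights P l pi x w -> caseA l w G ->
  transition_prob P l G n lam mu =
    (\prod_(j < l) \prod_(i < n) (1 - pi j * x i)) * skew_monomial l pi lam mu *
    fps_eval n x (g_skew lam mu (fun r => (pi r)^-1)).
Proof.
move=> hw hA; have md := caseA_mono hA.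
case: (boolP (sub_part mu lam)) => hs; last first.
  by rewrite not_sub_prob // fps_eval0 ?mulr0 // => m; rewrite /g_skew (negbTE hs).
rewrite (transition_prob_psum hdrive n (A := fun j k p v =>
  row p j == (maxn (row k j) (row p j.+1) + v)%N) flam (fmu hs) md) //; last first.
  by move=> t i k p hk; apply: (backward_step (f := fun g h v => (maxn g h + v)%N)) => // j jl;
     rewrite hA.
rewrite (@psum_rowmon R l lam mu hlam hmu hlaml hmul hlam1 n pi _
  (fun i => kA (fun r => (pi r)^-1) (x i)) (fun i => \prod_(j < l) (1 - pi j * x i))) //; last first.
  by move=> i k p _; exact: kernelA.
rewrite [in RHS]exchange_big; congr (_ * _); apply/esym.
apply: (@fps_eval_psum R l n x _ a z (fun k p e => (pA (fun r => (pi r)^-1) k p)`_e)).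
  by move=> m hm; exact: (g_skew_chains flam (fmu hs) hs _ hm).
by move=> i k p; rewrite -horner_pA; exact: rational_sum_poly.
Qed.

Theorem prob_caseC (beta : nat -> R) : (forall j, beta j = pi j.+1) ->
  geometric_weights P l pi x w -> caseC l w G ->
  transition_prob P l G n lam mu =
    (\prod_(i < n) (1 - pi 0%N * x i)) * skew_monomial l pi lam mu *
    fps_eval n x (Gb_dslash lam mu beta).
Proof.
move=> hbeta hw hC; have md := caseC_mono hC.
case: (boolP (sub_part mu lam)) => hs; last first.
  by rewrite not_sub_prob // fps_eval0 ?mulr0 // => m; rewrite /Gb_dslash /G_dslash (negbTE hs).
rewrite (transition_prob_psum hdrive n (A := @stepC l) flam (fmu hs) md) //; last exact: caseC_step.
rewrite (@psum_rowmon R l lam mu hlam hmu hlaml hmul hlam1 n pi _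
  (fun i => kGv false (fun r _ => - (0 + beta r)) (x i)) (fun i => 1 - pi 0%N * x i)) //; last first.
  move=> i k p _; rewrite (kernelC hdrive pi_neq0 _ _ _ hl hw (hpi0 (leqnn l))).
  by rewrite !kGv_rows; case: ifP => // _; congr (_ * _); apply: eq_bigr => r _; rewrite hbeta.
congr (_ * _); apply/esym.
apply: (@fps_eval_psum R l n x _ a z (kG false (fun r _ => - (0 + beta r)))).
  by move=> m hm; exact: (@hook_chains R l n false lam mu flam (fmu hs) hs (fun=> 0) beta m hm erefl).
by move=> i k p; exact: kG_eval.
Qed.

Theorem prob_caseB (alpha : nat -> R) : (forall j, alpha j = rho j.+1) ->
  bernoulli_weights P l rho x w -> caseB l w G ->
  transition_prob P l G n lam mu =
    skew_monomial l rho lam mu / (\prod_(i < n) (1 + rho 0%N * x i)) *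
    fps_eval n x (J_dslash (conj_part lam) (conj_part mu) alpha).
Proof.
move=> halpha hw hB; have md := caseB_mono hB.
case: (boolP (sub_part mu lam)) => hs; last first.
  rewrite not_sub_prob // fps_eval0 ?mulr0 // => m.
  by rewrite /J_dslash /G_dslash conj_sub_part (negbTE hs).
rewrite (transition_prob_psum hdrive n (A := @stepB l) flam (fmu hs) md) //; last exact: caseB_step.
rewrite (@psum_rowmon R l lam mu hlam hmu hlaml hmul hlam1 n rho _
  (fun i k p => kGv true (fun _ c => - (alpha c + 0)) (x i) (tr k) (tr p))
  (fun i => (1 + rho 0%N * x i)^-1)) //; last first.
  move=> i k p _; rewrite (kernelB hdrive rho_neq0 hrhox _ _ _ hl hw (hrho0 (leqnn l))).
  by rewrite !kGv_tr; case: ifP => // _; congr (_ * _); apply: eq_bigr => r _; rewrite halpha.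
rewrite prodfV [(_)^-1 * _]mulrC; congr (_ * _); apply/esym.
(* Relabelling states by transposition gives chains from mu' to lam'. *)
rewrite -(psum_inv n (fun i k p => kGv true (fun _ c => - (alpha c + 0)) (x i) k p) _ _ (@trK l)).
rewrite -!shape_of_conj ?(fmu hs) //.
apply: (@fps_eval_psum R l n x _ (shape_of l (conj_part mu)) (shape_of l (conj_part lam))
  (kG true (fun _ c => - (alpha c + 0)))).
  move=> m hm; apply: (@hook_chains R l n true _ _ _ _ _ alpha (fun=> 0) m hm erefl).
  - exact: fits_conj.
  - exact: fits_conj (fmu hs).
  - by rewrite conj_sub_part.
(* Positivity of [rho j * x i] keeps the denominators nonzero; beyond l the parameter is 0 and the
   denominator 1. *)
move=> i k p; apply: kG_eval => c r _; rewrite addr0 mulNr opprK halpha gt_eqF //.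
case: (ltnP c.+1 l) => [cl|lc]; first by rewrite addr_gt0 // hrhox.
by rewrite hrho0 // mul0r addr0.
Qed.

Theorem prob_caseD : bernoulli_weights P l rho x w -> caseD l w G ->
  transition_prob P l G n lam mu =
    skew_monomial l rho lam mu / (\prod_(j < l) \prod_(i < n) (1 + rho j * x i)) *
    fps_eval n x (j_skew (conj_part lam) (conj_part mu) (fun r => (rho r)^-1)).
Proof.
move=> hw hD; have md := caseD_mono hD.
have K s : is_partition s -> conj_part (conj_part s) = s.
  by move=> ps; apply: (@conj_partK (maxn (size s) (head 0%N s))); rewrite /fits ps leq_maxl leq_maxr.
rewrite /j_skew !K //.
case: (boolP (sub_part mu lam)) => hs; last first.
  rewrite not_sub_prob // fps_eval0 ?mulr0 // => m.
  (* The zero series has the empty Schur expansion, so its image is 0. *)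
  rewrite (@omegaE R _ (fun=> 0)) //; exists [::], (fun=> 0); split=> // m0; rewrite big_nil //.
  by rewrite /g_skew (negbTE hs).
rewrite (transition_prob_psum hdrive n (A := fun j k p v =>
  row p j == maxn (row k j + v)%N (row p j.+1)) flam (fmu hs) md) //; last first.
  by move=> t i k p hk; apply: (backward_step (f := fun g h v => maxn (g + v)%N h)) => // j jl;
     rewrite (caseD_rec hD).
rewrite (@psum_rowmon R l lam mu hlam hmu hlaml hmul hlam1 n rho _
  (fun i => kD (fun r => (rho r)^-1) (x i)) (fun i => \prod_(j < l) (1 + rho j * x i)^-1)) //; last first.
  by move=> i k p _; exact: (kernelD hdrive rho_neq0 hrhox).
rewrite exchange_big /= [X in X * _ * _](_ : _ = (\prod_(j < l) \prod_(i < n) (1 + rho j * x i))^-1).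
  rewrite [(_)^-1 * _]mulrC; congr (_ * _); apply/esym.
  apply: (@fps_eval_psum R l n x _ a z (fun k p e => (pD (fun r => (rho r)^-1) k p)`_e)).
    by move=> m hm; exact: (omega_g flam (fmu hs) hs _ hm).
  by move=> i k p; rewrite -horner_pD; exact: rational_sum_poly.
by rewrite -prodfV; apply: eq_bigr => j _; rewrite prodfV.
Qed.

End FourCases.

Unset Implicit Arguments.

Theorem theorem1p1 (R : realType) (l : nat) (hl : (1 <= l)%N)
    (lam mu : seq nat)
    (hlam : is_partition lam) (hmu : is_partition mu)
    (hlaml : (size lam <= l)%N) (hmul : (size mu <= l)%N)
    (hlam1 : (head 0%N lam <= l)%N)
    (pi rho x : nat -> R)
    (hpi0 : forall j, (l <= j)%N -> pi j = 0)
    (hrho0 : forall j, (l <= j)%N -> rho j = 0)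
    (hpix : forall i j, (j < l)%N -> 0 < pi j * x i < 1)
    (hrhox : forall i j, (j < l)%N -> 0 < rho j * x i)
    (alpha beta : nat -> R)
    (halpha : forall j, alpha j = rho j.+1)
    (hbeta : forall j, beta j = pi j.+1)
    (n : nat) (hn : (1 <= n)%N)
    (d : measure_display) (T : measurableType d) (P : probability T R)
    (w G : nat -> nat -> T -> nat)
    (hdrive : independent_drive P l w G)
    (hmu0 : P (config_at l G 0 mu) <> 0%E) :
  [/\ geometric_weights P l pi x w -> caseA l w G ->
        transition_prob P l G n lam mu =
          (\prod_(j < l) \prod_(i < n) (1 - pi j * x i)) *
          skew_monomial l pi lam mu *
          fps_eval n x (g_skew lam mu (fun r => (pi r)^-1)),
      bernoulli_weights P l rho x w -> caseB l w G ->
        transition_prob P l G n lam mu =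
          skew_monomial l rho lam mu / (\prod_(i < n) (1 + rho 0%N * x i)) *
          fps_eval n x (J_dslash (conj_part lam) (conj_part mu) alpha),
      geometric_weights P l pi x w -> caseC l w G ->
        transition_prob P l G n lam mu =
          (\prod_(i < n) (1 - pi 0%N * x i)) *
          skew_monomial l pi lam mu *
          fps_eval n x (Gb_dslash lam mu beta)
    & bernoulli_weights P l rho x w -> caseD l w G ->
        transition_prob P l G n lam mu =
          skew_monomial l rho lam mu /
            (\prod_(j < l) \prod_(i < n) (1 + rho j * x i)) *
          fps_eval n x
            (j_skew (conj_part lam) (conj_part mu) (fun r => (rho r)^-1))].
Proof.
split=> hw hc.
- exact: (prob_caseA hlam hmu hlaml hmul hlam1 hpix n hdrive hmu0 hw hc).
- exact: (prob_caseB hl hlam hmu hlaml hmul hlam1 hrho0 hrhox n hdrive hmu0 halpha hw hc).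
- exact: (prob_caseC hl hlam hmu hlaml hmul hlam1 hpi0 hpix n hdrive hmu0 hbeta hw hc).
- exact: (prob_caseD hlam hmu hlaml hmul hlam1 hrhox n hdrive hmu0 hw hc).
Qed.
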